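(* For all integers $p,q\ge0$, \[e_3^{p,q}(p+q+1,E)_p=\left[{p+q\atop p}\right].\] Equivalently, for all integers $k\ge0$ and $n\ge k+1$, $e_3^{k,n-1-k}(n,E)_k=\left[{n-1\atop k}\right]$.
   Context: Let $E$ be a complex elliptic curve, $x,y$ a basis of $H^1(E;\mathbb{Q})$ with $xy$ generating $H^2$. For $n\ge1$ let $E_2(n)$ be the quotient of the free graded-commutative algebra (for total degree) over $\mathbb{Q}$ on $x_i,y_i$ ($1\le i\le n$) of bidegree $(1,0)$ and $\omega_{ij}=\omega_{ji}$ ($i\ne j$) of bidegree $(0,1)$ by the relations $(x_i-x_j)\omega_{ij}=0$, $(y_i-y_j)\omega_{ij}=0$, $\omega_{ij}\omega_{jk}+\omega_{jk}\omega_{ki}+\omega_{ki}\omega_{ij}=0$ (distinct $i,j,k$), with the derivation $d_2$ of bidegree $(2,-1)$, $d_2x_i=d_2y_i=0$, $d_2\omega_{ij}=(x_i-x_j)(y_i-y_j)$; this is the second page of the rational Leray spectral sequence of the inclusion into $E^n$ of the configuration space of $n$ distinct ordered points of $E$. Let $E_2(n,E)$ be the sub-differential bigraded algebra generated by the $x_i-x_j$, $y_i-y_j$, $\omega_{ij}$ (the corresponding $E_2$ page for the quotient by diagonal translation by $E$), and $E_3^{p,q}(n,E)$ its $d_2$-cohomology in bidegree $(p,q)$. $\mathrm{SL}_2(\mathbb{Q})$ acts through its standard representation on each pair $(x_i,y_i)$ (as on $(x,y)$), trivially on the $\omega_{ij}$, commuting with $d_2$; $e_3^{p,q}(n,E)_k$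 is the multiplicity of the irreducible $(k+1)$-dimensional representation $\mathbb{V}_k$ in $E_3^{p,q}(n,E)$. $\left[{a\atop b}\right]$ denotes the unsigned Stirling number of the first kind. *)

(* Defs.v *)
From HB Require Import structures.
From mathcomp Require Import all_boot all_order all_algebra.
From mathcomp Require Import boolp.
Set Implicit Arguments. Unset Strict Implicit. Unset Printing Implicit Defensive.
Import Order.TTheory GRing.Theory Num.Theory.
Local Open Scope ring_scope.

(* Generators of the free graded-commutative algebra.  All generators have   *)
(* total degree 1, so the free graded-commutative algebra is the exterior    *)
(* algebra on them.                                                           *)
(*   inl (i, true)  = x_i,   inl (i, false) = y_i      (bidegree (1,0))       *)
(*   inr (i, j), i < j  = omega_ij = omega_ji            (bidegree (0,1))      *)
Definition gen (n : nat) : finType :=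
  (('I_n * bool) + {ij : 'I_n * 'I_n | (ij.1 < ij.2)%N})%type.

Definition isX n (g : gen n) : bool := if g is inl _ then true else false.

(* The exterior algebra Lambda(n): rational coefficients on the monomial      *)
(* basis indexed by subsets of generators.                                    *)
Definition Lam (n : nat) := {ffun {set gen n} -> rat^o}.

Section Ext.
Variable n : nat.
Local Notation Lam := (Lam n).
Local Notation gen := (gen n).

(* basis monomial indexed by S (product of its generators in enum order) *)
Definition eS (S : {set gen}) : Lam := [ffun T => (T == S)%:R].

Definition sgnST (S T : {set gen}) : rat :=
  (-1) ^+ #|[set st : gen * gen | (st.1 \in S) && (st.2 \in T)
                                  && (enum_rank st.2 < enum_rank st.1)%N]|.

Definition mul (a b : Lam) : Lam :=
  [ffun U => \sum_(S : {set gen}) \sum_(T : {set gen})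
     (if [disjoint S & T] && (S :|: T == U) then sgnST S T * a S * b T else 0)].

Definition one : Lam := eS set0.

Definition genL (g : gen) : Lam := eS [set g].

Definition prodL (l : seq Lam) : Lam := foldr mul one l.

Definition xL (i : 'I_n) : Lam := genL (inl (i, true)).
Definition yL (i : 'I_n) : Lam := genL (inl (i, false)).
(* omega_ij = omega_ji (zero if i = j, never used) *)
Definition omL (i j : 'I_n) : Lam :=
  \sum_(s : {ij : 'I_n * 'I_n | (ij.1 < ij.2)%N} |
          (val s == (i, j)) || (val s == (j, i))) genL (inr s).

Definition Lpq (p q : nat) : {vspace Lam} :=
  <<[seq eS Sg | Sg <- enum [set Sg : {set gen} |
       (#|[set g in Sg | isX g]| == p) && (#|[set g in Sg | ~~ isX g]| == q)]]>>%VS.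

Definition rels : seq Lam :=
  [seq mul (xL ij.1 - xL ij.2) (omL ij.1 ij.2)
     | ij <- enum [set ij : 'I_n * 'I_n | ij.1 != ij.2]]
  ++ [seq mul (yL ij.1 - yL ij.2) (omL ij.1 ij.2)
     | ij <- enum [set ij : 'I_n * 'I_n | ij.1 != ij.2]]
  ++ [seq let: (i, j, k) := t in
          mul (omL i j) (omL j k) + mul (omL j k) (omL k i) + mul (omL k i) (omL i j)
     | t <- enum [set t : 'I_n * 'I_n * 'I_n |
                   [&& t.1.1 != t.1.2, t.1.2 != t.2 & t.2 != t.1.1]]].

(* the (two-sided, homogeneous) ideal generated by the relations: spanned by *)
(* monomial multiples of relations (graded-commutativity makes left          *)
(* multiples suffice)                                                        *)
Definition Ideal : {vspace Lam} :=
  <<[seq mul (eS Sg) r | Sg <- enum [set: {set gen}], r <- rels]>>%VS.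

Definition subgens : seq Lam :=
  [seq xL ij.1 - xL ij.2 | ij <- enum [set ij : 'I_n * 'I_n | ij.1 != ij.2]]
  ++ [seq yL ij.1 - yL ij.2 | ij <- enum [set ij : 'I_n * 'I_n | ij.1 != ij.2]]
  ++ [seq omL ij.1 ij.2 | ij <- enum [set ij : 'I_n * 'I_n | ij.1 != ij.2]].

(* the sub-algebra (in Lambda) generated by subgens: spanned by all products *)
(* of (distinct entries of) subgens; products with repetitions vanish and    *)
(* reordering only changes signs, since all generators have odd degree.     *)
Definition Subalg : {vspace Lam} :=
  <<[seq prodL [seq nth (0 : Lam)%R subgens (val i) | i : 'I_(size subgens) <- enum A]
       | A : {set 'I_(size subgens)} <- enum [set: {set 'I_(size subgens)}]]>>%VS.

Definition dgen (g : gen) : Lam :=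
  match g with
  | inl _ => 0
  | inr s => mul (xL (val s).1 - xL (val s).2) (yL (val s).1 - yL (val s).2)
  end.

Fixpoint dmon (l : seq gen) : Lam :=
  match l with
  | [::] => 0
  | g :: l' => mul (dgen g) (prodL (map genL l')) - mul (genL g) (dmon l')
  end.

Definition d2fun (a : Lam) : Lam := \sum_(S : {set gen}) a S *: dmon (enum S).
Definition d2 : 'End(Lam) := linfun d2fun.

(* preimages in Lambda^{p,q} of the pieces of E_2(n,E), its cycles, its     *)
(* boundaries                                                                *)
Definition Ipq (p q : nat) : {vspace Lam} := (Ideal :&: Lpq p q)%VS.
Definition Apq (p q : nat) : {vspace Lam} := ((Subalg :&: Lpq p q) + Ipq p q)%VS.
Definition Zpq (p q : nat) : {vspace Lam} := (Apq p q :&: (d2 @^-1: Ideal))%VS.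
Definition Bpq (p q : nat) : {vspace Lam} :=
  ((if (2 <= p)%N then (d2 @: Apq (p - 2) q.+1)%VS else 0%VS) + Ipq p q)%VS.
(* E_3^{p,q}(n,E) = Zpq p q / Bpq p q *)

Definition act_gen (g : 'M[rat]_2) (s : gen) : Lam :=
  match s with
  | inl (i, true) => g 0 0 *: xL i + g 1 0 *: yL i
  | inl (i, false) => g 0 1 *: xL i + g 1 1 *: yL i
  | inr _ => genL s
  end.

Definition actL (g : 'M[rat]_2) (a : Lam) : Lam :=
  \sum_(S : {set gen}) a S *: prodL [seq act_gen g s | s <- enum S].

End Ext.

(* V_k = Sym^k of the standard representation, on the basis                 *)
(* x^(k-i) y^i (i < k+1), acting on row vectors: row i of symk k g lists the  *)
(* coordinates of g.(x^(k-i) y^i) = (a x + c y)^(k-i) (b x + d y)^i.         *)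
Definition symk (k : nat) (g : 'M[rat]_2) : 'M[rat]_(k.+1) :=
  \matrix_(i < k.+1, j < k.+1)
     ((((g 0 0)%:P + (g 1 0) *: 'X) ^+ (k - i)
       * ((g 0 1)%:P + (g 1 1) *: 'X) ^+ i)`_j).

(* A linear map f : V_k -> E_3^{p,q}(n,E) is given by lifts w_i in Z^{p,q}  *)
(* of the images of the basis vectors; it is SL_2(Q)-equivariant iff        *)
(* g.(w i) - sum_j (symk k g) i j w_j lies in B^{p,q} for all g, i.          *)
Definition equiv_lift (n p q k : nat) (w : {ffun 'I_k.+1 -> Lam n}) : Prop :=
  (forall i, w i \in Zpq n p q) /\
  (forall g : 'M[rat]_2, \det g = 1 -> forall i,
     actL g (w i) - \sum_j symk k g i j *: w j \in Bpq n p q).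

Definition lift_dim (n p q k : nat) : nat :=
  \max_(m < (\dim {: {ffun 'I_k.+1 -> Lam n}}%VS).+1 |
          `[< exists s : seq {ffun 'I_k.+1 -> Lam n},
               [/\ size s = m, free s & forall w, w \in s -> @equiv_lift n p q k w] >])
     m.

(* e_3^{p,q}(n,E)_k = dim Hom_{SL_2(Q)}(V_k, E_3^{p,q}(n,E))                 *)
(*                 = dim(equivariant lifts) - dim(lifts into B^{p,q})        *)
Definition e3 (n p q k : nat) : nat :=
  lift_dim n p q k - k.+1 * \dim (Bpq n p q).

Fixpoint stirling1 (n k : nat) : nat :=
  match n with
  | 0 => (k == 0)%N
  | n'.+1 => n' * stirling1 n' k + (if k is k'.+1 then stirling1 n' k' else 0)
  end.

(* Main.v *)
(* An SL_2-map from V_p into E_3^{p,q} is determined by the image of the highest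
   weight vector, and weight p in bidegree (p, q) means that no y_i occurs.  Every
   boundary involves some y_i, so the multiplicity is the dimension of the space
   of closed classes in the x_i - x_0 and omega_ij alone.  Put N = p + q.

   Such a class is straightened to a combination of forests on the points
   0, ..., N with q edges.  Sending omega_ij to (x_i - x_j) / (z_i - z_j) for
   distinct rational z_i kills the relations and turns a forest into the product
   of its edge weights times a volume form; linear independence of these products
   (partial fractions) shows that forests are independent modulo the ideal.  The
   same device, with one y_i kept, turns closedness into linear conditions.

   Removing the last point N maps the closed combinations of forests to families
   of closed combinations on N points, indexed by the parent of N and with sum 0;
   the kernel consists of those where N is detached.  If this map is onto, the
   dimension satisfies the Stirling recurrence.  Surjectivity comes from explicit
   closed elements, one for each cyclic word w on 0, ..., N, whose weight function
   is the coefficient of t^q in the product over the cyclic edges (a, b) of w of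
   1 + t / (z_a - z_b).  They arise from the contraction of the product of the
   factors (x_a - x_b) + t omega_ab around the cycle. *)
From HB Require Import structures.
From mathcomp Require Import all_boot all_order all_algebra all_field.
From mathcomp Require Import boolp ring zify.
Require Import Defs.
Set Implicit Arguments. Unset Strict Implicit. Unset Printing Implicit Defensive.
Import Order.TTheory GRing.Theory Num.Theory.
Local Open Scope ring_scope.

(** * Exterior algebra *)

(** Closedness modulo the ideal is hard to test directly: that would call for a normal form of
    classes containing one [y]. Instead [cocycle] collects necessary conditions, which bound the
    closed classes from above, and cyclic words supply genuine closed classes, which bound them from
    below. The bounds meet through [spanned]: by induction on the number of points, a subspace
    containing the forests of all cyclic words contains all cocycles. The induction step rests on
    one computation. When a new point n is inserted into a cyclic word u between its last letter l
    and its first letter x, the weight function becomes, in the variable z_n, a constant plus simple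
    poles at z_x and z_l, with residues plus and minus t times the weight of u. So n gets the
    parents x and l with opposite coefficients, and the part with n detached is the path that opens
    u. Telescoping along u moves the parent of n to any letter. Summing over all openings cancels
    the poles and leaves s - q times u, s being the number of letters, because a set of q cyclic
    edges survives s - q openings. *)

Section ExteriorOps.
Variables (W : lmodType rat) (I : finType) (op : I -> {linear W -> W}).
Hypothesis opC : forall i j w, op i (op j w) = - op j (op i w).
Hypothesis op2 : forall i w, op i (op i w) = 0.

Definition ops (l : seq I) (w : W) : W := foldr (fun i v => op i v) w l.

Lemma ops_cat l1 l2 w : ops (l1 ++ l2) w = ops l1 (ops l2 w).
Proof. exact: foldr_cat. Qed.

Lemma ops0 l : ops l 0 = 0.
Proof. by elim: l => //= i l ->; rewrite linear0. Qed.

Lemma op_ops i l w : op i (ops l w) = (-1) ^+ size l *: ops l (op i w).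
Proof.
elim: l => [|j l IH] /=; first by rewrite scale1r.
by rewrite opC IH linearZ /= exprS mulN1r scaleNr.
Qed.

Definition before (A : {set I}) (i : I) :=
  #|[set j in A | (enum_rank j < enum_rank i)%N]|.

Let lt_rank (i j : I) := (enum_rank i < enum_rank j)%N.

Lemma enum_pairwise (A : {set I}) : pairwise lt_rank (enum A).
Proof.
rewrite {1}/enum_mem; apply: subseq_pairwise (filter_subseq _ _) _.
rewrite -enumT; case def_e: (enum I) => [|x0 e] //; rewrite -def_e.
have rk i : (i < size (enum I))%N -> enum_rank (nth x0 (enum I) i) = i :> nat.
  move=> lt_i; have lt_i' : (i < #|I|)%N by rewrite cardE.
  by rewrite -(enum_val_nth x0 (Ordinal lt_i')) enum_valK.
by apply/(pairwiseP x0) => i j lt_i lt_j; rewrite /lt_rank !rk.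
Qed.

(** Sorting: [enum A] splits at the rank of [i] into [lo] and [hi], and moving [op i] past [lo]
    costs one sign per element of [lo], which is what [before] counts. *)
Lemma op_enum (A : {set I}) i w :
  op i (ops (enum A) w) =
  if i \in A then 0 else (-1) ^+ before A i *: ops (enum (i |: A)) w.
Proof.
pose lo := [seq j <- enum A | lt_rank j i].
pose hi := [seq j <- enum A | lt_rank i j].
have tr : transitive lt_rank by move=> a b c; exact: ltn_trans.
have irr : irreflexive lt_rank by move=> a; exact: ltnn.
have pw_lo : pairwise lt_rank lo by exact/pairwise_filter/enum_pairwise.
have pw_hi : pairwise lt_rank hi by exact/pairwise_filter/enum_pairwise.
have eqmid (B : {set I}) (mid : seq I) : pairwise lt_rank mid ->
    all (pred1 i) mid -> B =i (lo ++ mid ++ hi) -> enum B = lo ++ mid ++ hi.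
  move=> pw_mid all_mid eqB; apply: (irr_sorted_eq tr irr).
  - by rewrite (sorted_pairwise tr) enum_pairwise.
  - rewrite (sorted_pairwise tr) !pairwise_cat pw_lo pw_hi pw_mid /= !andbT.
    rewrite allrel_catr -!andbA; apply/and3P; split; apply/allrelP => a b.
    + by rewrite mem_filter => /andP[la _] /(allP all_mid)/eqP->.
    + rewrite !mem_filter => /andP[la _] /andP[lb _]; exact: tr la lb.
    + by move=> /(allP all_mid)/eqP->; rewrite mem_filter => /andP[].
  - by move=> j; rewrite mem_enum eqB.
have mem_lo j : (j \in lo) = lt_rank j i && (j \in A) by rewrite mem_filter mem_enum.
have mem_hi j : (j \in hi) = lt_rank i j && (j \in A) by rewrite mem_filter mem_enum.
have tri j : j != i -> lt_rank j i || lt_rank i j.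
  by rewrite /lt_rank -neq_ltn -(inj_eq enum_rank_inj).
have allP1 : all (pred1 i) [:: i] by rewrite /= eqxx.
have [iA|niA] := ifPn.
  rewrite (eqmid A [:: i]) //; last first.
    move=> j; rewrite !mem_cat inE mem_lo mem_hi.
    have [->|/tri] := eqVneq j i; first by rewrite iA orbT.
    by case/orP=> -> /=; rewrite ?orbT ?andbT /=; case: (j \in A); rewrite ?andbF ?orbT.
  by rewrite ops_cat op_ops /= op2 ops0 scaler0.
rewrite (eqmid A [::]) //; last first.
  move=> j; rewrite !mem_cat /= mem_lo mem_hi.
  have [->|/tri] := eqVneq j i; first by rewrite (negPf niA) !andbF.
  by case/orP=> -> /=; case: (j \in A); rewrite ?andbF ?orbT.
rewrite (eqmid (i |: A) [:: i]) //; last first.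
  move=> j; rewrite !inE !mem_cat inE mem_lo mem_hi.
  have [->|/tri] := eqVneq j i; first by rewrite ?orbT.
  by case/orP=> -> /=; case: (j \in A); rewrite ?andbF ?orbT.
rewrite !ops_cat op_ops /=; congr (_ ^+ _ *: _).
rewrite /before cardE; congr size.
rewrite /lo /enum_mem -filter_predI; apply: eq_filter => j.
by rewrite /= !inE andbC.
Qed.
End ExteriorOps.

(* [Lam n] is a finite function type and as such already carries the pointwise
   product; the copy [ext n] carries the exterior product. *)
Definition ext (n : nat) : Type := Lam n.
HB.instance Definition _ n := Choice.copy (ext n) (Lam n).
HB.instance Definition _ n := GRing.Lmodule.copy (ext n) {ffun {set gen n} -> rat^o}.
HB.instance Definition _ n := Vector.copy (ext n) {ffun {set gen n} -> rat^o}.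

Section ExteriorRing.
Variable n : nat.
Local Notation gen := (gen n).
Local Notation ext := (ext n).
Implicit Types (a b c : ext) (S T U : {set gen}).

Lemma prod_setU (I : finType) (A B : {set I}) (F : I -> rat) : [disjoint A & B] ->
  \prod_(i in A :|: B) F i = \prod_(i in A) F i * \prod_(i in B) F i.
Proof.
by move=> dAB; rewrite -bigU //; apply: eq_bigl => i; rewrite !inE.
Qed.

Lemma sgnST_prod S T :
  sgnST S T = \prod_(s in S) \prod_(t in T)
                (if (enum_rank t < enum_rank s)%N then -1 else 1).
Proof.
rewrite /sgnST pair_big_dep /= -prodr_const big_mkcondr /=.
rewrite [LHS]big_mkcond [RHS]big_mkcond /=; apply: eq_bigr => -[s t] _ /=.
by rewrite inE /=; case: (s \in S); case: (t \in T).
Qed.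

Lemma sgnSTUl S T U : [disjoint S & T] ->
  sgnST (S :|: T) U = sgnST S U * sgnST T U.
Proof. by move=> dST; rewrite !sgnST_prod prod_setU. Qed.

Lemma sgnSTUr S T U : [disjoint T & U] ->
  sgnST S (T :|: U) = sgnST S T * sgnST S U.
Proof.
move=> dTU; rewrite !sgnST_prod -big_split; apply: eq_bigr => s _ /=.
by rewrite prod_setU.
Qed.

Lemma sgnST0 S : sgnST S set0 = 1.
Proof. by rewrite sgnST_prod big1 // => s _; rewrite big_set0. Qed.

Lemma sgn0ST S : sgnST set0 S = 1.
Proof. by rewrite sgnST_prod big_set0. Qed.

Lemma extZE k a U : (k *: a) U = k * a U.
Proof. by rewrite ffunE. Qed.

Lemma eSE S U : eS S U = (U == S)%:R :> rat.
Proof. by rewrite ffunE. Qed.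

Lemma ext_sumE I (r : seq I) (P : pred I) (F : I -> ext) U :
  (\sum_(i <- r | P i) F i) U = \sum_(i <- r | P i) F i U.
Proof. exact: sum_ffunE. Qed.

Lemma eS_sum a : a = \sum_(S : {set gen}) a S *: (eS S : ext).
Proof.
apply/ffunP => U; rewrite ext_sumE (bigD1 U) //= extZE eSE eqxx mulr1 big1 ?addr0 //.
by move=> S /negPf neSU; rewrite extZE eSE eq_sym neSU mulr0.
Qed.

Lemma mulE_sum a b :
  (mul a b : ext) = \sum_(S : {set gen}) \sum_(T : {set gen})
    (if [disjoint S & T] then (sgnST S T * a S * b T) *: (eS (S :|: T) : ext) else 0).
Proof.
apply/ffunP => U; rewrite ffunE ext_sumE; apply: eq_bigr => S _.
rewrite ext_sumE; apply: eq_bigr => T _; case: ifP => [/andP[-> /eqP->]|].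
  by rewrite extZE eSE eqxx mulr1.
by case: [disjoint S & T] => /= H; rewrite ?extZE ?eSE ?ffunE // eq_sym H mulr0.
Qed.

Lemma mulDl_ext : left_distributive (@mul n : ext -> ext -> ext) +%R.
Proof.
move=> a b c; rewrite !mulE_sum -big_split; apply: eq_bigr => S _ /=.
rewrite -big_split; apply: eq_bigr => T _ /=; case: ifP => _; rewrite ?addr0 //.
by rewrite ffunE -scalerDl mulrDr mulrDl.
Qed.

Lemma mulDr_ext : right_distributive (@mul n : ext -> ext -> ext) +%R.
Proof.
move=> a b c; rewrite !mulE_sum -big_split; apply: eq_bigr => S _ /=.
rewrite -big_split; apply: eq_bigr => T _ /=; case: ifP => _; rewrite ?addr0 //.
by rewrite ffunE -scalerDl mulrDr.
Qed.

Lemma scalerAl_ext k a b : k *: (mul a b : ext) = mul (k *: a) b.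
Proof.
rewrite !mulE_sum scaler_sumr; apply: eq_bigr => S _.
rewrite scaler_sumr; apply: eq_bigr => T _; case: ifP => _; rewrite ?scaler0 //.
by rewrite scalerA ffunE !mulrA [k * _]mulrC.
Qed.

Lemma scalerAr_ext k a b : k *: (mul a b : ext) = mul a (k *: b).
Proof.
rewrite !mulE_sum scaler_sumr; apply: eq_bigr => S _.
rewrite scaler_sumr; apply: eq_bigr => T _; case: ifP => _; rewrite ?scaler0 //.
by rewrite scalerA ffunE mulrCA.
Qed.

Lemma mul_eS S T :
  (mul (eS S) (eS T) : ext) =
  if [disjoint S & T] then sgnST S T *: (eS (S :|: T) : ext) else 0.
Proof.
rewrite mulE_sum (bigD1 S) //= (bigD1 T) //= !eSE !eqxx !mulr1.
rewrite big1 ?addr0 => [|U /negPf neU].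
  rewrite big1 ?addr0 // => U /negPf neU.
  by apply: big1 => V _; rewrite eSE neU mulr0 mul0r scale0r; case: ifP.
by rewrite eSE neU mulr0 scale0r; case: ifP.
Qed.

Lemma mul_sumlE I (r : seq I) (P : pred I) (F : I -> ext) b :
  (mul (\sum_(i <- r | P i) F i) b : ext) = \sum_(i <- r | P i) mul (F i) b.
Proof.
apply: (big_morph (fun x : ext => mul x b : ext)) => [x y|]; first exact: mulDl_ext.
by rewrite -(scale0r (0 : ext)) -scalerAl_ext !scale0r.
Qed.

Lemma mul_sumrE I (r : seq I) (P : pred I) (F : I -> ext) a :
  (mul a (\sum_(i <- r | P i) F i) : ext) = \sum_(i <- r | P i) mul a (F i).
Proof.
apply: (big_morph (fun x : ext => mul a x : ext)) => [x y|]; first exact: mulDr_ext.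
by rewrite -(scale0r (0 : ext)) -scalerAr_ext !scale0r.
Qed.

Lemma mulA_eS S T U :
  (mul (eS S) (mul (eS T) (eS U)) : ext) = mul (mul (eS S) (eS T)) (eS U).
Proof.
rewrite !mul_eS.
have dU : [disjoint S :|: T & U] = [disjoint S & U] && [disjoint T & U].
  by rewrite -!setI_eq0 setIUl setU_eq0.
have dS : [disjoint S & T :|: U] = [disjoint S & T] && [disjoint S & U].
  by rewrite -!setI_eq0 setIUr setU_eq0.
have mul0l a : (mul 0 a : ext) = 0.
  by rewrite -(scale0r (0 : ext)) -scalerAl_ext !scale0r.
have mul0r a : (mul a 0 : ext) = 0.
  by rewrite -(scale0r (0 : ext)) -scalerAr_ext !scale0r.
case dTU: [disjoint T & U]; case dST: [disjoint S & T]; rewrite ?mul0l ?mul0r //.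
- rewrite -scalerAr_ext -scalerAl_ext !mul_eS dU dS dTU dST andbT /=.
  case: ifP => dSU; rewrite ?scaler0 //.
  by rewrite !scalerA setUA sgnSTUr // sgnSTUl //; congr (_ *: _); ring.
- by rewrite -scalerAr_ext mul_eS dS dST scaler0.
- by rewrite -scalerAl_ext mul_eS dU dTU andbF scaler0.
Qed.

Lemma mulA_ext : associative (@mul n : ext -> ext -> ext).
Proof.
move=> a b c; rewrite [a]eS_sum !mul_sumlE; apply: eq_bigr => S _.
rewrite -!scalerAl_ext; congr (_ *: _).
rewrite [b]eS_sum mul_sumlE !mul_sumrE mul_sumlE; apply: eq_bigr => T _.
rewrite -scalerAr_ext -!scalerAl_ext -scalerAr_ext; congr (_ *: _).
rewrite [c]eS_sum !mul_sumrE; apply: eq_bigr => U _.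
by rewrite -!scalerAr_ext mulA_eS.
Qed.

Lemma mul1l_ext : left_id (one n : ext) (@mul n : ext -> ext -> ext).
Proof.
move=> a; rewrite [a]eS_sum mul_sumrE; apply: eq_bigr => S _.
by rewrite -scalerAr_ext mul_eS disjoints_subset sub0set sgn0ST set0U scale1r.
Qed.

Lemma mul1r_ext : right_id (one n : ext) (@mul n : ext -> ext -> ext).
Proof.
move=> a; rewrite [a]eS_sum mul_sumlE; apply: eq_bigr => S _.
by rewrite -scalerAl_ext mul_eS disjoint_sym disjoints_subset sub0set sgnST0 setU0 scale1r.
Qed.

Lemma one_neq0_ext : (one n : ext) != 0.
Proof. by apply/eqP => /ffunP/(_ set0)/eqP; rewrite !ffunE eqxx. Qed.

End ExteriorRing.

HB.instance Definition _ n := GRing.Zmodule_isNzRing.Build (ext n)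
  (@mulA_ext n) (@mul1l_ext n) (@mul1r_ext n) (@mulDl_ext n) (@mulDr_ext n)
  (@one_neq0_ext n).
HB.instance Definition _ n := GRing.Lmodule_isLalgebra.Build rat (ext n)
  (@scalerAl_ext n).
HB.instance Definition _ n := GRing.Lalgebra_isAlgebra.Build rat (ext n)
  (@scalerAr_ext n).

HB.instance Definition _ n := Algebra_isFalgebra.Build rat (ext n).

Definition gL n (s : gen n) : ext n := genL s.

Section Monomials.
Variable n : nat.
Implicit Types (a b : ext n) (s : gen n) (S : {set gen n}).

Lemma mulE a b : mul a b = a * b.
Proof. by []. Qed.

Lemma oneE : one n = 1 :> ext n.
Proof. by []. Qed.

Lemma prodLE (l : seq (ext n)) : prodL l = \prod_(a <- l) a :> ext n.
Proof. by rewrite unlock; elim: l => //= a l ->. Qed.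

Lemma gL_eS s S :
  gL s * eS S = if s \in S then 0 else (-1) ^+ before S s *: (eS (s |: S) : ext n).
Proof.
rewrite -mulE mul_eS disjoints1; case: (s \in S) => //=; congr (_ *: _).
rewrite sgnST_prod big_set1 -big_mkcondr /= prodr_const; congr (_ ^+ _).
by apply: eq_card => t; rewrite !inE.
Qed.

Lemma prod_gL_sorted (l : seq (gen n)) :
  pairwise (fun s t => (enum_rank s < enum_rank t)%N) l ->
  \prod_(s <- l) gL s = eS [set s in l] :> ext n.
Proof.
elim: l => [_|s l IH /= /andP[s_l pw]].
  by rewrite big_nil -oneE /one; congr eS; apply/setP => s; rewrite !inE.
rewrite big_cons IH // gL_eS inE.
have -> : s \in l = false.
  by apply/negP => /(allP s_l); rewrite ltnn.
have -> : before [set t in l] s = 0%N.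
  apply: eq_card0 => t; rewrite !inE; apply/negP => /andP[/(allP s_l) h1 h2].
  by have := ltn_trans h1 h2; rewrite ltnn.
by rewrite scale1r; congr eS; apply/setP => t; rewrite !inE.
Qed.

Lemma eS_prod S : eS S = \prod_(s <- enum S) gL s :> ext n.
Proof.
rewrite prod_gL_sorted ?enum_pairwise //; congr eS.
by apply/setP => s; rewrite inE mem_enum.
Qed.

(** Every basis monomial is an iterated left multiple of 1. This replaces computations with subsets
    and signs in most multiplicative identities below. *)
Lemma ext_ind (P : ext n -> Prop) :
    (forall k a b, P a -> P b -> P (k *: a + b)) -> P 1 ->
    (forall s a, P a -> P (gL s * a)) -> forall a, P a.
Proof.
move=> Plin P1 Pmul a.
have P0 : P 0 by rewrite -[0](subrr 1) addrC -scaleN1r; exact: Plin.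
rewrite [a]eS_sum; apply: (big_ind P) => // [b c Pb Pc|S _].
  by rewrite -[b]scale1r; exact: Plin.
rewrite -[_ *: _]addr0; apply: Plin => //; rewrite eS_prod.
by elim: (enum S) => [|s l IH]; rewrite ?big_nil ?big_cons //; exact: Pmul.
Qed.

End Monomials.

Section Universal.
Variables (n : nat) (W : lmodType rat) (op : gen n -> {linear W -> W}).
Hypothesis opC : forall i j w, op i (op j w) = - op j (op i w).
Hypothesis op2 : forall i w, op i (op i w) = 0.
Variable w0 : W.

(** Universal property of the exterior algebra: anticommuting operators of square 0 make [W] a left
    module, and this is the map sending [a] to [a] acting on [w0]. Both [hom] and the differential
    are obtained from it. *)
Definition ext_rec (a : ext n) : W :=
  \sum_(S : {set gen n}) a S *: ops op (enum S) w0.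

Lemma ext_rec_is_linear : linear ext_rec.
Proof.
move=> k a b; rewrite /ext_rec scaler_sumr -big_split; apply: eq_bigr => S _ /=.
by rewrite !ffunE scalerDl scalerA.
Qed.
HB.instance Definition _ := GRing.isLinear.Build rat (ext n) W *:%R ext_rec ext_rec_is_linear.

Lemma ext_rec_eS S : ext_rec (eS S) = ops op (enum S) w0.
Proof.
rewrite /ext_rec (bigD1 S) //= ffunE eqxx scale1r big1 ?addr0 // => T /negPf neTS.
by rewrite ffunE neTS scale0r.
Qed.

Lemma ext_rec1 : ext_rec 1 = w0.
Proof. by rewrite -oneE /one ext_rec_eS enum_set0. Qed.

Lemma ext_rec_mul s a : ext_rec (gL s * a) = op s (ext_rec a).
Proof.
suff H (c : {set gen n} -> rat) : ext_rec (gL s * \sum_S c S *: (eS S : ext n)) =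
    op s (ext_rec (\sum_S c S *: (eS S : ext n))) by rewrite [a]eS_sum.
have liftE (F : {set gen n} -> ext n) :
    ext_rec (\sum_S c S *: F S) = \sum_S c S *: ext_rec (F S).
  by rewrite [LHS]linear_sum; apply: eq_bigr => S _; rewrite [LHS]linearZ.
rewrite mulr_sumr; under [X in ext_rec X]eq_bigr do rewrite -scalerAr.
rewrite !liftE linear_sum; apply: eq_bigr => S _; rewrite linearZ; congr (_ *: _).
rewrite gL_eS ext_rec_eS op_enum //; case: ifP => _; first by rewrite [LHS]linear0.
by rewrite [LHS]linearZ /= ext_rec_eS.
Qed.
End Universal.

Lemma span_ind (V : vectType rat) (X : seq V) (P : V -> Prop) :
    P 0 -> (forall k a b, P a -> P b -> P (k *: a + b)) ->
    (forall x, x \in X -> P x) ->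
  forall u, u \in <<X>>%VS -> P u.
Proof.
move=> P0 Plin PX u uX; rewrite (coord_span (uX : u \in <<in_tuple X>>%VS)).
apply: (big_ind P) => // [a b Pa Pb|i _]; first by rewrite -[a]scale1r; exact: Plin.
by rewrite -[_ *: _]addr0; apply: Plin => //; apply: PX; exact: mem_nth.
Qed.

Definition lmulf n (u a : ext n) : ext n := u * a.
Lemma lmulf_is_linear n (u : ext n) : linear (lmulf u).
Proof. by move=> k a b; rewrite /lmulf mulrDr scalerAr. Qed.
HB.instance Definition _ n (u : ext n) :=
  GRing.isLinear.Build rat (ext n) (ext n) *:%R (lmulf u) (lmulf_is_linear u).

Section Degree1.
Variable n : nat.
Implicit Types (a b u v : ext n) (s t : gen n).

Definition deg1 : {vspace ext n} := <<[seq gL s | s <- enum [set: gen n]]>>%VS.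

Lemma gL_deg1 s : gL s \in deg1.
Proof. by apply/memv_span/map_f; rewrite mem_enum inE. Qed.

Lemma before1 s t : before [set t] s = (enum_rank t < enum_rank s)%N :> nat.
Proof.
rewrite /before; case: ltnP => h.
  rewrite -[RHS]/1%N -(cards1 t); apply: eq_card => r; rewrite !inE.
  by case: eqVneq => // ->; rewrite h.
apply: eq_card0 => r; rewrite !inE; apply/negP => /andP[/eqP->].
by rewrite ltnNge h.
Qed.

Lemma gL_anti s t : gL s * gL t = - (gL t * gL s).
Proof.
rewrite /gL /genL !gL_eS !inE eq_sym; case: eqVneq => [_|ne]; first by rewrite oppr0.
rewrite !before1 [in RHS]setUC; case: ltngtP => [_|_|h].
- by rewrite expr0 expr1 scaleN1r scale1r.
- by rewrite expr0 expr1 scaleN1r opprK scale1r.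
- by move/val_inj/enum_rank_inj: h ne => ->; rewrite eqxx.
Qed.

Lemma deg1_anti u v : u \in deg1 -> v \in deg1 -> u * v = - (v * u).
Proof.
move: u; apply: span_ind => [_|k a b IHa IHb vd|_ /mapP[s _ ->] vd].
- by rewrite mul0r mulr0 oppr0.
- by rewrite mulrDl mulrDr opprD IHb // -scalerAl IHa // -scalerAr scalerN.
move: v vd; apply: span_ind => [|k a b IHa IHb|_ /mapP[t _ ->]].
- by rewrite mul0r mulr0 oppr0.
- by rewrite mulrDl mulrDr opprD IHb -scalerAl -scalerAr IHa scalerN.
- exact: gL_anti.
Qed.

Lemma deg1_sq u : u \in deg1 -> u * u = 0.
Proof.
move=> ud; have /eqP := deg1_anti ud ud.
rewrite -addr_eq0 -mulr2n -scaler_nat scaler_eq0 pnatr_eq0 /=.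
by move/eqP.
Qed.

End Degree1.

HB.lock Definition hom n n' (gam : gen n -> ext n') (a : ext n) : ext n' :=
  \sum_(S : {set gen n}) a S *: \prod_(s <- enum S) gam s.
Canonical hom_unlockable := Unlockable hom.unlock.

HB.lock Definition d n (a : ext n) : ext n := d2fun a.
Canonical d_unlockable := Unlockable d.unlock.

Section Hom.
Variables (n n' : nat) (gam : gen n -> ext n').
Hypothesis gam1 : forall s, gam s \in deg1 n'.

Local Notation hom := (hom gam).

Lemma homE a : hom a = \sum_(S : {set gen n}) a S *: \prod_(s <- enum S) gam s.
Proof. by rewrite unlock. Qed.

Lemma hom_ext_rec : hom =1 ext_rec (fun s => lmulf (gam s)) 1.
Proof.
move=> a; rewrite homE; apply: eq_bigr => S _; congr (_ *: _).
by elim: (enum S) => [|s l IH]; rewrite ?big_nil ?big_cons //= IH.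
Qed.

Lemma hom_is_linear : linear hom.
Proof. by move=> k a b; rewrite !hom_ext_rec ext_rec_is_linear. Qed.
HB.instance Definition _ := GRing.isLinear.Build rat (ext n) (ext n') *:%R hom hom_is_linear.

Lemma hom1 : hom 1 = 1.
Proof. by rewrite hom_ext_rec ext_rec1. Qed.

Lemma hom_gLM s a : hom (gL s * a) = gam s * hom a.
Proof.
rewrite !hom_ext_rec ext_rec_mul // => [i j w|i w] /=; rewrite /lmulf !mulrA.
  by rewrite (deg1_anti (gam1 i) (gam1 j)) mulNr.
by rewrite deg1_sq // mul0r.
Qed.

Lemma homM a b : hom (a * b) = hom a * hom b.
Proof.
elim/ext_ind: a => [k a a' IHa IHa'||s a IH].
- rewrite mulrDl -scalerAl ![hom (_ *: _ + _)]hom_is_linear IHa IHa'.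
  by rewrite mulrDl scalerAl.
- by rewrite hom1 !mul1r.
- by rewrite -mulrA !hom_gLM IH mulrA.
Qed.

Lemma hom_gL s : hom (gL s) = gam s.
Proof. by rewrite -[gL s]mulr1 hom_gLM hom1 mulr1. Qed.

Lemma hom_deg1 u : u \in deg1 n -> hom u \in deg1 n'.
Proof.
move: u; apply: span_ind => [|k a b IHa IHb|_ /mapP[s _ ->]].
- by rewrite [hom 0]linear0 mem0v.
- by rewrite hom_is_linear memvD ?memvZ.
- by rewrite hom_gL.
Qed.

End Hom.

Section Differential.
Variable n : nat.
Implicit Types (a b u v : ext n) (s t : gen n).

Lemma deg1_mul_comm u v a : u \in deg1 n -> v \in deg1 n -> u * v * a = a * (u * v).
Proof.
move=> ud vd; elim/ext_ind: a => [k a b IHa IHb||s a IH].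
- by rewrite mulrDr mulrDl IHb -scalerAr IHa scalerAl.
- by rewrite mulr1 mul1r.
- have us : u * v * gL s = gL s * (u * v).
    rewrite -mulrA (deg1_anti vd (gL_deg1 s)) mulrN !mulrA.
    by rewrite (deg1_anti ud (gL_deg1 s)) mulNr opprK.
  by rewrite mulrA us -mulrA IH mulrA.
Qed.

Lemma dgen_comm s a : (dgen s : ext n) * a = a * dgen s.
Proof.
case: s => [_|[[i j] ij]] /=; first by rewrite mul0r mulr0.
by rewrite mulE deg1_mul_comm //; apply: memvB; exact: gL_deg1.
Qed.

(** Left multiplication by a generator on pairs [(a, d a)], by the graded Leibniz rule. On pairs
    these operators anticommute and square to 0, so [ext_rec] applies to the differential. *)
Definition dop s (w : ext n * ext n) : ext n * ext n :=
  (gL s * w.1, (dgen s : ext n) * w.1 - gL s * w.2).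
Lemma dop_is_linear s : linear (dop s).
Proof.
move=> k [a b] [a' b']; rewrite /dop /=; congr (_, _) => /=.
  by rewrite mulrDr scalerAr.
rewrite scalerBr !mulrDr !scalerAr opprD -!addrA; congr (_ + _).
by rewrite addrCA.
Qed.
HB.instance Definition _ s :=
  GRing.isLinear.Build rat (ext n * ext n)%type (ext n * ext n)%type *:%R (dop s)
    (dop_is_linear s).

Lemma d2fun_ext_rec a : ((a, d2fun a) : ext n * ext n) = ext_rec dop (1, 0) a.
Proof.
have opsE l : ops dop l (1, 0) = (\prod_(s <- l) gL s, dmon l : ext n).
  elim: l => [|s l IH] /=; first by rewrite big_nil.
  rewrite IH /dop /= big_cons; congr (_, _); rewrite -!mulE prodLE.
  by rewrite big_map.
rewrite /ext_rec; under eq_bigr => S _ do rewrite opsE -eS_prod.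
rewrite {1}[a]eS_sum /d2fun.
elim: (index_enum _) => [|S r IH]; first by rewrite !big_nil.
by rewrite !big_cons -IH.
Qed.

Lemma dopC s t w : dop s (dop t w) = - dop t (dop s w).
Proof.
have st := deg1_anti (gL_deg1 s) (gL_deg1 t); rewrite /dop /=; congr (_, _) => /=.
  by rewrite !mulrA st mulNr.
rewrite !mulrBr !mulrA !(dgen_comm _ (gL _)) st mulNr opprK opprB.
by rewrite opprD addrA addrAC.
Qed.

Lemma dop2 s w : dop s (dop s w) = 0.
Proof.
have ss := deg1_sq (gL_deg1 s); rewrite /dop /=; congr (_, _) => /=.
  by rewrite mulrA ss mul0r.
by rewrite mulrBr !mulrA ss mul0r subr0 dgen_comm subrr.
Qed.

Lemma d2funE a : d2fun a = (ext_rec dop (1, 0) a).2 :> ext n.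
Proof. by rewrite -d2fun_ext_rec. Qed.

Local Notation d := (@d n).

Lemma dE a : d a = (ext_rec dop (1, 0) a).2.
Proof. by rewrite -d2funE unlock. Qed.

Lemma d2fun_is_linear : linear d.
Proof. by move=> k a b; rewrite !dE ext_rec_is_linear. Qed.
HB.instance Definition _ := GRing.isLinear.Build rat (ext n) (ext n) *:%R d
  d2fun_is_linear.

Lemma d2E a : d2 n a = d a.
Proof.
pose f : {linear Lam n -> Lam n} := d.
have -> : d2 n = linfun f by congr linfun; apply/funext => b; rewrite /f /= unlock.
exact: (lfunE f a).
Qed.

Lemma d_gLM s a : d (gL s * a) = (dgen s : ext n) * a - gL s * d a.
Proof.
rewrite !dE ext_rec_mul; [|exact: dopC|exact: dop2].
by rewrite /= /dop -d2fun_ext_rec.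
Qed.

Lemma d1 : d 1 = 0.
Proof. by rewrite dE ext_rec1. Qed.

Lemma d_gL s : d (gL s) = dgen s.
Proof. by rewrite -[gL s]mulr1 d_gLM d1 mulr0 subr0 mulr1. Qed.

Lemma d_deg1M u a : u \in deg1 n -> d (u * a) = d u * a - u * d a.
Proof.
move: u; apply: span_ind => [|k u v IHu IHv|_ /mapP[s _ ->]].
- by rewrite !mul0r linear0 mul0r subr0.
- rewrite mulrDl -scalerAl !linearP /= IHu IHv mulrDl mulrDl -!scalerAl scalerBr.
  by rewrite opprD addrACA.
- by rewrite d_gLM d_gL.
Qed.

End Differential.

(** * The quotient algebra and its differential *)

Section Generators.
Variable n : nat.
Implicit Types (i j k : 'I_n) (a b u v : ext n).

Definition xg i : ext n := xL i.
Definition yg i : ext n := yL i.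
Definition om i j : ext n := omL i j.

Lemma om_sym i j : om i j = om j i.
Proof. by apply: eq_bigl => s; rewrite orbC. Qed.

Lemma om_diag i : om i i = 0.
Proof.
apply: big1 => -[[j k] /= jk]; rewrite orbb => /eqP[ji ki].
by exfalso; move: (jk); rewrite ji ki ltnn.
Qed.

Lemma om_lt i j (ij : (i < j)%N) : om i j = gL (inr (exist _ (i, j) ij)).
Proof.
rewrite /om /omL (big_pred1 (exist _ (i, j) ij)) // => -[[a b] /= ab].
rewrite -val_eqE /=; apply/orP/eqP => [[/eqP//|/eqP[aj bi]]|->]; last by left.
by exfalso; move: (ab); rewrite aj bi ltnNge ltnW.
Qed.

(** [omL] is a sum over sorted pairs with at most one term; symmetric statements about it can be
    checked on generators and on the diagonal, where it is 0. *)
Lemma om_ind (P : 'I_n -> 'I_n -> ext n -> Prop) :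
    (forall i, P i i 0) -> (forall i j u, P i j u -> P j i u) ->
    (forall s, P (val s).1 (val s).2 (gL (inr s))) ->
  forall i j, P i j (om i j).
Proof.
move=> Pd Ps Pg i j; case: (ltngtP i j) => [ij|ij|/val_inj->].
- by rewrite om_lt; exact: (Pg (exist _ (i, j) ij)).
- by rewrite om_sym om_lt; apply: Ps; exact: (Pg (exist _ (j, i) ij)).
- by rewrite om_diag.
Qed.

Lemma xg_deg1 i : xg i \in deg1 n. Proof. exact: gL_deg1. Qed.
Lemma yg_deg1 i : yg i \in deg1 n. Proof. exact: gL_deg1. Qed.
Lemma om_deg1 i j : om i j \in deg1 n.
Proof.
by apply: (om_ind (P := fun _ _ u => u \in deg1 n)) => // [_|s]; rewrite ?mem0v ?gL_deg1.
Qed.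

Definition dx i j : ext n := xg i - xg j.
Definition dy i j : ext n := yg i - yg j.

Lemma dx_deg1 i j : dx i j \in deg1 n.
Proof. by rewrite memvB ?xg_deg1. Qed.
Lemma dy_deg1 i j : dy i j \in deg1 n.
Proof. by rewrite memvB ?yg_deg1. Qed.

Lemma dxN i j : dx j i = - dx i j. Proof. by rewrite /dx opprB. Qed.
Lemma dyN i j : dy j i = - dy i j. Proof. by rewrite /dy opprB. Qed.
Lemma dxD i j k : dx i j + dx j k = dx i k.
Proof. by rewrite /dx addrA subrK. Qed.
Lemma dyD i j k : dy i j + dy j k = dy i k.
Proof. by rewrite /dy addrA subrK. Qed.
Lemma dx_diag i : dx i i = 0. Proof. exact: subrr. Qed.
Lemma dy_diag i : dy i i = 0. Proof. exact: subrr. Qed.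

Lemma d_xg i : d (xg i) = 0. Proof. by rewrite /xg /xL d_gL. Qed.
Lemma d_yg i : d (yg i) = 0. Proof. by rewrite /yg /yL d_gL. Qed.
Lemma d_dx i j : d (dx i j) = 0.
Proof. by rewrite linearB /= !d_xg subrr. Qed.
Lemma d_dy i j : d (dy i j) = 0.
Proof. by rewrite linearB /= !d_yg subrr. Qed.
Lemma d_om i j : d (om i j) = dx i j * dy i j.
Proof.
apply: (om_ind (P := fun i j u => d u = dx i j * dy i j)) => [k|k l u ->|s].
- by rewrite linear0 dx_diag mul0r.
- by rewrite dxN dyN mulrNN.
- by rewrite d_gL.
Qed.

Lemma rels_ind (P : ext n -> Prop) :
    (forall i j, P (dx i j * om i j)) -> (forall i j, P (dy i j * om i j)) ->
    (forall i j k, P (om i j * om j k + om j k * om k i + om k i * om i j)) ->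
  forall r, r \in rels n -> P r.
Proof.
move=> Px Py Po r; rewrite !mem_cat => /or3P[]/mapP[].
- by case=> i j _ ->; exact: Px.
- by case=> i j _ ->; exact: Py.
- by case=> [[i j] k] _ ->; exact: Po.
Qed.

Lemma Ideal_rel a r : r \in rels n -> a * r \in Ideal n.
Proof.
move=> rr; rewrite [a]eS_sum mulr_suml; apply: memv_suml => S _.
rewrite -scalerAl memvZ //; apply/memv_span/allpairsP.
by exists (S, r); rewrite mem_enum inE.
Qed.

Lemma Ideal_ind (P : ext n -> Prop) :
    P 0 -> (forall (k : rat) a b, P a -> P b -> P (k *: a + b)) ->
    (forall a i j, P (a * (dx i j * om i j))) ->
    (forall a i j, P (a * (dy i j * om i j))) ->
    (forall a i j k,
       P (a * (om i j * om j k + om j k * om k i + om k i * om i j))) ->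
  forall r, r \in Ideal n -> P r.
Proof.
move=> P0 Plin Px Py Po; apply: span_ind => // _ /allpairsP[[S r] [_ /= rr ->]].
rewrite mulE; elim/rels_ind: rr; [exact: Px|exact: Py|exact: Po].
Qed.

Lemma Ideal_mull a b : b \in Ideal n -> a * b \in Ideal n.
Proof.
move: b; apply: span_ind => [|k b c IHb IHc|_ /allpairsP[[S r] [_ /= rr ->]]].
- by rewrite mulr0 mem0v.
- by rewrite mulrDr -scalerAr memvD ?memvZ.
- by rewrite mulE mulrA Ideal_rel.
Qed.

Lemma Ideal_x i j : dx i j * om i j \in Ideal n.
Proof.
have [->|ij] := eqVneq i j; first by rewrite dx_diag mul0r mem0v.
rewrite -[_ * _]mul1r Ideal_rel // !mem_cat; apply/or3P/Or31/mapP.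
by exists (i, j); rewrite // mem_enum inE.
Qed.

Lemma Ideal_y i j : dy i j * om i j \in Ideal n.
Proof.
have [->|ij] := eqVneq i j; first by rewrite dy_diag mul0r mem0v.
rewrite -[_ * _]mul1r Ideal_rel // !mem_cat; apply/or3P/Or32/mapP.
by exists (i, j); rewrite // mem_enum inE.
Qed.

Lemma Ideal_om i j k : om i j * om j k + om j k * om k i + om k i * om i j \in Ideal n.
Proof.
have sq (a b : 'I_n) : om a b * om b a = 0 by rewrite om_sym deg1_sq ?om_deg1.
have [->|ij] := eqVneq i j; first by rewrite om_diag mul0r mulr0 sq !addr0 mem0v.
have [->|jk] := eqVneq j k; first by rewrite om_diag mul0r mulr0 sq !addr0 mem0v.
have [->|ki] := eqVneq k i; first by rewrite om_diag mul0r mulr0 sq !addr0 mem0v.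
rewrite -[X in X \in _]mul1r Ideal_rel // !mem_cat; apply/or3P/Or33/mapP.
by exists (i, j, k); rewrite // mem_enum inE /= ij jk ki.
Qed.

(** The relations are sums of products of two elements of degree one, hence central, so the left
    ideal they generate is two-sided. *)
Lemma Ideal_mulr a b : b \in Ideal n -> b * a \in Ideal n.
Proof.
elim/ext_ind: a b => [k a b IHa IHb c cI||s a IH b bI].
- by rewrite mulrDr -scalerAr memvD ?memvZ ?IHa ?IHb.
- by move=> b; rewrite mulr1.
rewrite mulrA IH {a IH} //; have sd := gL_deg1 s.
have mulC c u v : u \in deg1 n -> v \in deg1 n -> c * (u * v) * gL s = c * gL s * (u * v).
  by move=> ud vd; rewrite -mulrA deg1_mul_comm // mulrA.
move: b bI; apply: Ideal_ind => [|k a b IHa IHb|a i j|a i j|a i j k].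
- by rewrite mul0r mem0v.
- by rewrite mulrDl -scalerAl memvD ?memvZ.
- by rewrite mulC ?dx_deg1 ?om_deg1 // Ideal_mull ?Ideal_x.
- by rewrite mulC ?dy_deg1 ?om_deg1 // Ideal_mull ?Ideal_y.
- by rewrite !mulrDr !mulrDl !mulC ?om_deg1 // -!mulrDr Ideal_mull ?Ideal_om.
Qed.

Lemma Ideal_omx i j : om i j * dx i j \in Ideal n.
Proof. by rewrite (deg1_anti (om_deg1 _ _) (dx_deg1 _ _)) memvN Ideal_x. Qed.

Lemma Ideal_omy i j : om i j * dy i j \in Ideal n.
Proof. by rewrite (deg1_anti (om_deg1 _ _) (dy_deg1 _ _)) memvN Ideal_y. Qed.

Lemma d_Ideal a : a \in Ideal n -> d a \in Ideal n.
Proof.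
have dM b r : r \in Ideal n -> d r \in Ideal n -> d (b * r) \in Ideal n.
  move=> rI dI; elim/ext_ind: b => [k b c IHb IHc||s b IH].
  - by rewrite mulrDl -scalerAl linearP memvD ?memvZ.
  - by rewrite mul1r.
  - by rewrite -mulrA d_gLM memvB ?Ideal_mull.
move: a; apply: Ideal_ind => [|k a b IHa IHb|a i j|a i j|a i j k].
- by rewrite linear0 mem0v.
- by rewrite linearP memvD ?memvZ.
- apply: dM; rewrite ?Ideal_x // d_deg1M ?dx_deg1 // d_dx d_om mul0r mulrA.
  by rewrite deg1_sq ?dx_deg1 // mul0r subr0 mem0v.
- apply: dM; rewrite ?Ideal_y // d_deg1M ?dy_deg1 // d_dy d_om mul0r mulrA.
  rewrite (deg1_anti (dy_deg1 _ _) (dx_deg1 _ _)) mulNr -mulrA.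
  by rewrite deg1_sq ?dy_deg1 // mulr0 oppr0 subr0 mem0v.
apply: dM; rewrite ?Ideal_om // !linearD /= !d_deg1M ?om_deg1 // !d_om.
(* A factor [om b' c'] identifies the points b' and c' modulo the ideal. The six terms of the
   differential of the Arnold relation pair off in this way. *)
have key (a' b' c' : 'I_n) : om b' c' * (dx a' b' * dy a' b') - om b' c' * (dx c' a' * dy c' a') \in Ideal n.
  rewrite (dxN a') (dyN a') mulrNN -(dxD a' b' c') -(dyD a' b' c').
  have -> (A B X Y P : ext n) : P * (A * B) - P * ((A + X) * (B + Y)) =
      - (P * (A * Y)) - P * (X * (B + Y)).
    by rewrite mulrDl (mulrDr A) !mulrDr !opprD !addrA subrr add0r.
  rewrite (deg1_anti (dx_deg1 a' b') (dy_deg1 b' c')) mulrN opprK !mulrA.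
  by apply: memvB; apply: Ideal_mulr; [exact: Ideal_omy|exact: Ideal_omx].
have dxyC (a' b' : 'I_n) (c : ext n) : dx a' b' * dy a' b' * c = c * (dx a' b' * dy a' b').
  by apply: deg1_mul_comm; [exact: dx_deg1|exact: dy_deg1].
rewrite !dxyC.
have -> (A B C D E F : ext n) : A - B + (C - D) + (E - F) = (A - D) + (C - F) + (E - B).
  rewrite (addrACA A) (addrACA (A + C)) (addrACA A (- D)) (addrACA (A + C) (- D - F)).
  by rewrite -(addrA (- B)) (addrC (- B)).
by apply: memvD; [apply: memvD|]; exact: key.
Qed.

End Generators.

Section Subalgebra.
Variable n : nat.
Implicit Types (i j : 'I_n) (a b u v : ext n).

Lemma subgens_deg1 u : u \in subgens n -> u \in deg1 n.
Proof.
rewrite !mem_cat => /or3P[]/mapP[[i j] _ ->].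
- exact: dx_deg1.
- exact: dy_deg1.
- exact: om_deg1.
Qed.

(** The spanning products of [Subalg] are indexed by sets of positions in [subgens], so multiplying
    by a generator inserts a position, up to sign, or gives 0 if it is already there: [op_enum]
    again. *)
Lemma Subalg_gen u a : u \in subgens n -> a \in Subalg n -> u * a \in Subalg n.
Proof.
move=> us; pose w (i : 'I_(size (subgens n))) : ext n := nth (0 : Lam n)%R (subgens n) i.
have wd l : w l \in deg1 n by apply/subgens_deg1/mem_nth.
have prodw (A : {set 'I_(size (subgens n))}) :
    prodL [seq nth (0 : Lam n)%R (subgens n) (val l) | l <- enum A] =
    ops (fun l => lmulf (w l)) (enum A) 1 :> ext n.
  by elim: (enum A) => //= l r ->.
have : u = w (Ordinal (etrans (index_mem u (subgens n)) us)) by rewrite /w nth_index.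
move: (Ordinal _) => l -> {us}.
move: a; apply: span_ind => [|k a b IHa IHb|_ /mapP[A _ ->]].
- by rewrite mulr0 mem0v.
- by rewrite mulrDr -scalerAr memvD ?memvZ.
rewrite prodw -/(lmulf (w l) _) op_enum => [|l1 l2 a|l1 a]; last first.
- by rewrite /= /lmulf mulrA deg1_sq ?mul0r.
- by rewrite /= /lmulf !mulrA (deg1_anti (wd l1) (wd l2)) mulNr.
case: ifP => _; first by rewrite mem0v.
rewrite memvZ // -prodw; apply/memv_span/map_f.
by rewrite mem_enum inE.
Qed.

Lemma Subalg1 : (1 : ext n) \in Subalg n.
Proof.
apply/memv_span/mapP; exists set0; first by rewrite mem_enum inE.
by rewrite enum_set0.
Qed.

Lemma Subalg_dx i j a : a \in Subalg n -> dx i j * a \in Subalg n.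
Proof.
have [->|ij] := eqVneq i j; first by rewrite dx_diag mul0r mem0v.
apply: Subalg_gen; rewrite !mem_cat; apply/or3P/Or31/mapP.
by exists (i, j); rewrite // mem_enum inE.
Qed.

Lemma Subalg_dy i j a : a \in Subalg n -> dy i j * a \in Subalg n.
Proof.
have [->|ij] := eqVneq i j; first by rewrite dy_diag mul0r mem0v.
apply: Subalg_gen; rewrite !mem_cat; apply/or3P/Or32/mapP.
by exists (i, j); rewrite // mem_enum inE.
Qed.

Lemma Subalg_om i j a : a \in Subalg n -> om i j * a \in Subalg n.
Proof.
have [->|ij] := eqVneq i j; first by rewrite om_diag mul0r mem0v.
apply: Subalg_gen; rewrite !mem_cat; apply/or3P/Or33/mapP.
by exists (i, j); rewrite // mem_enum inE.
Qed.

Lemma Subalg_ind (P : ext n -> Prop) :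
    P 0 -> (forall (k : rat) a b, P a -> P b -> P (k *: a + b)) -> P 1 ->
    (forall i j a, P a -> P (dx i j * a)) ->
    (forall i j a, P a -> P (dy i j * a)) ->
    (forall i j a, P a -> P (om i j * a)) ->
  forall a, a \in Subalg n -> P a.
Proof.
move=> P0 Plin P1 Px Py Po; apply: span_ind => // _ /mapP[A _ ->].
elim: (enum A) => //= l r IH; rewrite mulE.
have : nth (0 : Lam n)%R (subgens n) l \in subgens n by exact: mem_nth.
rewrite !mem_cat => /or3P[]/mapP[[j k] _ ->].
- exact: Px.
- exact: Py.
- exact: Po.
Qed.

Lemma d_Subalg a : a \in Subalg n -> d a \in Subalg n.
Proof.
suff: a \in Subalg n -> a \in Subalg n /\ d a \in Subalg n by move=> H /H[].
move: a; apply: Subalg_ind.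
- by rewrite linear0 mem0v.
- by move=> k a b [aS daS] [bS dbS]; rewrite linearP !memvD ?memvZ.
- by rewrite d1 mem0v Subalg1.
- move=> i j a [aS daS]; rewrite Subalg_dx //; split=> //.
  by rewrite d_deg1M ?dx_deg1 // d_dx mul0r sub0r memvN Subalg_dx.
- move=> i j a [aS daS]; rewrite Subalg_dy //; split=> //.
  by rewrite d_deg1M ?dy_deg1 // d_dy mul0r sub0r memvN Subalg_dy.
- move=> i j a [aS daS]; rewrite Subalg_om //; split=> //.
  by rewrite d_deg1M ?om_deg1 // d_om memvB ?Subalg_om // -mulrA Subalg_dx ?Subalg_dy.
Qed.

Lemma d_d a : d (d a) = 0.
Proof.
have ddg s : d (dgen s) = 0.
  case: s => [_|[[i j] ij]] /=; first by rewrite linear0.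
  rewrite mulE -/(dx i j) -/(dy i j) d_deg1M ?dx_deg1 // d_dx d_dy mul0r mulr0.
  by rewrite subrr.
have dM s b : d ((dgen s : ext n) * b) = (dgen s : ext n) * d b.
  case: s ddg => [t|[[i j] ij]] _ /=; first by rewrite !mul0r linear0.
  rewrite !mulE -/(dx i j) -/(dy i j) -mulrA d_deg1M ?dx_deg1 // d_dx mul0r sub0r.
  by rewrite d_deg1M ?dy_deg1 // d_dy mul0r sub0r mulrN opprK mulrA.
elim/ext_ind: a => [k a b IHa IHb||s a IH].
- by rewrite linearP /= linearP /= IHa IHb scaler0 addr0.
- by rewrite d1 linear0.
- by rewrite d_gLM linearB /= d_gLM dM IH mulr0 subr0 subrr.
Qed.

End Subalgebra.

Section Bidegree.
Variable n : nat.
Implicit Types (i j : 'I_n) (a b u v : ext n) (s : gen n) (S : {set gen n}).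

Definition nX S := #|[set g in S | isX g]|.
Definition nO S := #|[set g in S | ~~ isX g]|.

Lemma count_enum (P : pred (gen n)) S : count P (enum S) = #|[set s in S | P s]|.
Proof.
rewrite -size_filter cardE /enum_mem -filter_predI; congr size.
by apply: eq_filter => s; rewrite !inE andbC.
Qed.

Lemma eS_Lpq S : (eS S : ext n) \in Lpq n (nX S) (nO S).
Proof. by apply/memv_span/map_f; rewrite mem_enum inE !eqxx. Qed.

Lemma LpqP p q a :
  reflect (forall S, a S != 0 -> nX S = p /\ nO S = q) (a \in Lpq n p q).
Proof.
apply: (iffP idP) => [|H].
  move: a; apply: span_ind => [S|k a b IHa IHb S|_ /mapP[T + ->] S].
  - by rewrite ffunE eqxx.
  - rewrite !ffunE; have [->|/IHa//] := eqVneq (a S) 0.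
    by rewrite scaler0 add0r; exact: IHb.
  - rewrite mem_enum inE => /andP[/eqP<- /eqP<-]; rewrite ffunE.
    by case: (S =P T) => [->|]; rewrite ?eqxx.
rewrite [a]eS_sum; apply: memv_suml => S _; have [->|/H[<- <-]] := eqVneq (a S) 0.
  by rewrite scale0r mem0v.
by rewrite memvZ ?eS_Lpq.
Qed.

Lemma nXU s S : s \notin S -> nX (s |: S) = (isX s + nX S)%N.
Proof.
move=> sS; rewrite /nX; case: (boolP (isX s)) => sX.
  have -> : [set g in s |: S | isX g] = s |: [set g in S | isX g].
    by apply/setP => t; rewrite !inE; case: eqVneq => [->|]; rewrite ?sX.
  by rewrite cardsU1 inE (negPf sS).
congr #|pred_of_set _|; apply/setP => t; rewrite !inE.
by case: eqVneq => [->|] //; rewrite (negPf sX) !andbF.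
Qed.

Lemma nOU s S : s \notin S -> nO (s |: S) = (~~ isX s + nO S)%N.
Proof.
move=> sS; rewrite /nO; case: (boolP (isX s)) => sX /=.
  congr #|pred_of_set _|; apply/setP => t; rewrite !inE.
  by case: eqVneq => [->|] //; rewrite sX !andbF.
have -> : [set g in s |: S | ~~ isX g] = s |: [set g in S | ~~ isX g].
  by apply/setP => t; rewrite !inE; case: eqVneq => [->|]; rewrite ?sX.
by rewrite cardsU1 inE (negPf sS).
Qed.

Lemma Lpq_gL s p q a : a \in Lpq n p q ->
  gL s * a \in Lpq n (isX s + p) (~~ isX s + q).
Proof.
move=> /LpqP aL; rewrite [a]eS_sum mulr_sumr; apply: memv_suml => S _.
rewrite -scalerAr; have [->|/aL[<- <-]] := eqVneq (a S) 0; first by rewrite scale0r mem0v.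
rewrite memvZ // gL_eS; case: (boolP (s \in S)) => sS; rewrite ?mem0v //.
by rewrite memvZ // -nXU // -nOU // eS_Lpq.
Qed.

Lemma Lpq1 : (1 : ext n) \in Lpq n 0 0.
Proof.
apply/LpqP => S; rewrite -oneE ffunE; case: (S =P set0) => [->|] _; rewrite ?eqxx //.
by rewrite /nX /nO !(eq_card0 (A := [set g in set0 | _])) // => s; rewrite !inE.
Qed.

Lemma Lpq_xg i p q a : a \in Lpq n p q -> xg i * a \in Lpq n p.+1 q.
Proof. exact: (@Lpq_gL (inl (i, true))). Qed.
Lemma Lpq_yg i p q a : a \in Lpq n p q -> yg i * a \in Lpq n p.+1 q.
Proof. exact: (@Lpq_gL (inl (i, false))). Qed.
Lemma Lpq_om i j p q a : a \in Lpq n p q -> om i j * a \in Lpq n p q.+1.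
Proof.
move=> aL; apply: (om_ind (P := fun _ _ u => u * a \in Lpq n p q.+1)) => // [_|s].
  by rewrite mul0r mem0v.
exact: (@Lpq_gL (inr s)).
Qed.
Lemma Lpq_dx i j p q a : a \in Lpq n p q -> dx i j * a \in Lpq n p.+1 q.
Proof. by move=> aL; rewrite mulrBl memvB ?Lpq_xg. Qed.
Lemma Lpq_dy i j p q a : a \in Lpq n p q -> dy i j * a \in Lpq n p.+1 q.
Proof. by move=> aL; rewrite mulrBl memvB ?Lpq_yg. Qed.

Lemma d_Lpq p q a : a \in Lpq n p q ->
  if q is q'.+1 then d a \in Lpq n p.+2 q' else d a = 0.
Proof.
move=> /LpqP aL.
have H l : let p := count (@isX n) l in let q := count (predC (@isX n)) l in
  \prod_(s <- l) gL s \in Lpq n p q /\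
  if q is q'.+1 then d (\prod_(s <- l) gL s) \in Lpq n p.+2 q'
  else d (\prod_(s <- l) gL s) = 0.
  elim: l => [|s l [IH1 IH2]] /=; first by rewrite big_nil d1 Lpq1.
  rewrite big_cons; split; first exact: Lpq_gL.
  rewrite d_gLM; case: s => [t|[[i j] ij]] /=.
    rewrite mul0r sub0r !add0n; case: (count _ l) IH2 => [->|q' IH2].
      by rewrite mulr0 oppr0.
    by rewrite memvN; exact: (@Lpq_gL (inl t)).
  rewrite add0n /= mulE -/(dx i j) -/(dy i j) -mulrA.
  apply: memvB; first exact/Lpq_dx/Lpq_dy.
  case: (count _ l) IH2 => [->|q' IH2]; first by rewrite mulr0 mem0v.
  exact: (@Lpq_gL (inr _)).
have nE S : count (@isX n) (enum S) = nX S /\ count (predC (@isX n)) (enum S) = nO S.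
  by rewrite !count_enum.
case: q aL => [|q] aL; rewrite [a]eS_sum linear_sum.
  apply: big1 => S _; rewrite linearZ /=; have [->|/aL[]] := eqVneq (a S) 0.
    by rewrite scale0r.
  have [<- <-] := nE S => _ q0; have [_] := H (enum S).
  by rewrite /= q0 -eS_prod => ->; rewrite scaler0.
apply: memv_suml => S _; rewrite linearZ /=; have [->|/aL[]] := eqVneq (a S) 0.
  by rewrite scale0r mem0v.
have [<- <-] := nE S => p0 q0; have [_] := H (enum S).
by rewrite /= q0 p0 -eS_prod; exact: memvZ.
Qed.

End Bidegree.

(** * The action of 2 x 2 matrices *)

(* Replacing [k] by [k.+1] multiplies the [j]-th term by [r ^+ j]: subtracting
   [r ^+ N] times the original sum kills the top coefficient. *)
Lemma coef_memv_pow (V : vectType rat) (U : {vspace V}) (r : rat) (N : nat)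
    (v : nat -> V) : 1 < r ->
    (forall k : nat, \sum_(j < N) (r ^+ k) ^+ j *: v j \in U) ->
  forall j, (j < N)%N -> v j \in U.
Proof.
move=> r1; have r0 : 0 < r by apply: lt_trans r1.
elim: N v => // N IH v Hv.
have lowv j : (j < N)%N -> v j \in U.
  move=> jN; have ne : r ^+ j - r ^+ N != 0.
    by rewrite subr_eq0 (inj_eq (ieexprIn _ _)) ?ltn_eqF // gt_eqF.
  suff: (r ^+ j - r ^+ N) *: v j \in U.
    by move/(memvZ (r ^+ j - r ^+ N)^-1); rewrite scalerA mulVf // scale1r.
  apply: (IH (fun j => (r ^+ j - r ^+ N) *: v j)) jN => k.
  have := memvB (Hv k.+1) (memvZ (r ^+ N) (Hv k)).
  rewrite !big_ord_recr /= scalerDr !scalerA exprS exprMn opprD addrACA subrr addr0.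
  rewrite scaler_sumr -sumrB; congr (_ \in U); apply: eq_bigr => i _.
  by rewrite !scalerA -scalerBl exprMn mulrBr ![(r ^+ k) ^+ i * _]mulrC.
move=> j; rewrite ltnS leq_eqVlt => /orP[/eqP->|]; last exact: lowv.
have := Hv 0; rewrite big_ord_recr /= expr0 expr1n scale1r => H.
rewrite -[v N](addKr (\sum_(i < N) 1 ^+ i *: v i)) addrC memvB //.
by apply: memv_suml => i _; rewrite memvZ ?lowv.
Qed.

(** The powers of 2 are enough sample points. This is the standard tool below for comparing
    coefficients of a parameter. *)
Lemma coef_memv (V : vectType rat) (U : {vspace V}) (N : nat) (v : nat -> V) :
    (forall c : rat, c != 0 -> \sum_(j < N) c ^+ j *: v j \in U) ->
  forall j, (j < N)%N -> v j \in U.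
Proof.
move=> H; have r1 : 1 < 2%:R :> rat by rewrite ltr1n.
have r0 k : (2%:R : rat) ^+ k != 0 by rewrite expf_neq0 ?pnatr_eq0.
exact: coef_memv_pow r1 (fun k => H _ (r0 k)).
Qed.

Section GeneratorImages.
Variables (n n' : nat) (X Y : 'I_n -> ext n') (O : 'I_n -> 'I_n -> ext n').
Implicit Types (i j : 'I_n) (a b : ext n).

Definition img (s : gen n) : ext n' :=
  match s with
  | inl (i, true) => X i
  | inl (i, false) => Y i
  | inr s => O (val s).1 (val s).2
  end.

Hypotheses (X1 : forall i, X i \in deg1 n') (Y1 : forall i, Y i \in deg1 n').
Hypothesis O1 : forall i j, O i j \in deg1 n'.
Hypotheses (Osym : forall i j, O i j = O j i) (Odiag : forall i, O i i = 0).

Lemma img_deg1 s : img s \in deg1 n'.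
Proof. by case: s => [[i []]|[[i j] ij]] /=. Qed.

Definition gmap := hom img.
HB.instance Definition _ := GRing.Linear.on gmap.

Lemma gmap1 : gmap 1 = 1. Proof. exact: hom1. Qed.
Lemma gmapM a b : gmap (a * b) = gmap a * gmap b.
Proof. exact: (homM img_deg1). Qed.
Lemma gmap_xg i : gmap (xg i) = X i.
Proof. exact: (hom_gL img_deg1 (inl (i, true))). Qed.
Lemma gmap_yg i : gmap (yg i) = Y i.
Proof. exact: (hom_gL img_deg1 (inl (i, false))). Qed.
Lemma gmap_dx i j : gmap (dx i j) = X i - X j.
Proof. by rewrite linearB /= !gmap_xg. Qed.
Lemma gmap_dy i j : gmap (dy i j) = Y i - Y j.
Proof. by rewrite linearB /= !gmap_yg. Qed.
Lemma gmap_om i j : gmap (om i j) = O i j.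
Proof.
apply: (om_ind (P := fun i j u => gmap u = O i j)) => [k|k l u ->|s] //.
  by rewrite linear0 Odiag.
exact: (hom_gL img_deg1 (inr s)).
Qed.

Lemma gmap_deg1 u : u \in deg1 n -> gmap u \in deg1 n'.
Proof. exact: (hom_deg1 img_deg1). Qed.

Lemma gmap_Ideal (J : {vspace ext n'}) :
    (forall u v : ext n', v \in J -> u * v \in J) ->
    (forall i j, (X i - X j) * O i j \in J) ->
    (forall i j, (Y i - Y j) * O i j \in J) ->
    (forall i j k, O i j * O j k + O j k * O k i + O k i * O i j \in J) ->
  forall a, a \in Ideal n -> gmap a \in J.
Proof.
move=> JM Jx Jy Jo; apply: Ideal_ind => [|k a b IHa IHb|a i j|a i j|a i j k].
- by rewrite linear0 mem0v.
- by rewrite linearP memvD ?memvZ.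
- by rewrite !gmapM JM // gmap_dx gmap_om.
- by rewrite !gmapM JM // gmap_dy gmap_om.
- by rewrite !gmapM JM // !linearD /= !gmapM !gmap_om.
Qed.

End GeneratorImages.

Section LinearAction.
Variable n : nat.
Implicit Types (i j : 'I_n) (a b : ext n) (g h : 'M[rat]_2) (e : rat).

Definition gx g i : ext n := g 0 0 *: xg i + g 1 0 *: yg i.
Definition gy g i : ext n := g 0 1 *: xg i + g 1 1 *: yg i.
Definition eom e i j : ext n := e *: om i j.

Lemma gx1 g i : gx g i \in deg1 n.
Proof. by rewrite memvD ?memvZ ?xg_deg1 ?yg_deg1. Qed.
Lemma gy1 g i : gy g i \in deg1 n.
Proof. by rewrite memvD ?memvZ ?xg_deg1 ?yg_deg1. Qed.
Lemma eom1 e i j : eom e i j \in deg1 n.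
Proof. by rewrite memvZ ?om_deg1. Qed.
Lemma eom_sym e i j : eom e i j = eom e j i.
Proof. by rewrite /eom om_sym. Qed.
Lemma eom_diag e i : eom e i i = 0.
Proof. by rewrite /eom om_diag scaler0. Qed.

(* [act g e] extends [actL g] by rescaling the [omega]s by [e]; for [e = \det g]
   it commutes with the differential. *)
Definition act g e := gmap (gx g) (gy g) (eom e).
HB.instance Definition _ g e := GRing.Linear.on (act g e).

Lemma actLE g a : actL g a = act g 1 a.
Proof.
rewrite /actL /act /gmap homE; apply: eq_bigr => S _; congr (_ *: _); rewrite prodLE big_map.
apply: eq_bigr => s _; case: s => [[i []]|[[i j] ij]] //=.
by rewrite /eom scale1r om_lt.
Qed.

Lemma act1 g e : act g e 1 = 1. Proof. exact: gmap1. Qed.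
Lemma actM g e a b : act g e (a * b) = act g e a * act g e b.
Proof. by apply: gmapM; [exact: gx1|exact: gy1|exact: eom1]. Qed.
Lemma act_xg g e i : act g e (xg i) = gx g i.
Proof. by apply: gmap_xg; [exact: gx1|exact: gy1|exact: eom1]. Qed.
Lemma act_yg g e i : act g e (yg i) = gy g i.
Proof. by apply: gmap_yg; [exact: gx1|exact: gy1|exact: eom1]. Qed.
Lemma act_om g e i j : act g e (om i j) = e *: om i j.
Proof.
by apply: gmap_om; [exact: gx1|exact: gy1|exact: eom1|exact: eom_sym|exact: eom_diag].
Qed.
Lemma act_dx g e i j : act g e (dx i j) = g 0 0 *: dx i j + g 1 0 *: dy i j.
Proof. by rewrite linearB /= !act_xg /gx opprD addrACA -!scalerBr. Qed.
Lemma act_dy g e i j : act g e (dy i j) = g 0 1 *: dx i j + g 1 1 *: dy i j.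
Proof. by rewrite linearB /= !act_yg /gy opprD addrACA -!scalerBr. Qed.

Lemma act_Ideal g e a : a \in Ideal n -> act g e a \in Ideal n.
Proof.
have xE (k l : rat) i j : (k *: xg i + l *: yg i - (k *: xg j + l *: yg j)) * eom e i j \in Ideal n.
  rewrite /eom opprD addrACA -!scalerBr -/(dx i j) -/(dy i j) -scalerAr mulrDl.
  rewrite -!scalerAl; apply/memvZ/memvD; apply: memvZ; [exact: Ideal_x|exact: Ideal_y].
apply: gmap_Ideal; [exact: gx1|exact: gy1|exact: eom1|exact: eom_sym|exact: eom_diag
  |exact: Ideal_mull|move=> *; exact: xE|move=> *; exact: xE|].
move=> i j k; rewrite /eom -!(scalerAl, scalerAr) !scalerA -!scalerDr.
by rewrite memvZ ?Ideal_om.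
Qed.

Lemma act_Subalg g e a : a \in Subalg n -> act g e a \in Subalg n.
Proof.
move: a; apply: Subalg_ind => [|k a b IHa IHb||i j a IH|i j a IH|i j a IH].
- by rewrite linear0 mem0v.
- by rewrite linearP memvD ?memvZ.
- by rewrite act1 Subalg1.
- rewrite actM act_dx mulrDl -!scalerAl.
  by apply: memvD; apply: memvZ; [exact: Subalg_dx|exact: Subalg_dy].
- rewrite actM act_dy mulrDl -!scalerAl.
  by apply: memvD; apply: memvZ; [exact: Subalg_dx|exact: Subalg_dy].
- by rewrite actM act_om -!scalerAl; apply/memvZ/Subalg_om.
Qed.

Lemma act_gL_om g e (s : {ij : 'I_n * 'I_n | (ij.1 < ij.2)%N}) :
  act g e (gL (inr s)) = e *: gL (inr s).
Proof. by case: s => -[i j] ij; rewrite -om_lt act_om. Qed.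

Lemma act_Lpq g e p q a : a \in Lpq n p q -> act g e a \in Lpq n p q.
Proof.
have H l : act g e (\prod_(s <- l) gL s) \in
    Lpq n (count (@isX n) l) (count (predC (@isX n)) l).
  elim: l => [|s l IH] /=; first by rewrite big_nil act1 Lpq1.
  rewrite big_cons actM; case: s => [[i []]|s] /=; rewrite add0n add1n.
  - rewrite act_xg mulrDl -!scalerAl.
    by apply: memvD; apply: memvZ; [exact: Lpq_xg|exact: Lpq_yg].
  - rewrite act_yg mulrDl -!scalerAl.
    by apply: memvD; apply: memvZ; [exact: Lpq_xg|exact: Lpq_yg].
  - by rewrite act_gL_om -scalerAl memvZ //; exact: (@Lpq_gL _ (inr s)).
move=> /LpqP aL; rewrite [a]eS_sum linear_sum; apply: memv_suml => S _.
rewrite linearZ /=; have [->|/aL[<- <-]] := eqVneq (a S) 0.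
  by rewrite scale0r mem0v.
apply: memvZ; rewrite eS_prod; move: (H (enum S)); rewrite !count_enum; exact.
Qed.

Lemma mulmx2E g h k l : (g *m h) k l = g k 0 * h 0 l + g k 1 * h 1 l.
Proof.
rewrite mxE !big_ord_recl big_ord0 addr0.
by have -> : lift ord0 ord0 = 1 :> 'I_2 by exact: val_inj.
Qed.

Lemma act_comp g h e f a : act g e (act h f a) = act (g *m h) (e * f) a.
Proof.
elim/ext_ind: a => [k a b IHa IHb||s a IH].
- by rewrite linearP /= [LHS]linearP [RHS]linearP /= IHa IHb.
- by rewrite !act1.
rewrite !actM IH; congr (_ * _); case: s => [[i []]|s].
- rewrite -![gL _]/(xg i) !act_xg linearD !linearZ /= act_xg act_yg /gx /gy.
  rewrite !mulmx2E !scalerDr !scalerA addrACA -!scalerDl.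
  by congr (_ *: _ + _ *: _); ring.
- rewrite -![gL _]/(yg i) !act_yg linearD !linearZ /= act_xg act_yg /gx /gy.
  rewrite !mulmx2E !scalerDr !scalerA addrACA -!scalerDl.
  by congr (_ *: _ + _ *: _); ring.
- by rewrite !act_gL_om linearZ /= act_gL_om scalerA mulrC.
Qed.

Lemma det_mx2E g : \det g = g 0 0 * g 1 1 - g 0 1 * g 1 0.
Proof.
rewrite (expand_det_row _ 0) !big_ord_recl big_ord0 addr0 /cofactor !det_mx11 !mxE.
rewrite /bump /= expr0 expr1 mul1r mulN1r mulrN.
by congr (_ * g _ _ - g _ _ * g _ _); apply: val_inj.
Qed.

Lemma act_d g a : d (act g (\det g) a) = act g (\det g) (d a).
Proof.
have dact s : d (act g (\det g) (gL s)) = act g (\det g) (dgen s).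
  case: s => [[i []]|[[i j] ij]].
  - rewrite -[gL _]/(xg i) act_xg [dgen _]/= linear0.
    by rewrite linearD !linearZ /= d_xg d_yg !scaler0 addr0.
  - rewrite -[gL _]/(yg i) act_yg [dgen _]/= linear0.
    by rewrite linearD !linearZ /= d_xg d_yg !scaler0 addr0.
  (* Two transformed one-forms multiply to the determinant times [dx i j * dy i j], which is why
     [omega] must be scaled by the determinant. *)
  rewrite act_gL_om linearZ /= d_gL /= mulE -/(dx i j) -/(dy i j) actM act_dx act_dy.
  move: (dx_deg1 i j) (dy_deg1 i j); move: (dx i j) (dy i j) => u v ud vd.
  rewrite mulrDl !mulrDr -!(scalerAl, scalerAr) !scalerA.
  rewrite (deg1_sq ud) (deg1_sq vd) !scaler0 add0r addr0 (deg1_anti vd ud).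
  rewrite scalerN -scalerBl; congr (_ *: _).
  by rewrite det_mx2E; ring.
elim/ext_ind: a => [k a b IHa IHb||s a IH].
- by rewrite linearP /= linearP /= [d (_ *: _ + _)]linearP linearP /= IHa IHb.
- by rewrite act1 d1 linear0.
rewrite actM d_deg1M ?IH ?dact; last first.
  by apply: gmap_deg1 (gL_deg1 _); [exact: gx1|exact: gy1|exact: eom1].
by rewrite d_gLM linearB /= !actM.
Qed.

End LinearAction.

Definition mat2 (a b c d : rat) : 'M[rat]_2 :=
  \matrix_(i, j) (if i == 0 then if j == 0 then a else b else if j == 0 then c else d).

Lemma mat2E a b c d :
  (mat2 a b c d 0 0 = a) * (mat2 a b c d 0 1 = b) *
  (mat2 a b c d 1 0 = c) * (mat2 a b c d 1 1 = d).
Proof. by rewrite !mxE. Qed.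

Lemma det_mat2 a b c d : \det (mat2 a b c d) = a * d - b * c.
Proof. by rewrite det_mx2E !mat2E. Qed.

Lemma mat2P (g : 'M[rat]_2) : g = mat2 (g 0 0) (g 0 1) (g 1 0) (g 1 1).
Proof.
apply/matrixP => i j; rewrite mxE.
by case: i j => [[|[|i]] // hi] [[|[|j]] // hj]; congr (g _ _); apply: val_inj.
Qed.

Lemma mul_mat2 a b c d a' b' c' d' :
  mat2 a b c d *m mat2 a' b' c' d' =
  mat2 (a * a' + b * c') (a * b' + b * d') (c * a' + d * c') (c * b' + d * d').
Proof.
apply/matrixP => i j; rewrite !mxE !big_ord_recl big_ord0 addr0 !mxE /=.
by case: (i == 0); case: (j == 0).
Qed.

Definition isY n (s : gen n) : bool := if s is inl (_, false) then true else false.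

(** On bidegree (p, q) this is the projection to weight p - 2b of the diagonal torus. *)
HB.lock Definition ycomp n (b : nat) (a : ext n) : ext n :=
  \sum_(S : {set gen n} | #|[set s in S | isY s]| == b) a S *: (eS S : ext n).
Canonical ycomp_unlockable := Unlockable ycomp.unlock.

Section Weights.
Variable n : nat.
Implicit Types (a : ext n) (b : nat) (S : {set gen n}).

Definition nY S := #|[set s in S | isY s]|.

Lemma nY_le S : (nY S <= nX S)%N.
Proof.
apply: subset_leq_card; apply/subsetP => s; rewrite !inE => /andP[->].
by case: s => [[]|].
Qed.

Lemma act_diag x y e S :
  act (mat2 x 0 0 y) e (eS S) = (x ^+ (nX S - nY S) * y ^+ nY S * e ^+ nO S) *: (eS S : ext n).
Proof.
have H l : act (mat2 x 0 0 y) e (\prod_(s <- l) gL s) =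
    (x ^+ (count (@isX n) l - count (@isY n) l) * y ^+ count (@isY n) l * e ^+ count (predC (@isX n)) l)
      *: \prod_(s <- l) gL s.
  have cle l' : (count (@isY n) l' <= count (@isX n) l')%N by apply: sub_count => -[[? []]|].
  elim: l => [|s l IH] /=; first by rewrite big_nil act1 !expr0 !mulr1 scale1r.
  rewrite !big_cons actM IH; case: s => [[i []]|s] /=; rewrite ?add0n ?add1n.
  - rewrite -[gL _]/(xg i) act_xg /gx !mat2E scale0r addr0 subSn // exprS.
    by rewrite -scalerAl -scalerAr scalerA !mulrA.
  - rewrite -[gL _]/(yg i) act_yg /gy !mat2E scale0r add0r subSS exprS.
    by rewrite -scalerAl -scalerAr scalerA; congr (_ *: _); ring.
  - rewrite act_gL_om -scalerAl -scalerAr scalerA exprS; congr (_ *: _); ring.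
by rewrite eS_prod H !count_enum.
Qed.

Local Notation ycomp := (@ycomp n).

Lemma ycompE b a : ycomp b a = \sum_(S : {set gen n} | nY S == b) a S *: (eS S : ext n).
Proof. by rewrite unlock. Qed.

Lemma ycomp_is_linear b : linear (ycomp b).
Proof.
move=> k u v; rewrite !ycompE scaler_sumr -big_split; apply: eq_bigr => S _ /=.
by rewrite !ffunE scalerDl scalerA.
Qed.
HB.instance Definition _ b :=
  GRing.isLinear.Build rat (ext n) (ext n) *:%R (ycomp b) (ycomp_is_linear b).

Lemma act_diag_Lpq x y p q a : a \in Lpq n p q ->
  act (mat2 x 0 0 y) 1 a = \sum_(b < p.+1) (x ^+ (p - b) * y ^+ b) *: ycomp b a.
Proof.
move=> /LpqP aL; rewrite {1}[a]eS_sum linear_sum /=.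
have -> : \sum_(b < p.+1) (x ^+ (p - b) * y ^+ b) *: ycomp b a =
    \sum_(b < p.+1) \sum_(S : {set gen n} | nY S == b)
       (a S * (x ^+ (nX S - nY S) * y ^+ nY S)) *: (eS S : ext n).
  apply: eq_bigr => b _; rewrite ycompE scaler_sumr; apply: eq_bigr => S /eqP bE.
  rewrite scalerA; have [->|/aL[pE _]] := eqVneq (a S) 0; first by rewrite mulr0 mul0r.
  by rewrite pE bE mulrC.
rewrite (exchange_big_dep predT) //=; apply: eq_bigr => S _.
rewrite linearZ /= act_diag expr1n mulr1 scalerA.
have [->|/aL[pE _]] := eqVneq (a S) 0.
  by rewrite mul0r scale0r big1 // => b _; rewrite mul0r scale0r.
have lt_b : (nY S < p.+1)%N by rewrite ltnS -pE nY_le.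
by rewrite (big_pred1 (Ordinal lt_b)) // => b; rewrite -val_eqE /= eq_sym.
Qed.

(** Singular on purpose: [act] is an algebra endomorphism for every matrix and is compatible with
    products, so [act E11 1] is an idempotent projection. *)
Definition E11 := mat2 1 0 0 0.

Lemma ycomp0 p q a : a \in Lpq n p q -> ycomp 0 a = act E11 1 a.
Proof.
move=> aL; rewrite (act_diag_Lpq _ _ aL) big_ord_recl subn0 expr1n mul1r expr0 scale1r.
by rewrite big1 ?addr0 // => i _; rewrite exprS mul0r mulr0 scale0r.
Qed.

Lemma act_E11_d a : act E11 1 (d a) = 0.
Proof.
elim/ext_ind: a => [k a b IHa IHb||s a IH].
- by rewrite linearP linearP /= IHa IHb scaler0 addr0.
- by rewrite d1 linear0.
rewrite d_gLM linearB /= !actM IH mulr0 subr0.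
case: s => [?|[[i j] ij]] /=; first by rewrite linear0 mul0r.
by rewrite mulE -/(dx i j) -/(dy i j) actM act_dy !mat2E !scale0r addr0 mulr0 mul0r.
Qed.
End Weights.

Section Pages.
Variables (n p q : nat).
Implicit Types (a b : ext n) (g : 'M[rat]_2).

Lemma act_Ipq g e a : a \in Ipq n p q -> act g e a \in Ipq n p q.
Proof. by rewrite !memv_cap => /andP[aI aL]; rewrite act_Ideal ?act_Lpq. Qed.

End Pages.

Lemma act_Apq n p q g e (a : ext n) : a \in Apq n p q -> act g e a \in Apq n p q.
Proof.
move=> /memv_addP[u + [v vI ->]]; rewrite memv_cap => /andP[uS uL].
by rewrite linearD /= memv_add ?act_Ipq // memv_cap act_Subalg ?act_Lpq.
Qed.

Lemma Apq_Lpq n p q (a : ext n) : a \in Apq n p q -> a \in Lpq n p q.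
Proof.
move=> /memv_addP[u + [v + ->]]; rewrite !memv_cap => /andP[_ uL] /andP[_ vL].
exact: memvD.
Qed.

Lemma BpqP n p q (a : ext n) :
  reflect (exists2 b : ext n, b \in Ipq n p q &
    (a = b \/ exists r u, [/\ p = r.+2, u \in Apq n r q.+1 & a = d u + b]))
  (a \in Bpq n p q).
Proof.
apply: (iffP idP) => [/memv_addP[u uD [b bI ->]]|[b bI [->|[r [u [pE uA ->]]]]]].
- exists b => //; case: ifP uD => [p2 /memv_imgP[v vA ->]|_]; last first.
    by rewrite memv0 => /eqP->; left; rewrite add0r.
  right; exists (p - 2)%N, v; split=> //; first by rewrite -addn2 subnK.
  by rewrite d2E.
- by rewrite -[b]add0r memv_add ?mem0v.
- rewrite -d2E; subst p; apply: (memv_add _ bI); rewrite /= subSS subSS subn0; exact: memv_img.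
Qed.

Lemma act_Bpq n p q g (a : ext n) :
  \det g = 1 -> a \in Bpq n p q -> act g 1 a \in Bpq n p q.
Proof.
move=> g1 /BpqP[b bI aE]; apply/BpqP; exists (act g 1 b); first exact: act_Ipq.
case: aE => [->|[r [u [-> uA ->]]]]; [by left|right].
exists r, (act g 1 u); split=> //; first exact: act_Apq.
by rewrite linearD /= -{1}g1 -act_d g1.
Qed.

Lemma Bpq_Ideal n p q (a : ext n) :
  act E11 1 a = a -> a \in Bpq n p q -> a \in Ideal n.
Proof.
move=> aE /BpqP[b]; rewrite memv_cap => /andP[bI _] abE; rewrite -aE.
case: abE => [->|[r [u [_ _ ->]]]]; first exact: act_Ideal.
by rewrite linearD /= act_E11_d add0r; exact: act_Ideal.
Qed.

Lemma ZpqP n p q (a : ext n) :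
  (a \in Zpq n p q) = (a \in Apq n p q) && (d a \in Ideal n).
Proof. by rewrite memv_cap -memv_preim d2E. Qed.

Lemma act_Zpq n p q g (a : ext n) :
  \det g = 1 -> a \in Zpq n p q -> act g 1 a \in Zpq n p q.
Proof.
move=> g1; rewrite !ZpqP => /andP[aA dI]; rewrite act_Apq //=.
by rewrite -g1 act_d act_Ideal.
Qed.

Lemma Bpq_Zpq n p q (a : ext n) : a \in Bpq n p q -> a \in Zpq n p q.
Proof.
have IZ (b : ext n) : b \in Ipq n p q -> b \in Zpq n p q.
  move=> bI; rewrite ZpqP -{1}[b]add0r memv_add ?mem0v //=.
  by move: bI; rewrite memv_cap => /andP[/d_Ideal].
move=> /BpqP[b bI [->|[r [u [pE uA ->]]]]]; first exact: IZ.
apply: memvD; last exact: IZ.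
rewrite ZpqP d_d mem0v andbT {1}pE.
move: uA => /memv_addP[v + [w + ->]]; rewrite !memv_cap => /andP[vS vL] /andP[wI wL].
rewrite linearD /= memv_add // memv_cap; last by rewrite d_Ideal //; exact: d_Lpq wL.
by rewrite d_Subalg //; exact: d_Lpq vL.
Qed.

(** A subspace of maximal dimension on which [P] holds must be everything, since any other solution
    could be adjoined. Applied to [equiv_lift] and [cocycle], which quantify over infinitely many
    matrices or functions [z]. *)
Lemma prop_vspace (V : vectType rat) (P : V -> Prop) :
    P 0 -> (forall (k : rat) u v, P u -> P v -> P (k *: u + v)) ->
  exists U : {vspace V}, forall v, v \in U <-> P v.
Proof.
move=> P0 Plin.
pose good m := `[< exists U : {vspace V}, \dim U = m /\ forall v, v \in U -> P v >].
have ex_good : exists m, good m.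
  exists 0; apply/asboolP; exists 0%VS; rewrite dimv0; split=> // v.
  by rewrite memv0 => /eqP->.
have good_le m : good m -> (m <= \dim {:V})%N.
  by move=> /asboolP[U [<- _]]; exact/dimvS/subvf.
case: (ex_maxnP ex_good good_le) => m /asboolP[U [dimU PU]] max_m.
exists U => v; split=> [/PU//|Pv]; apply: contraT => vU.
have /max_m : good (\dim (U + <[v]>)%VS).
  apply/asboolP; exists (U + <[v]>)%VS; split=> // _ /memv_addP[u uU [_ /vlineP[k ->] ->]].
  by rewrite addrC; apply: Plin => //; exact: PU.
rewrite -dimU leqNgt => /negP[].
have [le_dim eq_dim] := dimv_leqif_sup (addvSl U <[v]>).
rewrite ltn_neqAle le_dim eq_dim andbT; apply: contra vU => /subvP; apply.
by rewrite memvE addvSr.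
Qed.

Lemma max_free_size (V : vectType rat) (P : V -> Prop) (U : {vspace V}) :
    (forall v, v \in U <-> P v) ->
  \max_(m < (\dim {: V}%VS).+1 |
      `[< exists s : seq V, [/\ size s = m, free s & forall w, w \in s -> P w] >]) m
    = \dim U.
Proof.
move=> UP; apply/eqP; rewrite eqn_leq; apply/andP; split.
  apply/bigmax_leqP => m /asboolP[s [<- /eqP fs Ps]]; rewrite -fs.
  by apply/dimvS/span_subvP => v /Ps/UP.
have lt_U : (\dim U < (\dim {: V}%VS).+1)%N by rewrite ltnS; exact/dimvS/subvf.
apply: (leq_bigmax_cond (Ordinal lt_U)); apply/asboolP; exists (vbasis U).
split; first by rewrite size_tuple.
  exact: basis_free (vbasisP U).
by move=> v /vbasis_mem/UP.
Qed.

(** Serves twice: for lifts with values in [Bpq], which explain the term subtracted in [e3], and for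
    families of cocycles indexed by the parent of the last point. *)
Lemma ffun_vspace (I : finType) (V : vectType rat) (U : {vspace V}) :
  exists W : {vspace {ffun I -> V}},
    (forall w : {ffun I -> V}, w \in W <-> forall i, w i \in U) /\
    \dim W = (#|I| * \dim U)%N.
Proof.
pose f (w : {ffun I -> subvs_of U}) : {ffun I -> V} := [ffun i => vsval (w i)].
have f_lin : linear f.
  by move=> k u v; apply/ffunP => i; rewrite !ffunE linearP.
pose fl : {linear {ffun I -> subvs_of U} -> {ffun I -> V}} :=
  HB.pack f (GRing.isLinear.Build _ _ _ _ f f_lin).
exists (limg (linfun fl)); split=> [w|].
  split=> [/memv_imgP[u _ ->] i|wU]; first by rewrite lfunE ffunE subvsP.
  apply/memv_imgP; exists [ffun i => vsproj U (w i)]; first exact: memvf.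
  by rewrite lfunE; apply/ffunP => i; rewrite !ffunE vsprojK.
rewrite limg_dim_eq ?dimvf; last first.
  apply/eqP; rewrite capfv -subv0; apply/subvP => u; rewrite memv_ker lfunE memv0 => /eqP u0.
  apply/eqP/ffunP => i; move/ffunP/(_ i): u0; rewrite !ffunE => u0.
  by apply: val_inj; rewrite [LHS]u0 [RHS]linear0.
by rewrite /dim /= /dim /=.
Qed.

(** * Equivariant maps and highest weight vectors *)

(** The image of [x^(k-i) y^i] under the matrix with rows [(a, b)] and [(c, d)], dehomogenised by
    [x = 1], [y = 'X]; its coefficients are the entries of [symk]. *)
Definition binform (k i : nat) (a b c d : rat) : {poly rat} :=
  (a%:P + c *: 'X) ^+ (k - i) * (b%:P + d *: 'X) ^+ i.

Lemma size_binform k i a b c d : (i <= k)%N -> (size (binform k i a b c d) <= k.+1)%N.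
Proof.
move=> ik; have sz (u v : rat) : ((size (u%:P + v *: 'X)%R).-1 <= 1)%N.
  rewrite -subn1 leq_subLR; apply: leq_trans (size_polyD _ _) _; rewrite geq_max.
  rewrite (leq_trans (size_polyC_leq1 _)) //=.
  by apply: leq_trans (size_scale_leq _ _) _; rewrite size_polyX.
have szX (u v : rat) m : (size ((u%:P + v *: 'X)%R ^+ m) <= m.+1)%N.
  by apply: leq_trans (size_exp_leq _ _) _; rewrite ltnS -{2}[m]mul1n leq_mul2r sz orbT.
have := leq_add (szX a c (k - i)%N) (szX b d i); rewrite addnS addSn subnK // => le_k2.
by apply: leq_trans (size_polyMleq _ _) _; move: le_k2; case: (_ + _)%N.
Qed.

Lemma coef_rat0 N (c : nat -> rat) :
  (forall t : rat, \sum_(j < N) t ^+ j * c j = 0) -> forall j, (j < N)%N -> c j = 0.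
Proof.
move=> H j jN; apply/eqP; rewrite -(memv0 (vT := rat^o)).
apply: (@coef_memv rat^o 0%VS N c) jN => t _.
by rewrite memv0; apply/eqP/H.
Qed.

Lemma horner_binform k i a b c d t :
  (binform k i a b c d).[t] = (a + c * t) ^+ (k - i) * (b + d * t) ^+ i.
Proof. by rewrite /binform !hornerE. Qed.

(* Both sides are the coefficient of [s ^+ i * t ^+ j] in
   [(a + b s + c t + d s t) ^+ k]. *)
Lemma binform_sym k i j a b c d : (i <= k)%N -> (j <= k)%N ->
  'C(k, i)%:R * (binform k i a b c d)`_j = 'C(k, j)%:R * (binform k j a c b d)`_i.
Proof.
move=> ik jk; apply/eqP; rewrite -subr_eq0; apply/eqP.
pose M i j := 'C(k, i)%:R * (binform k i a b c d)`_j - 'C(k, j)%:R * (binform k j a c b d)`_i.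
have gen (a' b' c' d' s t : rat) :
    \sum_(i < k.+1) s ^+ i * ('C(k, i)%:R * \sum_(j < k.+1) t ^+ j * (binform k i a' b' c' d')`_j)
    = (a' + c' * t + s * (b' + d' * t)) ^+ k.
  rewrite exprDn; apply: eq_bigr => l _.
  have -> : \sum_(j < k.+1) t ^+ j * (binform k l a' b' c' d')`_j = (binform k l a' b' c' d').[t].
    rewrite (@horner_coef_wide _ k.+1) ?size_binform -1?ltnS //.
    by apply: eq_bigr => m _; rewrite mulrC.
  by rewrite horner_binform exprMn -mulr_natl; ring.
have H s t : \sum_(j < k.+1) t ^+ j * (\sum_(i < k.+1) s ^+ i * M i j) = 0.
  have := gen a b c d s t; rewrite [X in X ^+ k](_ : _ = a + b * s + t * (c + d * s)); last by ring.
  rewrite -gen => /eqP; rewrite -subr_eq0 => /eqP E; rewrite -[RHS]E {E}.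
  under eq_bigr => m _.
    rewrite mulr_sumr; under eq_bigr => l _ do rewrite /M !mulrBr.
    rewrite sumrB; over.
  rewrite sumrB; congr (_ - _).
    rewrite exchange_big /=; apply: eq_bigr => l _; rewrite !mulr_sumr.
    by apply: eq_bigr => m _; ring.
  by apply: eq_bigr => m _; rewrite !mulr_sumr; apply: eq_bigr => l _; ring.
have M0 m s : (m < k.+1)%N -> \sum_(i < k.+1) s ^+ i * M i m = 0.
  by move=> mk; apply: (@coef_rat0 k.+1 (fun m => \sum_(i < k.+1) s ^+ i * M i m)) => // t; exact: H.
by apply: (@coef_rat0 k.+1 (fun i => M i j)) => // s; exact: M0.
Qed.

Lemma memv_eq (V : vectType rat) (U : {vspace V}) (u v : V) : u \in U -> u = v -> v \in U.
Proof. by move=> uU <-. Qed.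

Section Lifts.
Variables (n p q : nat).
Implicit Types (a : ext n) (w : {ffun 'I_p.+1 -> Lam n}).
Local Notation eql := (@equiv_lift n p q p).

Lemma symkE (g : 'M[rat]_2) i j :
  symk p g i j = (binform p i (g 0 0) (g 0 1) (g 1 0) (g 1 1))`_j.
Proof. by rewrite mxE. Qed.

Lemma actL_act (g : 'M[rat]_2) w i : actL g (w i) = act g 1 (w i).
Proof. exact: (actLE g (w i : ext n)). Qed.

Lemma equiv_lift0 : eql 0.
Proof.
split=> [i|g _ i]; first by rewrite ffunE mem0v.
rewrite actL_act ffunE linear0 big1 ?subr0 ?mem0v // => j _.
by rewrite ffunE scaler0.
Qed.

Lemma equiv_lift_lin (k : rat) (v w : {ffun 'I_p.+1 -> Lam n}) :
  eql v -> eql w -> eql (k *: v + w).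
Proof.
move=> [Zv Bv] [Zw Bw]; split=> [i|g g1 i].
  by rewrite !ffunE; apply: memvD (Zw i); exact: memvZ.
apply: memv_eq (memvD (memvZ k (Bv g g1 i)) (Bw g g1 i)) _; rewrite !actL_act.
rewrite scalerBr addrACA -opprD !ffunE; congr (_ - _).
  exact: (esym (linearP (act g 1) k (v i : ext n) (w i : ext n))).
rewrite scaler_sumr -big_split; apply: eq_bigr => j _ /=.
by rewrite !ffunE scalerDr !scalerA [k * _]mulrC.
Qed.

(** The diagonal matrix with entries t^-1, t scales the part of [w0] with b letters [y] by t^(2b -
    p), while equivariance scales [w0] by t^-p modulo [Bpq]. Separating the powers of t^2 isolates b
    = 0. *)
Lemma lift_top w (w0 := w ord0 : ext n) :
  eql w -> ycomp 0 w0 - w0 \in Bpq n p q.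
Proof.
move=> [Zw Bw].
have wL : w0 \in Lpq n p q by have := Zw ord0; rewrite ZpqP => /andP[/Apq_Lpq].
pose v b : ext n := ycomp b w0 - (if b == 0%N then w0 else 0).
(* The sample values are t = 2^k and the variable is t^2, whence the ratio 2^2. *)
have r1 : 1 < 2%:R ^+ 2 :> rat by rewrite exprn_egt1 ?ltr1n.
apply: (@coef_memv_pow (ext n) (Bpq n p q) (2%:R ^+ 2) p.+1 v r1) (ltn0Sn _) => k.
pose t : rat := 2%:R ^+ k; have t0 : t != 0 by rewrite expf_neq0 ?pnatr_eq0.
have g1 : \det (mat2 t^-1 0 0 t) = 1 by rewrite det_mat2 mul0r subr0 mulVf.
apply: memv_eq (memvZ (t ^+ p) (Bw _ g1 ord0)) _.
rewrite actL_act -/w0 (act_diag_Lpq _ _ wL) scalerBr scaler_sumr /v.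
under [in RHS]eq_bigr do rewrite scalerBr.
rewrite [RHS]sumrB; congr (_ - _).
  apply: eq_bigr => b _; rewrite scalerA; congr (_ *: _).
  have bp : (b <= p)%N by rewrite -ltnS.
  rewrite -{1}(subnK bp) exprD exprVn mulrACA mulfV ?expf_neq0 // mul1r -expr2.
  by rewrite /t -!exprM; congr (_ ^+ _); rewrite mulnC mulnA.
rewrite big_ord_recl [in RHS]big_ord_recl /= expr0 scale1r !big1 ?addr0 => [|i _|i _].
- rewrite scalerA symkE /binform expr0 mulr1 !mat2E scale0r addr0 -polyC_exp coefC eqxx.
  by rewrite subn0 -exprMn mulfV // expr1n scale1r.
- by rewrite scaler0.
- rewrite symkE /binform expr0 mulr1 !mat2E scale0r addr0 -polyC_exp coefC /=.
  by rewrite scale0r.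
Qed.

(** The highest weight vector generates V_p: lower unipotent matrices send [w ord0] to the sum of
    the [w j] with coefficients C(p, j) c^j, and each coefficient of c^j must lie in [Bpq] if all
    these images do. *)
Lemma lift_Bpq w : eql w -> w ord0 \in Bpq n p q -> forall i, w i \in Bpq n p q.
Proof.
move=> [Zw Bw] w0B i; set w0 : ext n := w ord0 in w0B.
pose v j : ext n := 'C(p, j)%:R *: w (inord j).
suff : v i \in Bpq n p q.
  move/(memvZ ('C(p, i)%:R)^-1); rewrite /v inord_val scalerA mulVf ?scale1r //.
  by rewrite pnatr_eq0 -lt0n bin_gt0 -ltnS.
apply: (@coef_memv (ext n) (Bpq n p q) p.+1 v) (ltn_ord i) => c _.
have g1 : \det (mat2 1 0 c 1) = 1 by rewrite det_mat2 mul0r subr0 mulr1.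
apply: memv_eq (memvB (act_Bpq g1 w0B) (Bw _ g1 ord0)) _.
rewrite actL_act -/w0 opprB addrCA subrr addr0; apply: eq_bigr => j _.
rewrite /v inord_val scalerA symkE /binform !mat2E expr0 mulr1 subn0; congr (_ *: _).
have -> : 1%:P + c *: 'X = (c *: 'X + 1 : {poly rat}) by rewrite addrC.
rewrite exprD1n coef_sum (bigD1 j) //= big1 ?addr0 => [|l lj].
  rewrite coefMn exprZn coefZ coefXn eqxx mulr1.
  by rewrite mulr_natr.
by rewrite coefMn exprZn coefZ coefXn eq_sym (negPf (_ : val l != j)) ?mulr0 ?mul0rn.
Qed.

Section Polarization.
Variable v : ext n.
Hypotheses (vZ : v \in Zpq n p q) (vx : act E11 1 v = v).

Let vL : v \in Lpq n p q. Proof. by move: vZ; rewrite ZpqP => /andP[/Apq_Lpq]. Qed.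

(* The image of [y ^+ j * x ^+ (p - j)] under the map sending [x ^+ p] to [v],
   read off from the substitution [x |-> x + y]. *)
Definition polar (j : nat) : ext n :=
  ('C(p, j)%:R)^-1 *: ycomp j (act (mat2 1 0 1 0) 1 v).

(** As [v] is fixed by [act E11 1], only the first column of the matrix matters, and a column (a, c)
    is the column (1, 1) followed by a diagonal matrix. *)
Lemma act_polar (a b c d' : rat) :
  act (mat2 a b c d') 1 v =
  \sum_(j < p.+1) ('C(p, j)%:R * (a ^+ (p - j) * c ^+ j)) *: polar j.
Proof.
have -> : act (mat2 a b c d') 1 v = act (mat2 a 0 0 c) 1 (act (mat2 1 0 1 0) 1 v).
  rewrite -{1}vx !act_comp !mul_mat2.
  by rewrite !(mulr0, mul0r, mulr1, mul1r, addr0, add0r).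
rewrite (act_diag_Lpq _ _ (act_Lpq _ _ vL)); apply: eq_bigr => j _.
rewrite /polar scalerA mulrAC mulfV ?mul1r //.
by rewrite pnatr_eq0 -lt0n bin_gt0 -ltnS.
Qed.

Lemma polar0 : polar 0 = v.
Proof.
rewrite /polar bin0 invr1 scale1r (ycomp0 (act_Lpq _ _ vL)) act_comp mul_mat2.
by rewrite !(mulr0, mul0r, mulr1, mul1r, addr0, add0r) -[RHS]vx.
Qed.

Lemma polar_Zpq j : (j < p.+1)%N -> polar j \in Zpq n p q.
Proof.
move=> jp; have : 'C(p, j)%:R *: polar j \in Zpq n p q.
  apply: (@coef_memv (ext n) _ p.+1 (fun j => 'C(p, j)%:R *: polar j)) jp => c _.
  have g1 : \det (mat2 1 0 c 1) = 1 by rewrite det_mat2 mul0r subr0 mulr1.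
  apply: memv_eq (act_Zpq g1 vZ) _; rewrite act_polar; apply: eq_bigr => l _.
  by rewrite [RHS]scalerA expr1n mul1r mulrC.
move/(memvZ ('C(p, j)%:R)^-1); rewrite scalerA mulVf ?scale1r //.
by rewrite pnatr_eq0 -lt0n bin_gt0 -ltnS.
Qed.

(** [act (mat2 1 0 c 0) 1 v] is the generating function in c of the polars with binomial weights.
    Applying [g] transforms its column (1, c), and comparing powers of c gives the claim up to a
    transposition, supplied by [binform_sym]. *)
Lemma polar_equiv (g : 'M[rat]_2) (i : 'I_p.+1) :
  act g 1 (polar i) = \sum_(j < p.+1) symk p g i j *: polar j.
Proof.
pose Q (l : nat) : ext n := 'C(p, l)%:R *: act g 1 (polar l)
   - \sum_(j < p.+1) ('C(p, j)%:R * (binform p j (g 0 0) (g 1 0) (g 0 1) (g 1 1))`_l) *: polar j.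
have Q0 : Q i = 0.
  apply/eqP; rewrite -memv0; apply: (@coef_memv (ext n) 0%VS p.+1 Q) (ltn_ord i) => c _.
  have E : act g 1 (act (mat2 1 0 c 0) 1 v) =
      act (mat2 (g 0 0 + g 0 1 * c) 0 (g 1 0 + g 1 1 * c) 0) 1 v.
    by rewrite act_comp {1}[g]mat2P mul_mat2 !(mulr0, mul0r, mulr1, mul1r, addr0, add0r).
  rewrite memv0 /Q; under eq_bigr do rewrite scalerBr.
  rewrite sumrB subr_eq0; apply/eqP.
  transitivity (act g 1 (act (mat2 1 0 c 0) 1 v)).
    rewrite act_polar linear_sum; apply: eq_bigr => l _.
    rewrite [LHS]scalerA [RHS]linearZ expr1n mul1r.
    by rewrite [c ^+ l * _]mulrC.
  rewrite E act_polar; under [RHS]eq_bigr do rewrite scaler_sumr.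
  rewrite exchange_big; apply: eq_bigr => j _ /=.
  under eq_bigr do rewrite scalerA; rewrite -scaler_suml; congr (_ *: _).
  rewrite -horner_binform (@horner_coef_wide _ p.+1) ?size_binform -1?ltnS // mulr_sumr.
  by apply: eq_bigr => l _; ring.
have Cn0 l : (l < p.+1)%N -> ('C(p, l)%:R : rat) != 0.
  by move=> lp; rewrite pnatr_eq0 -lt0n bin_gt0 -ltnS.
apply: (scalerI (Cn0 _ (ltn_ord i))); apply/eqP; rewrite -subr_eq0 -[X in _ == X]Q0 /Q.
apply/eqP; congr (_ - _); rewrite scaler_sumr; apply: eq_bigr => j _.
by rewrite scalerA symkE binform_sym // -ltnS.
Qed.

Lemma polar_lift : eql [ffun i : 'I_p.+1 => polar i : Lam n].
Proof.
split=> [i|g _ i]; first by rewrite ffunE polar_Zpq.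
apply: memv_eq (mem0v _) _; symmetry; apply/eqP; rewrite subr_eq0; apply/eqP.
rewrite actL_act ffunE polar_equiv; apply: eq_bigr => j _.
by rewrite ffunE.
Qed.
End Polarization.
End Lifts.

Section HighestWeight.
Variables (n p q : nat).
Implicit Types (a : ext n).

(* [act E11 1] sets the [y]s to [0]: its fixed points are the polynomials in the
   [x]s and [omega]s, which are the vectors of weight [p] in bidegree [(p, q)]. *)
Definition Kx : {vspace ext n} :=
  ((Zpq n p q : {vspace ext n}) :&: lker (linfun (@act n E11 1) - \1%VF))%VS.

Lemma KxP a : (a \in Kx) = (a \in Zpq n p q) && (act E11 1 a == a).
Proof.
rewrite memv_cap memv_ker add_lfunE opp_lfunE id_lfunE lfunE subr_eq0.
by [].
Qed.

Lemma act_E11_idem a : act E11 1 (act E11 1 a) = act E11 1 a.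
Proof. by rewrite act_comp mul_mat2 !(mulr0, mul0r, mulr1, mul1r, addr0, add0r). Qed.

Lemma Kx_cap_Bpq : (Kx :&: (Bpq n p q : {vspace ext n}) = Kx :&: (Ideal n : {vspace ext n}))%VS.
Proof.
apply/vspaceP => a; rewrite (memv_cap a Kx) [RHS](memv_cap a Kx).
case aK: (a \in Kx) => //=.
move: aK; rewrite KxP ZpqP => /andP[/andP[/Apq_Lpq aL _] /eqP aE].
apply/idP/idP => [|aI]; first exact: Bpq_Ideal.
by rewrite -[a]add0r memv_add ?mem0v // memv_cap aI.
Qed.

(** Evaluation at the basis vector x^p has the same kernel on all equivariant lifts as on the lifts
    into [Bpq], by [lift_Bpq]; the two images are [Kx + Bpq] and [Bpq]. So the multiplicity is the
    dimension of [Kx] modulo [Kx :&: Bpq], which is [Kx :&: Ideal]. *)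
Lemma e3_Kx : e3 n p q p = (\dim Kx - \dim (Kx :&: (Ideal n : {vspace ext n})))%N.
Proof.
have [W WP] := prop_vspace (@equiv_lift0 n p q) (@equiv_lift_lin n p q).
have [BB [BBP dimBB]] := @ffun_vspace 'I_p.+1 (ext n) (Bpq n p q).
pose ev (w : {ffun 'I_p.+1 -> ext n}) : ext n := w ord0.
have ev_lin : linear ev by move=> k u v; rewrite /ev !ffunE.
pose evl : {linear {ffun 'I_p.+1 -> ext n} -> ext n} :=
  HB.pack ev (GRing.isLinear.Build _ _ _ _ ev ev_lin).
pose f := linfun evl; have fE w : f w = w ord0 by rewrite lfunE.
rewrite /e3 /lift_dim (max_free_size WP).
rewrite -(limg_ker_dim f W).
have dimB := limg_ker_dim f BB; rewrite dimBB card_ord in dimB; rewrite -dimB.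
have BBW w : w \in BB -> w \in W.
  move=> /BBP wB; apply/WP; split=> [i|g g1 i]; first exact/Bpq_Zpq/wB.
  rewrite actL_act; apply: memvB; first exact: act_Bpq (wB i).
  by apply: memv_suml => j _; exact/memvZ/wB.
have -> : (W :&: lker f = BB :&: lker f)%VS.
  apply/vspaceP => w; rewrite !memv_cap memv_ker; case f0: (f w == 0); rewrite ?andbF ?andbT //.
  apply/idP/idP => [/WP wW|]; last exact: BBW.
  apply/BBP; apply: lift_Bpq (wW) _; move: f0; rewrite fE => /eqP->; exact: mem0v.
have -> : (f @: BB)%VS = Bpq n p q.
  apply/vspaceP => a; apply/memv_imgP/idP => [[w /BBP wB ->]|aB]; first by rewrite fE.
  exists [ffun => a]; last by rewrite fE ffunE.
  by apply/BBP => i; rewrite ffunE.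
have -> : (f @: W)%VS = (Kx + (Bpq n p q : {vspace ext n}))%VS.
  apply/vspaceP => a; apply/memv_imgP/idP => [[w /WP wW ->]|/memv_addP[u uK [b bB ->]]].
    rewrite fE; set w0 : ext n := w ord0.
    have w0Z : w0 \in Zpq n p q := wW.1 ord0.
    have w0L : w0 \in Lpq n p q by move: w0Z; rewrite ZpqP => /andP[/Apq_Lpq].
    have b := lift_top wW; rewrite -/w0 (ycomp0 w0L) in b.
    rewrite -[w0](subKr (act E11 1 w0)); apply: memv_add; last by rewrite memvN.
    rewrite KxP act_E11_idem eqxx andbT.
    exact: memv_eq (memvD (Bpq_Zpq b) w0Z) (subrK _ _).
  move: uK; rewrite KxP => /andP[uZ /eqP uE].
  have [P1 P2] := polar_lift uZ uE.
  exists ([ffun i : 'I_p.+1 => polar p u i] + [ffun => b]); last first.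
    by rewrite fE !ffunE /= (polar0 uZ uE).
  apply: memvD; first exact/WP/polar_lift.
  by apply/BBW/BBP => i; rewrite ffunE.
have := dimv_sum_cap Kx (Bpq n p q); rewrite Kx_cap_Bpq => dE.
by rewrite subnDl -(addnK (\dim (Kx :&: (Ideal n : {vspace ext n}))) (\dim (_ + _))%VS) dE subnAC addnK.
Qed.
End HighestWeight.

(** * Forests and partial fractions *)

(** The empty index range at [q = 0] keeps the truncated predecessor [q.-1 = 0] from admitting an
    attached point in a forest without edges. *)
Definition npar (m q : nat) : nat := if q is 0 then 0 else m.+1.

(* An element of [forest m q] is a formal combination of the monomials in which
   each point [k] in [1, ..., m] is either detached or attached to a parent
   [j < k], with exactly [q] attached points.  The first component collects the
   monomials with [m'.+1] detached, the second those with [m'.+1] attached. *)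
Fixpoint forest (m q : nat) {struct m} : vectType rat :=
  match m with
  | 0 => 'rV[rat]_(q == 0%N)
  | m'.+1 => (forest m' q * {ffun 'I_(npar m' q) -> forest m' q.-1})%type
  end.

Definition mkF m q (f0 : forest m q) (g : {ffun 'I_(npar m q) -> forest m q.-1}) :
  forest m.+1 q := (f0, g).
Definition detF m q (f : forest m.+1 q) : forest m q := f.1.
Definition attF m q (f : forest m.+1 q) : {ffun 'I_(npar m q) -> forest m q.-1} := f.2.

Lemma detF_is_linear m q : linear (@detF m q). Proof. by []. Qed.
Lemma attF_is_linear m q : linear (@attF m q). Proof. by []. Qed.
HB.instance Definition _ m q :=
  GRing.isLinear.Build rat (forest m.+1 q) (forest m q) *:%R (@detF m q) (@detF_is_linear m q).
HB.instance Definition _ m q :=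
  GRing.isLinear.Build rat (forest m.+1 q) {ffun 'I_(npar m q) -> forest m q.-1} *:%R
    (@attF m q) (@attF_is_linear m q).

Lemma mkF_eta m q (f : forest m.+1 q) : mkF (detF f) (attF f) = f.
Proof. by case: f. Qed.

Fixpoint ev (c : nat -> nat -> rat) (m q : nat) {struct m} : forest m q -> rat :=
  match m return forest m q -> rat with
  | 0 => fun f => \sum_j (f : 'rV[rat]_(q == 0%N)) 0 j
  | m'.+1 => fun f => ev c (detF f) + \sum_(j < npar m' q) c m'.+1 j * ev c (attF f j)
  end.

(* Up to sign, the coefficient of [y_i] in the image of the differential of a forest when
   [omega_ab] is sent to [c a b (x_a - x_b)]: each edge of a forest is
   differentiated in turn. *)
Fixpoint evD (c : nat -> nat -> rat) (i : nat) (m q : nat) {struct m} : forest m q -> rat :=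
  match m return forest m q -> rat with
  | 0 => fun=> 0
  | m'.+1 => fun f => evD c i (detF f) +
      \sum_(j < npar m' q) (c m'.+1 j * evD c i (attF f j)
              + ((m'.+1 == i)%:R - ((j : nat) == i)%:R) * ev c (attF f j))
  end.

Lemma evS c m q (f : forest m.+1 q) :
  ev c f = ev c (detF f) + \sum_(j < npar m q) c m.+1 j * ev c (attF f j).
Proof. by []. Qed.

Lemma evDS c i m q (f : forest m.+1 q) :
  evD c i f = evD c i (detF f) +
    \sum_(j < npar m q) (c m.+1 j * evD c i (attF f j)
              + ((m.+1 == i)%:R - ((j : nat) == i)%:R) * ev c (attF f j)).
Proof. by []. Qed.

Section Evaluation.
Implicit Types (c : nat -> nat -> rat) (z : nat -> rat).

Lemma ev_is_linear c m q : linear_for *%R (@ev c m q).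
Proof.
elim: m q => [|m IH] q k f g.
  by rewrite mulr_sumr -big_split; apply: eq_bigr => j _; rewrite !mxE.
rewrite !evS [detF _]linearP [attF _]linearP IH mulrDr mulr_sumr addrACA -big_split; congr (_ + _).
by apply: eq_bigr => j _; rewrite !ffunE IH /=; ring.
Qed.
HB.instance Definition _ c m q :=
  GRing.isLinear.Build rat (forest m q) rat *%R (@ev c m q) (@ev_is_linear c m q).

Lemma evD_is_linear c i m q : linear_for *%R (@evD c i m q).
Proof.
elim: m q => [|m IH] q k f g; first by rewrite /= mulr0 addr0.
rewrite !evDS [detF _]linearP [attF _]linearP IH mulrDr mulr_sumr addrACA -big_split; congr (_ + _).
by apply: eq_bigr => j _; rewrite !ffunE IH linearP /=; ring.
Qed.
HB.instance Definition _ c i m q :=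
  GRing.isLinear.Build rat (forest m q) rat *%R (@evD c i m q) (@evD_is_linear c i m q).

Lemma lt_npar m q (j : 'I_(npar m q)) : (j < m.+1)%N.
Proof. by case: q j => [|q] j; first case: j. Qed.

Lemma eq_ev c c' m q (f : forest m q) :
  (forall a b, (b < a <= m)%N -> c a b = c' a b) -> ev c f = ev c' f.
Proof.
elim: m q f => // m IH q f cc.
have cc' a b : (b < a <= m)%N -> c a b = c' a b.
  by move=> /andP[ba am]; rewrite cc // ba ltnW.
rewrite !evS (IH _ _ cc'); congr (_ + _); apply: eq_bigr => j _.
by rewrite (IH _ _ cc') cc // lt_npar leqnn.
Qed.

Lemma eq_evD c c' i m q (f : forest m q) :
  (forall a b, (b < a <= m)%N -> c a b = c' a b) -> evD c i f = evD c' i f.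
Proof.
elim: m q f => // m IH q f cc.
have cc' a b : (b < a <= m)%N -> c a b = c' a b.
  by move=> /andP[ba am]; rewrite cc // ba ltnW.
rewrite !evDS (IH _ _ cc'); congr (_ + _); apply: eq_bigr => j _.
by rewrite (IH _ _ cc') (eq_ev _ cc') cc // lt_npar leqnn.
Qed.

Lemma evD_gt c i m q (f : forest m q) : (m < i)%N -> evD c i f = 0.
Proof.
elim: m q f => // m IH q f mi; rewrite evDS IH 1?ltnW // add0r big1 // => j _.
rewrite IH 1?ltnW // mulr0 add0r !ltn_eqF ?subrr ?mul0r //.
exact: ltn_trans (lt_npar j) mi.
Qed.

Definition zinj m z := {in [pred k | (k <= m)%N] &, injective z}.
Definition wt z (a b : nat) : rat := (z a - z b)^-1.
Definition wt0 z (i a b : nat) : rat := if (a == i) || (b == i) then 0 else wt z a b.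
Definition upd z (k : nat) (s : rat) (a : nat) : rat := if a == k then s else z a.

Lemma zinjS m z : zinj m.+1 z -> zinj m z.
Proof. by move=> zi a b am bm; apply: zi; rewrite inE ltnW. Qed.

Lemma zinj_upd m z s : zinj m z -> (forall j, (j <= m)%N -> s != z j) -> zinj m.+1 (upd z m.+1 s).
Proof.
move=> zi sz; have le_m a : a != m.+1 -> (a <= m.+1)%N -> (a <= m)%N.
  by move=> am; rewrite -[(a <= m)%N]ltnS ltn_neqAle am.
move=> a b; rewrite !inE /upd.
have [->|am] := eqVneq a m.+1; have [->|bm] := eqVneq b m.+1 => //.
- by move=> _ /(le_m _ bm)/sz/eqP.
- by move=> /(le_m _ am)/sz + _ => /eqP ne /esym.
- by move=> /(le_m _ am) am' /(le_m _ bm) bm'; exact: zi.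
Qed.

Lemma poly_eq0_cofinite (P : {poly rat}) (l : seq rat) :
  (forall s, s \notin l -> P.[s] = 0) -> P = 0.
Proof.
move=> P0; have l0 : \prod_(x <- l) ('X - x%:P) != 0 :> {poly rat}.
  by rewrite prodf_seq_neq0; apply/allP => x _; rewrite polyXsubC_eq0.
suff : P * \prod_(x <- l) ('X - x%:P) == 0 by rewrite mulf_eq0 (negPf l0) orbF => /eqP.
set R := _ * _; apply/eqP.
apply: (@roots_geq_poly_eq0 _ R [seq k%:R | k <- iota 0 (size R)]).
- apply/allP => x _; rewrite rootE /R hornerM.
  have [xl|/P0->] := boolP (x \in l); last by rewrite mul0r.
  by rewrite (_ : (\prod_(y <- l) _).[x] = 0) ?mulr0 //; apply/eqP; rewrite -rootE root_prod_XsubC.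
- by rewrite map_inj_uniq ?iota_uniq // => a b /eqP; rewrite eqr_nat => /eqP.
- by rewrite size_map size_iota.
Qed.

(** Clearing denominators gives a polynomial with infinitely many roots. Its value at the pole [x j]
    is a nonzero multiple of [b j]; afterwards only [a] times a monic product is left. *)
Lemma partial_fractions n (x b : 'I_n -> rat) (a : rat) (l : seq rat) :
    injective x ->
    (forall s, s \notin l -> (forall j, s != x j) -> a + \sum_j (s - x j)^-1 * b j = 0) ->
  a = 0 /\ forall j, b j = 0.
Proof.
move=> xi H.
pose Q j : {poly rat} := \prod_(k | k != j) ('X - (x k)%:P).
pose P := a *: \prod_j ('X - (x j)%:P) + \sum_j b j *: Q j.
have P0 : P = 0.
  apply: (@poly_eq0_cofinite _ (l ++ [seq x j | j : 'I_n])) => s.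
  rewrite mem_cat negb_or => /andP[sl sx].
  have sj j : s != x j by apply: contraNneq sx => ->; exact: image_f.
  rewrite /P hornerD hornerZ horner_prod horner_sum.
  under eq_bigr do rewrite !hornerE.
  transitivity ((\prod_j (s - x j)) * (a + \sum_j (s - x j)^-1 * b j)); last by rewrite H // mulr0.
  rewrite mulrDr mulrC mulr_sumr; congr (_ + _); apply: eq_bigr => j _.
  rewrite hornerZ horner_prod; under eq_bigr do rewrite !hornerE.
  rewrite [in RHS](bigD1 j) //= [b j * _]mulrC mulrA; congr (_ * _).
  by rewrite mulrAC mulfV ?mul1r // subr_eq0.
have b0 j : b j = 0.
  have := congr1 (horner^~ (x j)) P0; rewrite /P hornerD hornerZ horner_prod horner_sum.
  have -> : \prod_i ('X - (x i)%:P).[x j] = 0.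
    by rewrite (bigD1 j) //= hornerXsubC subrr mul0r.
  have Qj : (Q j).[x j] != 0.
    rewrite horner_prod; apply/prodf_neq0 => k kj.
    by rewrite hornerXsubC subr_eq0 (inj_eq xi) eq_sym.
  have Qk k : k != j -> (Q k).[x j] = 0.
    by move=> kj; rewrite horner_prod (bigD1 j) 1?eq_sym //= hornerXsubC subrr mul0r.
  rewrite mulr0 add0r horner0 (bigD1 j) //= big1 ?addr0 => [|k kj].
    by rewrite hornerZ => /eqP; rewrite mulf_eq0 (negPf Qj) orbF => /eqP.
  by rewrite hornerZ Qk ?mulr0.
split=> //; move: P0; rewrite /P [X in _ + X]big1 => [|j _]; last by rewrite b0 scale0r.
rewrite addr0 => /eqP; rewrite scaler_eq0 => /orP[/eqP//|/prodf_eq0[j _]].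
by rewrite polyXsubC_eq0.
Qed.
End Evaluation.

Section Cocycles.
Implicit Types (z : nat -> rat).

Lemma upd_wt z m s a b : (b < a <= m)%N -> wt (upd z m.+1 s) a b = wt z a b.
Proof.
move=> /andP[ba am]; have bm := leq_trans (ltnW ba) am.
by rewrite /wt /upd !ltn_eqF.
Qed.

Lemma upd_wt0 z m s i a b : (b < a <= m)%N -> wt0 (upd z m.+1 s) i a b = wt0 z i a b.
Proof. by move=> H; rewrite /wt0 upd_wt. Qed.

Lemma upd_wt_top z m s j : (j <= m)%N -> wt (upd z m.+1 s) m.+1 j = (s - z j)^-1.
Proof. by move=> jm; rewrite /wt /upd eqxx ltn_eqF. Qed.

Lemma fresh_value m z : exists s, forall j, (j <= m)%N -> s != z j.
Proof.
exists (1 + \sum_(k < m.+1) `|z k|) => j jm; rewrite gt_eqF //.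
rewrite (bigD1 (Ordinal (jm : (j < m.+1)%N))) //= addrCA.
apply: le_lt_trans (ler_norm _) _; rewrite ltrDl.
by rewrite ltr_wpDr ?ltr01 // sumr_ge0.
Qed.

Lemma zinj_par m q z : zinj m z -> injective (fun j : 'I_(npar m q) => z j).
Proof. by move=> zi a b ab; apply/val_inj/zi => //; rewrite inE -ltnS lt_npar. Qed.

Lemma partial_fractions_zinj m q z (b : 'I_(npar m q) -> rat) (a : rat) :
    zinj m z ->
    (forall s, (forall j, (j <= m)%N -> s != z j) ->
      a + \sum_(j < npar m q) (s - z j)^-1 * b j = 0) ->
  a = 0 /\ forall j, b j = 0.
Proof.
move=> zi H; apply: (partial_fractions (l := map z (iota 0 m.+1)) (zinj_par zi)) => s sl _.
by apply: H => j jm; apply: contraNneq sl => ->; rewrite map_f // mem_iota.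
Qed.

(** As a function of the value [s] given to the last point, [ev] is a partial fraction with constant
    term [ev (detF f)] and residues [ev (attF f j)] at [z j]; all of these vanish and the induction
    applies. *)
Lemma ev_eq0 m q (f : forest m q) :
  (forall z, zinj m z -> ev (wt z) f = 0) -> f = 0.
Proof.
elim: m q f => [|m IH] q f f0.
  apply/rowP => j; rewrite mxE; move: (f0 (fun=> 0)); rewrite /= => <-.
    case: q f f0 j => [|q] f _ j; last by case: j.
    by rewrite big_ord_recl big_ord0 addr0 ord1.
  by move=> a b; rewrite !inE !leqn0 => /eqP-> /eqP->.
have H z : zinj m z -> ev (wt z) (detF f) = 0 /\ forall j, ev (wt z) (attF f j) = 0.
  move=> zi; apply: (partial_fractions_zinj zi) => s /(zinj_upd zi)/f0 E.
  rewrite -[RHS]E.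
  rewrite evS (eq_ev _ (@upd_wt z m s)). congr (_ + _); apply: eq_bigr => j _.
  by rewrite (eq_ev _ (@upd_wt z m s)) upd_wt_top // -ltnS lt_npar.
rewrite -[f]mkF_eta (IH _ (detF f)) => [|z /H[]//].
rewrite (_ : attF f = 0) //; apply/ffunP => j; rewrite ffunE.
by apply: IH => z /H[].
Qed.

(* With the weights of the edges at [i] set to [0] and all [y_j], [j != i], sent
   to [0], the relations [(y_a - y_b) omega_ab] are respected, so these conditions
   hold for closed elements; see [cocycle_of_closed]. *)
Definition cocycle m q (f : forest m q) : Prop :=
  forall z i, zinj m z -> (i <= m)%N -> evD (wt0 z i) i f = 0.

Lemma cocycle0 m q : cocycle (0 : forest m q).
Proof. by move=> z i _ _; rewrite linear0. Qed.

Lemma cocycle_lin m q (k : rat) (f g : forest m q) :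
  cocycle f -> cocycle g -> cocycle (k *: f + g).
Proof. by move=> cf cg z i zi im; rewrite [LHS]linearP /= (cf z i) // (cg z i) // mulr0 addr0. Qed.

Definition cocycles m q : {vspace forest m q} :=
  projT1 (cid (prop_vspace (@cocycle0 m q) (@cocycle_lin m q))).

Lemma cocyclesP m q (f : forest m q) : f \in cocycles m q <-> cocycle f.
Proof. exact: (projT2 (cid (prop_vspace (@cocycle0 m q) (@cocycle_lin m q)))). Qed.

(** Again a partial fraction in [s]. The edge from the new point to [i] has weight 0 and contributes
    only when it is differentiated itself, hence without a pole: this is the middle term. *)
Lemma evDS_lt z m q s i (f : forest m.+1 q) : (i <= m)%N -> zinj m z ->
  evD (wt0 (upd z m.+1 s) i) i f =
  evD (wt0 z i) i (detF f)
  - \sum_(j < npar m q) ((j : nat) == i)%:R * ev (wt0 z i) (attF f j)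
  + \sum_(j < npar m q) (s - z j)^-1 * (((j : nat) != i)%:R * evD (wt0 z i) i (attF f j)).
Proof.
move=> im zi; rewrite evDS (eq_evD _ _ (@upd_wt0 z m s i)) -addrA; congr (_ + _).
rewrite -sumrN -big_split; apply: eq_bigr => j _.
have jm : (j <= m)%N by rewrite -ltnS lt_npar.
rewrite (eq_evD _ _ (@upd_wt0 z m s i)) (eq_ev _ (@upd_wt0 z m s i)) /=.
rewrite {1}/wt0 upd_wt_top // gtn_eqF //= sub0r addrC mulNr; congr (_ + _).
by case: (j == i :> nat); rewrite ?mul0r ?mulr0 ?mul1r.
Qed.

(** All edges at [m.+1] have weight 0 here, so only the terms in which the edge from [m.+1] to its
    parent is differentiated survive, each with coefficient 1. *)
Lemma evDS_top z m q s (f : forest m.+1 q) : zinj m z ->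
  evD (wt0 (upd z m.+1 s) m.+1) m.+1 f = ev (wt z) (\sum_j attF f j).
Proof.
move=> zi; rewrite evDS evD_gt ?leqnn // add0r linear_sum; apply: eq_bigr => j _ /=.
rewrite {1}/wt0 eqxx mul0r add0r (ltn_eqF (lt_npar j)) subr0 mul1r.
apply: eq_ev => a b /andP[ba am].
rewrite /wt0 !ltn_eqF ?(leq_ltn_trans am) ?(leq_trans ba (leqW am)) //=.
by rewrite upd_wt // ba.
Qed.

Lemma cocycle_attF m q (f : forest m.+1 q) : cocycle f -> \sum_j attF f j = 0.
Proof.
move=> cf; apply: ev_eq0 => z zi; have [s sz] := fresh_value m z.
by rewrite -(evDS_top s f zi) cf //; exact: zinj_upd.
Qed.

(** Comparing poles gives the condition at [i] for every component other than [i]. The component [i]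
    has no pole, but it is minus the sum of the others by [cocycle_attF]. *)
Lemma cocycle_attF_cocycle m q (f : forest m.+1 q) j : cocycle f -> cocycle (attF f j).
Proof.
move=> cf z i zi im.
have other (k : 'I_(npar m q)) : (k : nat) != i -> evD (wt0 z i) i (attF f k) = 0.
  move=> ki.
  have [_ H] : evD (wt0 z i) i (detF f)
      - \sum_(j < npar m q) ((j : nat) == i)%:R * ev (wt0 z i) (attF f j) = 0
      /\ forall j : 'I_(npar m q), ((j : nat) != i)%:R * evD (wt0 z i) i (attF f j) = 0.
    apply: (partial_fractions_zinj zi) => s sz.
    by rewrite -(evDS_lt s f im zi) cf //; [exact: zinj_upd|exact: leqW].
  by have := H k; rewrite ki mul1r.
have [ji|] := eqVneq (j : nat) i; last exact: other.
have := congr1 (@evD (wt0 z i) i m q.-1) (cocycle_attF cf).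
rewrite linear0 linear_sum (bigD1 j) //= big1 ?addr0 // => k kj; apply: other.
by rewrite -ji (inj_eq val_inj).
Qed.

Lemma cocycle_mkF0 m q (f : forest m q) : cocycle (mkF f 0) <-> cocycle f.
Proof.
have E z i s : (i <= m)%N -> zinj m z ->
    evD (wt0 (upd z m.+1 s) i) i (mkF f 0) = evD (wt0 z i) i f.
  by move=> im zi; rewrite evDS_lt // !big1 ?subr0 ?addr0 // => j _;
     rewrite ffunE ?(linear0 (@ev (wt0 z i) m q.-1)) ?(linear0 (@evD (wt0 z i) i m q.-1)) !mulr0.
split=> cf z i zi im.
  have [s sz] := fresh_value m z; rewrite -(E z i s) // cf //; last exact: leqW.
  exact: zinj_upd.
have zE : z =1 upd z m.+1 (z m.+1) by move=> a; rewrite /upd; case: eqP => [->|].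
have wtE a b : wt0 z i a b = wt0 (upd z m.+1 (z m.+1)) i a b by rewrite /wt0 /wt -!zE.
rewrite (eq_evD _ _ (fun a b _ => wtE a b)).
have zim := zinjS zi; move: im; rewrite leq_eqVlt => /orP[/eqP->|im].
  by rewrite evDS_top // big1 ?linear0 // => j _; rewrite ffunE.
by rewrite E // cf.
Qed.
End Cocycles.

(** * Cyclic words *)

Definition pedges (w : seq nat) : seq (nat * nat) :=
  if w is x :: t then pairmap pair x t else [::].
(** A one-letter word has the loop [(x, x)] as its cyclic edge; its weight [wt z x x] is [0^-1 = 0],
    so the product over the cycle is 1. *)
Definition cedges (w : seq nat) : seq (nat * nat) :=
  if w is x :: t then pairmap pair x (rcons t x) else [::].

Lemma pairmap_rcons (x : nat) t y :
  pairmap pair x (rcons t y) = rcons (pairmap pair x t) (last x t, y).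
Proof. by elim: t x => //= a t IH x; rewrite IH. Qed.

Lemma cedgesE x t : cedges (x :: t) = rcons (pedges (x :: t)) (last x t, x).
Proof. exact: pairmap_rcons. Qed.

Lemma size_cedges w : size (cedges w) = size w.
Proof. by case: w => //= x t; rewrite size_pairmap size_rcons. Qed.

Lemma cedges_rot k w : cedges (rot k w) = rot k (cedges w).
Proof.
have [kw|wk] := leqP k (size w); last by rewrite !rot_oversize ?size_cedges // ltnW.
elim: k kw => [|k IH] kw; first by rewrite !rot0.
rewrite (rotS kw) [rot k.+1 (cedges w)]rotS ?size_cedges // -(IH (ltnW kw)).
case: (rot k w) => [|x [|y t]] //.
by rewrite rot1_cons /= rot1_cons !pairmap_rcons last_rcons.
Qed.

Lemma pedges_rot w i : (i < size w)%N ->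
  pedges (rot i.+1 w) = drop i.+1 (cedges w) ++ take i (cedges w).
Proof.
move=> iw; have := cedges_rot i.+1 w.
rewrite {2}/rot (take_nth (0, 0)%N) ?size_cedges // -rcons_cat.
have : (0 < size (rot i.+1 w))%N by rewrite size_rot (leq_ltn_trans _ iw).
by case: (rot i.+1 w) => // x t _; rewrite cedgesE => /rcons_inj[].
Qed.

Section Polynomials.
Variable z : nat -> rat.
Definition edgeP (e : nat * nat) : {poly rat} := 1 + wt z e.1 e.2 *: 'X.
Definition pathP w := \prod_(e <- pedges w) edgeP e.
Definition cycP w := \prod_(e <- cedges w) edgeP e.

Lemma cycP_rot k w : cycP (rot k w) = cycP w.
Proof. by rewrite /cycP cedges_rot; apply: perm_big; rewrite perm_rot. Qed.

(** A choice of q edges survives the omission of any one of the [size s - q] others; the factor q on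
    the coefficient of degree q is 'X times the derivative. *)
Lemma sum_omit (s : seq (nat * nat)) :
  \sum_(i < size s) \prod_(e <- drop i.+1 s ++ take i s) edgeP e =
  (size s)%:R * \prod_(e <- s) edgeP e - 'X * (\prod_(e <- s) edgeP e)^`().
Proof.
elim: s => [|e s IH].
  by rewrite big_ord0 big_nil -polyC1 derivC mul0r mulr0 subr0.
rewrite /= big_ord_recl /= drop0 cats0 big_cons derivM.
have -> : \sum_(i < size s) \prod_(e0 <- drop i.+1 s ++ e :: take i s) edgeP e0 =
    edgeP e * \sum_(i < size s) \prod_(e0 <- drop i.+1 s ++ take i s) edgeP e0.
  by rewrite mulr_sumr; apply: eq_bigr => i _; rewrite !big_cat big_cons /= mulrCA.
have -> : (edgeP e)^`() = (wt z e.1 e.2)%:P.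
  by rewrite derivD -polyC1 derivC derivZ derivX add0r -mul_polyC mulr1.
by rewrite IH -(natr1 (size s)) /edgeP -mul_polyC; ring.
Qed.

Lemma sum_pathP_rot w :
  \sum_(i < size w) pathP (rot i.+1 w) = (size w)%:R * cycP w - 'X * (cycP w)^`().
Proof.
rewrite /cycP -(size_cedges w) -sum_omit size_cedges; apply: eq_bigr => i _.
by rewrite /pathP pedges_rot.
Qed.

Lemma coef_sum_pathP_rot w q :
  \sum_(i < size w) (pathP (rot i.+1 w))`_q = ((size w)%:R - q%:R) * (cycP w)`_q.
Proof.
rewrite -coef_sum sum_pathP_rot coefB mulr_natl coefMn coefXM.
case: q => [|q] /=; first by rewrite !subr0 mulr_natl.
by rewrite coef_deriv mulrBl !mulr_natl.
Qed.

End Polynomials.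

Lemma eq_edges z z' (s : seq (nat * nat)) (P : pred nat) :
    {in P, z =1 z'} -> all (fun e => P e.1 && P e.2) s ->
  \prod_(e <- s) edgeP z e = \prod_(e <- s) edgeP z' e.
Proof.
move=> zz /allP sP; apply: eq_big_seq => e /sP /andP[e1 e2].
by rewrite /edgeP /wt !zz.
Qed.

Lemma all_cedges (P : pred nat) w : all P w -> all (fun e => P e.1 && P e.2) (cedges w).
Proof.
case: w => //= x t /andP[Px Pt].
have : all P (rcons t x) by rewrite all_rcons Px.
move: (rcons t x) => l {Pt}.
by elim: l x Px {t} => //= y t IH x -> /andP[Py Pt]; rewrite Py IH.
Qed.

Lemma all_pedges (P : pred nat) w : all P w -> all (fun e => P e.1 && P e.2) (pedges w).
Proof.
case: w => // x t /all_cedges; rewrite cedgesE all_rcons => /andP[_]; exact.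
Qed.

Lemma eq_cycP z z' m w : {in [pred k | (k <= m)%N], z =1 z'} ->
  all [pred k | (k <= m)%N] w -> cycP z w = cycP z' w.
Proof. by move=> zz /all_cedges; exact: eq_edges. Qed.

Lemma eq_pathP z z' m w : {in [pred k | (k <= m)%N], z =1 z'} ->
  all [pred k | (k <= m)%N] w -> pathP z w = pathP z' w.
Proof. by move=> zz /all_pedges; exact: eq_edges. Qed.

Definition word m (w : seq nat) : bool := perm_eq w (iota 0 m.+1).

Lemma word_all m w : word m w -> all [pred k | (k <= m)%N] w.
Proof.
by move=> wm; rewrite (perm_all _ wm); apply/allP => k; rewrite mem_iota.
Qed.

Lemma word_cons m w : word m w -> word m.+1 (m.+1 :: w).
Proof.
rewrite /word => wm; have -> : iota 0 m.+2 = rcons (iota 0 m.+1) m.+1.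
  by rewrite -cats1 -[m.+2]addn1 iotaD.
by rewrite perm_sym perm_rcons perm_cons perm_sym.
Qed.

Lemma word_rot m k w : word m w -> word m (rot k w).
Proof. by rewrite /word => wm; rewrite perm_rot. Qed.

Lemma size_word m w : word m w -> size w = m.+1.
Proof. by move/perm_size; rewrite size_iota. Qed.

Lemma insertion_identity (R : comNzRingType) (a b c X P : R) : a * - b = (a - b) * c ->
  (1 + a * X) * P * (1 + - b * X) = P + (a - b) * (X * (P * (1 + c * X))).
Proof.
move=> key; have -> : (a - b) * (X * (P * (1 + c * X))) = P * ((a - b) * X + (a - b) * c * X ^+ 2).
  by ring.
by rewrite -key; ring.
Qed.

Lemma insertion_poly (a b c : rat) (P : {poly rat}) : a * - b = (a - b) * c ->
  (1 + a *: 'X) * P * (1 + - b *: 'X) = P + (a - b) *: ('X * (P * (1 + c *: 'X))).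
Proof.
move=> key; have {}key : a%:P * - b%:P = (a%:P - b%:P) * c%:P :> {poly rat}.
  transitivity ((a * - b)%:P : {poly rat}); first by rewrite polyCM polyCN.
  by rewrite key polyCM polyCB.
rewrite -!mul_polyC polyCB polyCN.
exact: (insertion_identity 'X P key).
Qed.

(** Let a, b, c be the weights of the edges (n, x), (n, l), (l, x), where n is the new point and l
    the last letter. The factor 1 + cX is replaced by (1 + aX)(1 - bX), which is 1 + (a - b) X (1 +
    cX) because -ab = (a - b) c. *)
Lemma cycP_cons z m q x t (u := x :: t) : word m u -> (q <= m.+1)%N -> zinj m.+1 z ->
  (cycP z (m.+1 :: u))`_q = (pathP z u)`_q
     + (wt z m.+1 x - wt z m.+1 (last x t)) * ('X * cycP z u)`_q.
Proof.
move=> wu qm zi; set l := last x t; set n := m.+1.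
have allu := word_all wu.
have xm : (x <= m)%N by case/andP: allu.
have lm : (l <= m)%N by apply: (allP allu); exact: mem_last.
have ne k : (k <= m)%N -> z n - z k != 0.
  move=> km; rewrite subr_eq0; apply/eqP => /zi; rewrite !inE leqnn (leqW km).
  by move=> /(_ isT isT) E; move: km; rewrite -E ltnn.
have -> : cycP z (n :: u) = edgeP z (n, x) * pathP z u * edgeP z (l, n).
  by rewrite /cycP cedgesE -cats1 big_cat big_seq1 /= big_cons.
have -> : cycP z u = pathP z u * edgeP z (l, x).
  by rewrite /cycP cedgesE -cats1 big_cat big_seq1.
have wtN a b : wt z a b = - wt z b a by rewrite /wt -invrN opprB.
(* For a one-letter [u] the identity fails in degree 2, where [- wt z n x ^+ 2] appears; but then
   [m = 0], and [q <= 1] excludes that degree. *)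
have [lx|lx] := eqVneq l x.
  have t0 : t = [::].
    have : uniq u by rewrite (perm_uniq wu) iota_uniq.
    rewrite /u; move: lx; rewrite /l; case: (t) => //= y t' lx /andP[/negP[]].
    by rewrite -{1}lx mem_last.
  have m0 : m = 0%N by have := size_word wu; rewrite /u t0 => -[].
  rewrite lx subrr mul0r addr0 {1 2}/edgeP /= /pathP /u t0 big_nil mulr1.
  have -> : (1 + wt z n x *: 'X) * (1 + wt z x n *: 'X) = 1 - wt z n x ^+ 2 *: 'X^2 :> {poly rat}.
    by rewrite (wtN x n) -!mul_polyC polyCN polyC_exp; ring.
  rewrite coefB coefZ coefXn; move: qm; rewrite m0.
  by case: q => [|[|q]] //= _; rewrite mulr0 subr0.
rewrite -coefZ -coefD; congr (_`_q).
have Hlx : z l - z x != 0.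
  by rewrite subr_eq0; apply: contraNneq lx => /zi; rewrite !inE !leqW // => ->.
have key : wt z n x * wt z l n = (wt z n x - wt z n l) * wt z l x.
  rewrite /wt; have Hn1 := ne _ xm; have Hn2 := ne _ lm.
  have Hn3 : z l - z n != 0 by rewrite -opprB oppr_eq0.
  by field; rewrite Hn1 Hn2 Hn3 Hlx.
rewrite (wtN l n) in key; rewrite /edgeP /= (wtN l n).
congr polyseq; exact: insertion_poly.
Qed.

Definition represents m q (f : forest m q) (w : seq nat) : Prop :=
  forall z, zinj m z -> ev (wt z) f = (cycP z w)`_q.

Lemma represents_inj m q (f g : forest m q) w :
  represents f w -> represents g w -> f = g.
Proof.
move=> fw gw; apply/eqP; rewrite -subr_eq0; apply/eqP/ev_eq0 => z zi.
by rewrite linearB /= fw // gw // subrr.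
Qed.

Lemma represents_rot m q (f : forest m q) k w : represents f w -> represents f (rot k w).
Proof. by move=> fw z zi; rewrite cycP_rot fw. Qed.

(** Both [cycP_cons] and [ev f] are partial fractions in the value at [m.+1], so their constant
    terms and residues agree. *)
Lemma represents_cons m q (f : forest m.+1 q) x t : word m (x :: t) -> (q <= m.+1)%N ->
    represents f (m.+1 :: x :: t) ->
  forall z, zinj m z -> ev (wt z) (detF f) = (pathP z (x :: t))`_q /\
    forall j, ev (wt z) (attF f j) =
      (((j : nat) == x)%:R - ((j : nat) == last x t)%:R) * (cycP z (x :: t))`_q.-1.
Proof.
move=> wu qm fr z zi; set u := x :: t.
have allu := word_all wu.
have xm : (x < m.+1)%N by case/andP: allu.
have lm : (last x t < m.+1)%N by apply: (allP allu); exact: mem_last.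
pose a := ev (wt z) (detF f) - (pathP z u)`_q.
pose b (j : 'I_(npar m q)) := ev (wt z) (attF f j) -
   (((j : nat) == x)%:R - ((j : nat) == last x t)%:R) * (cycP z u)`_q.-1.
suff [a0 b0] : a = 0 /\ forall j, b j = 0.
  split=> [|j]; first by apply/eqP; rewrite -subr_eq0 -/a a0.
  by apply/eqP; rewrite -subr_eq0 -/(b j) b0.
apply: (partial_fractions_zinj zi) => s sz.
have zs := zinj_upd zi sz.
have := fr _ zs; rewrite (cycP_cons wu qm zs) evS (eq_ev _ (@upd_wt z m s)).
have updz : {in [pred k | (k <= m)%N], upd z m.+1 s =1 z}.
  by move=> k km; rewrite /upd ltn_eqF.
rewrite (eq_pathP updz allu) (eq_cycP updz allu) !upd_wt_top //.
have -> : \sum_(j < npar m q) wt (upd z m.+1 s) m.+1 j * ev (wt (upd z m.+1 s)) (attF f j) =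
   \sum_(j < npar m q) (s - z j)^-1 * ev (wt z) (attF f j).
  apply: eq_bigr => j _.
  by rewrite (eq_ev _ (@upd_wt z m s)) upd_wt_top // -ltnS lt_npar.
move=> E; under eq_bigr do rewrite /b mulrBr.
rewrite sumrB addrA [a + _](_ : _ = ((s - z x)^-1 - (s - z (last x t))^-1) * ('X * cycP z u)`_q); last first.
  by rewrite /a addrAC E addrC addKr.
apply/eqP; rewrite subr_eq0; apply/eqP; rewrite coefXM.
case: q {fr E a b f} qm => [|q] qm /=; first by rewrite big_ord0 mulr0.
under eq_bigr do rewrite mulrA; rewrite -mulr_suml; congr (_ * _).
under eq_bigr do rewrite mulrBr; rewrite sumrB; congr (_ - _).
  rewrite (bigD1 (Ordinal xm)) //= eqxx mulr1 big1 ?addr0 // => j.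
  by rewrite -val_eqE /= => /negPf->; rewrite mulr0.
rewrite (bigD1 (Ordinal lm)) //= eqxx mulr1 big1 ?addr0 // => j.
by rewrite -val_eqE /= => /negPf->; rewrite mulr0.
Qed.

Lemma npar_gt0 m q (j : 'I_(npar m q)) : (0 < q)%N.
Proof. by case: q j => // -[]. Qed.

Lemma head_rot (w : seq nat) i : (i < size w)%N -> head 0 (rot i w) = nth 0 w i.
Proof. by move=> iw; rewrite /rot (drop_nth 0 iw). Qed.

Lemma last_rot (w : seq nat) i : (i < size w)%N -> last 0 (rot i.+1 w) = nth 0 w i.
Proof. by move=> iw; rewrite /rot (take_nth 0 iw) last_cat last_rcons. Qed.

Lemma sum_head_last (w : seq nat) (F : nat -> rat) :
  \sum_(i < size w) (F (head 0 (rot i.+1 w)) - F (last 0 (rot i.+1 w))) = 0.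
Proof.
rewrite sumrB; apply/eqP; rewrite subr_eq0; apply/eqP.
transitivity (\sum_(x <- rot 1 w) F x).
  rewrite (big_nth 0) big_mkord size_rot; apply: eq_bigr => i _.
  by rewrite -head_rot ?size_rot // -rotD addn1.
rewrite (perm_big w) ?perm_rot // (big_nth 0) big_mkord; apply: eq_bigr => i _.
by rewrite last_rot.
Qed.

(** * Forests in the exterior algebra *)

Lemma prod_gL_eS n (l : seq (gen n)) : uniq l ->
  exists2 e : rat, e != 0 & \prod_(s <- l) gL s = e *: (eS [set s in l] : ext n).
Proof.
elim: l => [_|s l IH /= /andP[sl /IH[e e0 E]]].
  exists 1; rewrite ?oner_neq0 // big_nil scale1r.
  by rewrite (_ : [set s in [::]] = set0) //; apply/setP => s; rewrite !inE.
exists (e * (-1) ^+ before [set t in l] s); first by rewrite mulf_neq0 ?signr_eq0.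
rewrite big_cons E -scalerAr gL_eS inE (negPf sl) scalerA; congr (_ *: eS _).
by apply/setP => t; rewrite !inE.
Qed.

Lemma eS_neq0 n (S : {set gen n}) : (eS S : ext n) != 0.
Proof. by apply/eqP => /ffunP/(_ S)/eqP; rewrite !ffunE eqxx oner_eq0. Qed.

Lemma prod_gL_neq0 n (l : seq (gen n)) : uniq l -> \prod_(s <- l) gL s != 0 :> ext n.
Proof. by move=> /prod_gL_eS[e e0 ->]; rewrite scaler_eq0 negb_or e0 eS_neq0. Qed.

Lemma prod_gL_perm n (l l' : seq (gen n)) : uniq l -> perm_eq l l' ->
  exists2 e : rat, e != 0 & \prod_(s <- l) gL s = e *: \prod_(s <- l') gL s :> ext n.
Proof.
move=> ul pll'; have [e e0 ->] := prod_gL_eS ul.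
have [|e' e0' ->] := @prod_gL_eS n l'; first by rewrite -(perm_uniq pll').
exists (e / e'); first by rewrite mulf_neq0 ?invr_eq0.
rewrite scalerA divfK //; congr (_ *: eS _).
by apply/setP => s; rewrite !inE (perm_mem pll').
Qed.

Section ForestElements.
Variable N : nat.
Local Notation ext := (ext N.+1).
Implicit Types (a b : ext) (z : nat -> rat) (c : nat -> nat -> rat).

Definition ix (k : nat) : 'I_N.+1 := inord k.
Definition Dx i j : ext := dx (ix i) (ix j).
Definition Om i j : ext := om (ix i) (ix j).

(** With the factor [x_k - x_0] for a detached point, every point k > 0 contributes exactly one
    factor of degree one, and [wmap] sends all forests to multiples of one volume form. *)
Fixpoint G (m q : nat) {struct m} : forest m q -> ext :=
  match m return forest m q -> ext with
  | 0 => fun f => (\sum_j (f : 'rV[rat]_(q == 0%N)) 0 j)%:A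
  | m'.+1 => fun f => Dx m'.+1 0 * G (detF f)
                      + \sum_(j < npar m' q) Om m'.+1 j * G (attF f j)
  end.

Lemma GS m q (f : forest m.+1 q) :
  G f = Dx m.+1 0 * G (detF f) + \sum_(j < npar m q) Om m.+1 j * G (attF f j).
Proof. by []. Qed.

Lemma G_is_linear m q : linear (@G m q).
Proof.
elim: m q => [|m IH] q k f g.
  rewrite /G scalerA -scalerDl; congr (_ *: _).
  by rewrite mulr_sumr -big_split; apply: eq_bigr => j _; rewrite !mxE.
rewrite !GS [detF _]linearP [attF _]linearP IH mulrDr -scalerAr scalerDr addrACA.
congr (_ + _); rewrite scaler_sumr -big_split; apply: eq_bigr => j _ /=.
by rewrite !ffunE IH mulrDr scalerAr.
Qed.
HB.instance Definition _ m q :=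
  GRing.isLinear.Build rat (forest m q) ext *:%R (@G m q) (@G_is_linear m q).

Section WeightMap.
Variables (c : nat -> nat -> rat) (eta : nat -> rat).
Hypothesis cN : forall i j, c j i = - c i j.
Hypothesis cA : forall i j k, (i <= N)%N -> (j <= N)%N -> (k <= N)%N ->
  [&& i != j, j != k & k != i] -> c i j * c j k + c j k * c k i + c k i * c i j = 0.
Hypothesis ceta : forall i j, c i j * eta i = 0.

Let WX (i : 'I_N.+1) : ext := xg i.
Let WY (i : 'I_N.+1) : ext := eta i *: yg i.
Let WO (i j : 'I_N.+1) : ext := c i j *: dx i j.

(** Used twice: [c = wt z] and [eta = 0] separate forests modulo the ideal; [c = wt0 z i] and [eta]
    the indicator of [i] extract the coefficient of [y_i] from [d (G f)]. *)
Definition wmap : ext -> ext := gmap WX WY WO.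
HB.instance Definition _ := GRing.Linear.on wmap.

Let WX1 i : WX i \in deg1 N.+1. Proof. exact: xg_deg1. Qed.
Let WY1 i : WY i \in deg1 N.+1. Proof. exact/memvZ/yg_deg1. Qed.
Let WO1 i j : WO i j \in deg1 N.+1. Proof. exact/memvZ/dx_deg1. Qed.
Let WOsym i j : WO i j = WO j i.
Proof. by rewrite /WO cN dxN scaleNr scalerN opprK. Qed.
Let WOdiag i : WO i i = 0.
Proof. by rewrite /WO dx_diag scaler0. Qed.

Lemma wmapM a b : wmap (a * b) = wmap a * wmap b.
Proof. exact: (gmapM WX1 WY1 WO1). Qed.
Lemma wmap1 : wmap 1 = 1. Proof. exact: gmap1. Qed.
Lemma wmap_dx i j : wmap (dx i j) = dx i j.
Proof. exact: (gmap_dx WX1 WY1 WO1). Qed.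
Lemma wmap_dy i j : wmap (dy i j) = eta i *: yg i - eta j *: yg j.
Proof. exact: (gmap_dy WX1 WY1 WO1). Qed.
Lemma wmap_om i j : wmap (om i j) = c i j *: dx i j.
Proof. exact: (gmap_om WX1 WY1 WO1 WOsym WOdiag). Qed.

(** The products of two consecutive sides of an oriented triangle all coincide, so the Arnold
    relation maps to a multiple of the scalar sum in [cA]. The relation with [x] becomes a square,
    and the one with [y] dies by [ceta] at both ends of the edge. *)
Lemma wmap_Ideal a : a \in Ideal N.+1 -> wmap a = 0.
Proof.
move=> aI; apply/eqP; rewrite -memv0.
apply: (gmap_Ideal WX1 WY1 WO1 WOsym WOdiag _ _ _ _ aI).
- by move=> u v; rewrite memv0 => /eqP->; rewrite mulr0 mem0v.
- by move=> i j; rewrite /WO -scalerAr deg1_sq ?dx_deg1 // scaler0 mem0v.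
- move=> i j; rewrite /WY /WO -scalerAr mulrBl -!scalerAl scalerBr !scalerA ceta.
  by rewrite -[c i j]opprK -cN mulNr ceta oppr0 !scale0r subrr mem0v.
move=> i j k; rewrite memv0 /WO.
have ZZ (s t : rat) u v : s *: u * (t *: v) = (s * t) *: (u * v) :> ext.
  by rewrite -scalerAl -scalerAr scalerA.
rewrite !ZZ.
have Eki : dx k i = - (dx i j + dx j k) by rewrite dxD dxN.
have E1 : dx j k * dx k i = dx i j * dx j k.
  rewrite Eki mulrN mulrDr [dx j k * dx j k]deg1_sq ?dx_deg1 // addr0.
  by rewrite (deg1_anti (dx_deg1 j k) (dx_deg1 i j)) opprK.
have E2 : dx k i * dx i j = dx i j * dx j k.
  rewrite Eki mulNr mulrDl [dx i j * dx i j]deg1_sq ?dx_deg1 // add0r.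
  by rewrite (deg1_anti (dx_deg1 j k) (dx_deg1 i j)) opprK.
rewrite E1 E2 -!scalerDl.
have [->|ij] := eqVneq i j; first by rewrite dx_diag mul0r scaler0.
have [->|jk] := eqVneq j k; first by rewrite dx_diag mulr0 scaler0.
have [->|ki] := eqVneq k i.
  by rewrite [dx j i]dxN mulrN deg1_sq ?dx_deg1 // oppr0 scaler0.
have H : c i j * c j k + c j k * c k i + c k i * c i j = 0.
  by apply: cA; rewrite ?leq_ord // !(inj_eq val_inj) ij jk.
by rewrite [X in X *: _](_ : _ = 0) ?scale0r // -[RHS]H; ring.
Qed.

Fixpoint vol (m : nat) : ext := if m is m'.+1 then Dx m 0 * vol m' else 1.

Lemma Dx_deg1 i j : Dx i j \in deg1 N.+1. Proof. exact: dx_deg1. Qed.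
Lemma Dx_sub i j : Dx i j = Dx i 0 - Dx j 0.
Proof. by rewrite /Dx -dxN dxD. Qed.

Lemma Dx_vol i m : (i <= m)%N -> Dx i 0 * vol m = 0.
Proof.
elim: m => [|m IH].
  by rewrite leqn0 => /eqP->; rewrite /Dx dx_diag mul0r.
rewrite leq_eqVlt => /orP[/eqP->|im] /=.
  by rewrite mulrA deg1_sq ?Dx_deg1 // mul0r.
by rewrite mulrA (deg1_anti (Dx_deg1 _ _) (Dx_deg1 _ _)) mulNr -mulrA IH // mulr0 oppr0.
Qed.

(** The difference of [Dx m.+1 i] and [Dx m.+1 0] is a multiple of [Dx i 0], which annihilates
    [vol m]; so the choice of a parent affects the scalar but not the form. *)
Lemma Dx_volS i m : (i <= m)%N -> Dx m.+1 i * vol m = vol m.+1.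
Proof. by move=> im; rewrite Dx_sub mulrBl (Dx_vol im) subr0. Qed.

Lemma ixK k : (k <= N)%N -> ix k = k :> nat.
Proof. by move=> kN; rewrite inordK. Qed.

Lemma wmap_Dx i j : wmap (Dx i j) = Dx i j. Proof. exact: wmap_dx. Qed.
Lemma wmap_Om i j : (i <= N)%N -> (j <= N)%N -> wmap (Om i j) = c i j *: Dx i j.
Proof. by move=> iN jN; rewrite wmap_om !ixK. Qed.

Lemma wmap_G m q (f : forest m q) : (m <= N)%N -> wmap (G f) = ev c f *: vol m.
Proof.
elim: m q f => [|m IH] q f mN; first by rewrite linearZ /= wmap1.
have mN' := ltnW mN.
rewrite GS evS scalerDl linearD linear_sum /= wmapM wmap_Dx (IH _ _ mN') -scalerAr.
congr (_ + _); rewrite scaler_suml; apply: eq_bigr => j _.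
have jm : (j <= m)%N by rewrite -ltnS lt_npar.
rewrite [LHS]wmapM (wmap_Om mN (leq_trans jm mN')) (IH _ _ mN').
by rewrite -scalerAl -[in LHS]scalerAr scalerA (Dx_volS jm).
Qed.

(** Moving [d] and then [y_i] past a degree-one factor costs two signs, which cancel; the sign left
    over comes from taking [y_i] out of the differentiated factor. *)
Lemma wmap_dG i m q (f : forest m q) :
    (forall k, eta k = (k == i)%:R) -> (m <= N)%N ->
  wmap (d (G f)) = - evD c i f *: (yg (ix i) * vol m).
Proof.
move=> etaE; elim: m q f => [|m IH] q f mN.
  by rewrite linearZ /= d1 scaler0 linear0 oppr0 scale0r.
have mN' := ltnW mN; set y := yg (ix i).
have yC k l a : Dx k l * (y * a) = - (y * (Dx k l * a)).
  by rewrite mulrA (deg1_anti (Dx_deg1 _ _) (yg_deg1 _)) mulNr mulrA.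
have dDx k l b : wmap (d (Dx k l * b)) = - (Dx k l * wmap (d b)).
  by rewrite d_deg1M ?Dx_deg1 // [d (Dx k l)]d_dx mul0r sub0r linearN /= wmapM wmap_Dx.
have dOm j b : (j <= m)%N -> wmap (d (Om m.+1 j * b)) =
    ((m.+1 == i)%:R - (j == i)%:R) *: (Dx m.+1 j * y * wmap b) - c m.+1 j *: (Dx m.+1 j * wmap (d b)).
  move=> jm; have jN := leq_trans jm mN'.
  rewrite d_deg1M ?om_deg1 // [d (Om _ _)]d_om linearB /= !wmapM (wmap_Om mN jN) -scalerAl.
  congr (_ - _); rewrite [wmap (dx _ _)]wmap_Dx wmap_dy (ixK mN) (ixK jN) !etaE.
  have -> : (m.+1 == i)%:R *: yg (ix m.+1) - (j == i)%:R *: yg (ix j)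
      = ((m.+1 == i)%:R - (j == i)%:R) *: y :> ext.
    rewrite scalerBl /y; congr (_ - _); first by case: eqP => [->|]; rewrite ?scale0r.
    by case: eqP => [->|]; rewrite ?scale0r.
  by rewrite -scalerAr -scalerAl.
rewrite GS evDS opprD scalerDl !linearD /= dDx (IH _ _ mN') -scalerAr yC scalerN opprK.
congr (_ + _); rewrite !linear_sum /= -sumrN scaler_suml; apply: eq_bigr => j _.
have jm : (j <= m)%N by rewrite -ltnS lt_npar.
rewrite (dOm _ _ jm) (wmap_G _ mN') (IH _ _ mN') -!scalerAr -mulrA !yC (Dx_volS jm).
move: (y * vol m.+1) => v.
rewrite !scalerN !scalerA -!scaleNr -scalerDl; congr (_ *: _).
ring.
Qed.
End WeightMap.

Definition xgen (k : nat) : gen N.+1 := inl (ix k, true).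

Lemma uniq_xgen l : all (fun k => k <= N)%N l -> uniq l -> uniq (map xgen l).
Proof.
move=> /allP lN ul; rewrite map_inj_in_uniq // => a b /lN aN /lN bN [] /(congr1 val).
by rewrite /= !ixK.
Qed.

(** Multiplication by [x_0] turns each factor [x_k - x_0] into [x_k], so the volume form becomes a
    monomial up to sign and is visibly nonzero. *)
Lemma xg_vol m : (m <= N)%N ->
  xg (ix 0) * vol m = (-1) ^+ m *: \prod_(s <- map xgen (rev (iota 0 m.+1))) gL s :> ext.
Proof.
elim: m => [|m IH] mN; first by rewrite /= big_seq1 scale1r mulr1.
have -> : rev (iota 0 m.+2) = m.+1 :: rev (iota 0 m.+1).
  by rewrite -[m.+2]addn1 iotaD rev_cat.
rewrite map_cons big_cons -[gL _]/(xg (ix m.+1)) exprS -scalerA scalerAr -IH 1?ltnW // scaleN1r.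
rewrite /= mulrA mulrBr [xg (ix 0) * xg (ix 0)]deg1_sq ?xg_deg1 // subr0.
by rewrite (deg1_anti (xg_deg1 (ix 0)) (xg_deg1 _)) mulNr mulrA.
Qed.

Lemma all_rev_iota : all (fun k => k <= N)%N (rev (iota 0 N.+1)).
Proof. by rewrite all_rev; apply/allP => k; rewrite mem_iota. Qed.

Lemma xg_vol_neq0 : xg (ix 0) * vol N != 0.
Proof.
rewrite xg_vol // scaler_eq0 signr_eq0 /=; apply/prod_gL_neq0/uniq_xgen.
  exact: all_rev_iota.
by rewrite rev_uniq; exact: (iota_uniq 0 N.+1).
Qed.

Lemma yg_vol_neq0 i : yg (ix i) * vol N != 0.
Proof.
apply/eqP => /(congr1 (fun a => xg (ix 0) * a)); rewrite mulr0 mulrA.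
rewrite (deg1_anti (xg_deg1 _) (yg_deg1 _)) mulNr -mulrA xg_vol // -scalerAr.
move/eqP; rewrite oppr_eq0 scaler_eq0 signr_eq0 /=; apply/negP.
have := @prod_gL_neq0 _ (inl (ix i, false) :: map xgen (rev (iota 0 N.+1))).
rewrite big_cons; apply; rewrite cons_uniq; apply/andP; split; first by apply/mapP => -[].
by apply: (uniq_xgen all_rev_iota); rewrite rev_uniq; exact: (iota_uniq 0 N.+1).
Qed.
End ForestElements.

(** * Straightening to normal forms modulo the ideal *)

Section Straightening.
Variable N : nat.
Local Notation ext := (ext N.+1).
Local Notation Idl := (Ideal N.+1 : {vspace ext}).
Local Notation Dx := (@Dx N).
Local Notation Om := (@Om N).
Implicit Types (a b u : ext) (V : {vspace ext}).

Definition lmulv u (V : {vspace ext}) : {vspace ext} := (linfun (lmulf u) @: V)%VS.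

Lemma lmulvP u V a : reflect (exists2 v, v \in V & a = u * v) (a \in lmulv u V).
Proof.
by apply: (iffP memv_imgP) => -[v vV ->]; exists v; rewrite ?lfunE.
Qed.

Lemma mem_lmulv u V v : v \in V -> u * v \in lmulv u V.
Proof. by move=> vV; apply/lmulvP; exists v. Qed.

(* Span of the normal forms of bidegree [(p, q)] in the points [0, ..., m]:
   each point [k > 0] contributes [x_k - x_0], or one [omega_kj] with [j < k],
   or nothing. *)
Fixpoint normal (m p q : nat) : {vspace ext} :=
  match m with
  | 0 => ((if (p == 0%N) && (q == 0%N) then <[1 : ext]> else 0) + Idl)%VS
  | m'.+1 => (normal m' p q
      + (if p is p'.+1 then lmulv (Dx m'.+1 0) (normal m' p' q) else 0)
      + (if q is q'.+1 then \sum_(j < m'.+1) lmulv (Om m'.+1 j) (normal m' p q') else 0))%VS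
  end.

Lemma Ideal_normal m p q : (Idl <= normal m p q)%VS.
Proof.
elim: m p q => [|m IH] p q; first exact: addvSr.
exact: subv_trans (subv_trans (IH p q) (addvSl _ _)) (addvSl _ _).
Qed.

Lemma normalS m p q : (normal m p q <= normal m.+1 p q)%VS.
Proof. exact: subv_trans (addvSl _ _) (addvSl _ _). Qed.

Lemma normal_Dx_top m p q a : a \in normal m p q -> Dx m.+1 0 * a \in normal m.+1 p.+1 q.
Proof.
move=> aT; apply: (subvP (addvSl _ _)); apply: (subvP (addvSr _ _)).
exact: mem_lmulv.
Qed.

Lemma normal_Om_top m p q j a : (j <= m)%N ->
  a \in normal m p q -> Om m.+1 j * a \in normal m.+1 p q.+1.
Proof.
move=> jm aT; apply: (subvP (addvSr _ _)).
by apply: (subvP (sumv_sup (Ordinal (jm : (j < m.+1)%N)) _ (subvv _))) => //; exact: mem_lmulv.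
Qed.

Lemma normal_sub m p q (U : {vspace ext}) :
    (forall b, b \in normal m p q -> b \in U) ->
    (forall p' b, p = p'.+1 -> b \in normal m p' q -> Dx m.+1 0 * b \in U) ->
    (forall q' j b, q = q'.+1 -> (j <= m)%N -> b \in normal m p q' -> Om m.+1 j * b \in U) ->
  forall a, a \in normal m.+1 p q -> a \in U.
Proof.
move=> H1 H2 H3; apply/subvP; rewrite /= !subv_add -andbA; apply/and3P; split.
- exact/subvP.
- case: p H2 {H1 H3} => [|p] H2; first exact: sub0v.
  by apply/subvP => _ /lmulvP[b bT ->]; exact: H2.
- case: q H3 {H1 H2} => [|q] H3; first exact: sub0v.
  apply/subv_sumP => j _; apply/subvP => _ /lmulvP[b bT ->].
  by apply: H3 bT => //; rewrite -ltnS.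
Qed.

Lemma Om_deg1 i j : Om i j \in deg1 N.+1. Proof. exact: om_deg1. Qed.

Lemma swap_deg1 u v a : u \in deg1 N.+1 -> v \in deg1 N.+1 -> u * (v * a) = - (v * (u * a)).
Proof. by move=> ud vd; rewrite mulrA (deg1_anti ud vd) mulNr -mulrA. Qed.

Lemma memv_modl (U : {vspace ext}) a b : (Idl <= U)%VS -> a - b \in Idl -> b \in U -> a \in U.
Proof. by move=> /subvP IU ab bU; rewrite -[a](subrK b) memvD // IU. Qed.

Lemma Dx_Om_Ideal i j a : Dx i 0 * (Om i j * a) - Dx j 0 * (Om i j * a) \in Idl.
Proof.
rewrite -mulrBl -Dx_sub mulrA; apply: Ideal_mulr; exact: Ideal_x.
Qed.

(** If [k] is the last point and is attached to [j], the ideal allows [x_k] to be replaced by [x_j],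
    and the factor moves down to the earlier points. *)
Lemma normal_Dx m p q k a : (k <= m)%N ->
  a \in normal m p q -> Dx k 0 * a \in normal m p.+1 q.
Proof.
elim: m p q k a => [|m IH] p q k a km aT.
  by move: km; rewrite leqn0 => /eqP->; rewrite /Dx dx_diag mul0r mem0v.
have lm u b V : (b \in linfun (lmulf u) @^-1: V)%VS = (u * b \in V) by rewrite -memv_preim lfunE.
rewrite -lm; move: a aT; move: km; rewrite leq_eqVlt => /orP[/eqP->|km].
  apply: normal_sub => [b bT|p' b pE bT|q' j b qE jm bT]; rewrite lm.
  - exact: normal_Dx_top.
  - by rewrite mulrA deg1_sq ?Dx_deg1 // mul0r mem0v.
  - apply: memv_modl (Ideal_normal _ _ _) (Dx_Om_Ideal _ _ _) _.
    rewrite swap_deg1 ?Dx_deg1 ?Om_deg1 // memvN qE.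
    by apply: normal_Om_top => //; apply: IH.
apply: normal_sub => [b bT|p' b pE bT|q' j b qE jm bT]; rewrite lm.
- by apply: (subvP (normalS _ _ _)); apply: IH.
- rewrite swap_deg1 ?Dx_deg1 // memvN.
  by apply: normal_Dx_top; rewrite pE; apply: IH.
- rewrite swap_deg1 ?Dx_deg1 ?Om_deg1 // memvN qE.
  by apply: normal_Om_top => //; apply: IH.
Qed.

(** The Arnold relation as a rewriting rule: two edges at [m] are traded for one edge at [m] and the
    edge between [i] and [j]. *)
Lemma Om_Arnold m i j b :
  Om m i * (Om m j * b) - (Om m i * (Om j i * b) - Om m j * (Om j i * b)) \in Idl.
Proof.
have := Ideal_mulr b (Ideal_om (@ix N i) (@ix N m) (@ix N j)).
move=> H; apply: memv_eq H _.
have -> : om (ix N j) (ix N i) * om (ix N i) (ix N m) = - (Om m i * Om j i).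
  by rewrite (deg1_anti (om_deg1 _ _) (om_deg1 _ _)); congr (- (_ * _)); exact: om_sym.
rewrite (om_sym (ix N i)) opprB addrA !mulrDl mulNr -!mulrA.
by [].
Qed.

Lemma normal_Om m p q k i a : (i < k)%N -> (k <= m)%N ->
  a \in normal m p q -> Om k i * a \in normal m p q.+1.
Proof.
elim: m p q k i a => [|m IH] p q k i a ik km aT.
  by move: km ik; rewrite leqn0 => /eqP->.
have lm u b V : (b \in linfun (lmulf u) @^-1: V)%VS = (u * b \in V) by rewrite -memv_preim lfunE.
rewrite -lm; move: a aT; move: km; rewrite leq_eqVlt => /orP[/eqP kE|km].
  subst k; apply: normal_sub => [b bT|p' b pE bT|q' j b qE jm bT]; rewrite lm.
  - exact: normal_Om_top.
  - have -> : Om m.+1 i * (Dx m.+1 0 * b) = - (Dx m.+1 0 * (Om m.+1 i * b)).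
      by rewrite swap_deg1 ?Om_deg1 ?Dx_deg1.
    rewrite memvN; apply: memv_modl (Ideal_normal _ _ _) (Dx_Om_Ideal _ _ _) _.
    rewrite swap_deg1 ?Dx_deg1 ?Om_deg1 // memvN.
    by apply: normal_Om_top => //; rewrite pE; apply: normal_Dx.
  - have [->|ij] := eqVneq i j; first by rewrite mulrA deg1_sq ?Om_deg1 // mul0r mem0v.
    apply: memv_modl (Ideal_normal _ _ _) (Om_Arnold _ _ _ _) _.
    have bji : Om j i * b \in normal m p q.
      rewrite qE; case: (ltngtP i j) ij => // [ij|ji] _; first exact: IH.
      by rewrite /Om om_sym; apply: IH bT.
    by rewrite memvB //; apply: normal_Om_top.
apply: normal_sub => [b bT|p' b pE bT|q' j b qE jm bT]; rewrite lm.
- by apply: (subvP (normalS _ _ _)); apply: IH.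
- rewrite swap_deg1 ?Dx_deg1 ?Om_deg1 // memvN pE.
  by apply: normal_Dx_top; apply: IH.
- rewrite swap_deg1 ?Om_deg1 // memvN.
  by apply: normal_Om_top => //; rewrite qE; apply: IH.
Qed.

Lemma normal_gt m p q a : (m < p + q)%N -> a \in normal m p q -> a \in Idl.
Proof.
elim: m p q a => [|m IH] p q a pq.
  have E : (p == 0%N) && (q == 0%N) = false by case: p q pq => [|p] [].
  by rewrite /= E add0v.
apply: normal_sub => [b bT|p' b pE bT|q' j b qE jm bT].
- by apply: IH bT; rewrite ltnW.
- by apply: Ideal_mull; apply: IH bT; move: pq; rewrite pE.
- by apply: Ideal_mull; apply: IH bT; move: pq; rewrite qE addnS.
Qed.

(** Each of the points 1, ..., m contributes at most one factor, so in total degree [m] each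
    contributes exactly one and the normal forms are forests. The summand in which the last point
    contributes nothing lies in the ideal by [normal_gt]. *)
Lemma normal_G m p q a : (p + q = m)%N -> a \in normal m p q ->
  exists f : forest m q, a - G N f \in Idl.
Proof.
suff: (p + q = m)%N -> a \in normal m p q -> a \in (limg (linfun (@G N m q)) + Idl)%VS.
  move=> H pq /(H pq)/memv_addP[_ /memv_imgP[f _ ->] [b bI ->]]; exists f.
  by rewrite lfunE addrC addKr.
have inG m' q' (f : forest m' q') b : b - G N f \in Idl -> b \in (limg (linfun (@G N m' q')) + Idl)%VS.
  move=> bI; rewrite -[b](subrK (G N f)) addrC memv_add //.
  by rewrite -[G N f]lfunE memv_img ?memvf.
elim: m p q a => [|m IH] p q a pq.
  move: pq => /eqP; rewrite addn_eq0 => /andP[/eqP-> /eqP->] /=.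
  move=> /memv_addP[_ /vlineP[k ->] [b bI ->]]; apply: (inG 0 0 (const_mx k : 'rV_1)).
  by rewrite /= big_ord_recl big_ord0 addr0 mxE addrC addKr.
have exG m' p' q' b : (forall a, (p' + q' = m')%N -> a \in normal m' p' q' ->
     a \in (limg (linfun (@G N m' q')) + Idl)%VS) -> (p' + q' = m')%N ->
     b \in normal m' p' q' -> exists f : forest m' q', b - G N f \in Idl.
  move=> H pq' /(H b pq')/memv_addP[_ /memv_imgP[f _ ->] [c cI ->]]; exists f.
  by rewrite lfunE addrC addKr.
apply: normal_sub => [b bT|p' b pE bT|q' j b qE jm bT].
- by apply: (subvP (addvSr _ _)); apply: normal_gt bT; rewrite pq.
- have [|f fE] := exG _ _ _ _ (IH p' q) _ bT; first by move: pq; rewrite pE => -[].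
  apply: (inG _ _ (mkF f 0)); rewrite GS big1 ?addr0 => [|l _]; last by rewrite ffunE linear0 mulr0.
  by rewrite -mulrBr; exact: Ideal_mull.
- subst q; have [|g gE] := exG _ _ _ _ (IH p q') _ bT; first by move: pq; rewrite addnS => -[].
  have jm' : (j < m.+1)%N by [].
  pose h : {ffun 'I_(npar m q'.+1) -> forest m q'} := [ffun l : 'I_(npar m q'.+1) => if (l : nat) == j then g else 0].
  apply: (inG _ _ (mkF 0 h)); rewrite GS [G N (detF _)]linear0 mulr0 add0r.
  rewrite (bigD1 (Ordinal jm')) //= ffunE eqxx big1 ?addr0 => [|l lj].
    by rewrite -mulrBr; exact: Ideal_mull.
  by rewrite ffunE (negPf (lj : (l : nat) != j)) linear0 mulr0.
Qed.
End Straightening.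

(** [Subalg_ind] passes through inhomogeneous elements; projecting to one bidegree keeps track of
    (p, q) in the induction that straightens [Subalg]. *)
HB.lock Definition bicomp n (p q : nat) (a : ext n) : ext n :=
  \sum_(S : {set gen n} | (nX S == p) && (nO S == q)) a S *: (eS S : ext n).
Canonical bicomp_unlockable := Unlockable bicomp.unlock.

Section BidegreeComponents.
Variable n : nat.
Implicit Types (a : ext n) (S : {set gen n}).
Local Notation bicomp := (@bicomp n).

Lemma bicompE p q a :
  bicomp p q a = \sum_(S : {set gen n} | (nX S == p) && (nO S == q)) a S *: (eS S : ext n).
Proof. by rewrite unlock. Qed.

Lemma bicomp_is_linear p q : linear (bicomp p q).
Proof.
move=> k u v; rewrite !bicompE scaler_sumr -big_split; apply: eq_bigr => S _ /=.
by rewrite !ffunE scalerDl scalerA.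
Qed.
HB.instance Definition _ p q :=
  GRing.isLinear.Build rat (ext n) (ext n) *:%R (bicomp p q) (bicomp_is_linear p q).

Lemma bicomp_Lpq p q p' q' a : a \in Lpq n p' q' ->
  bicomp p q a = if (p' == p) && (q' == q) then a else 0.
Proof.
move=> /LpqP aL; rewrite bicompE; case: ifP => [/andP[/eqP<- /eqP<-]|pq].
  rewrite {2}[a]eS_sum [RHS](bigID (fun S => (nX S == p') && (nO S == q'))) /=.
  rewrite [X in _ + X]big1 ?addr0 // => S; have [->|/aL[-> ->]] := eqVneq (a S) 0.
    by rewrite scale0r.
  by rewrite !eqxx.
apply: big1 => S /andP[/eqP pE /eqP qE]; have [->|/aL[p'E q'E]] := eqVneq (a S) 0.
  by rewrite scale0r.
by move: pq; rewrite -p'E -q'E pE qE !eqxx.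
Qed.

Lemma bicomp_mul_ext u p q p' q' :
    (forall S, bicomp p q (u * (eS S : ext n)) = u * bicomp p' q' (eS S)) ->
  forall a, bicomp p q (u * a) = u * bicomp p' q' a.
Proof.
move=> H a; suff E (c : {set gen n} -> rat) : bicomp p q (u * \sum_S c S *: (eS S : ext n)) =
   u * bicomp p' q' (\sum_S c S *: (eS S : ext n)) by rewrite [a]eS_sum E.
rewrite mulr_sumr !linear_sum mulr_sumr; apply: eq_bigr => S _.
by rewrite -scalerAr !linearZ /= H scalerAr.
Qed.

Lemma bicomp_xS s p q a : isX s -> bicomp p.+1 q (gL s * a) = gL s * bicomp p q a.
Proof.
move=> sX; apply: bicomp_mul_ext => S.
have SL := eS_Lpq S; have := Lpq_gL s SL; rewrite sX add1n add0n => sSL.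
rewrite (bicomp_Lpq _ _ sSL) (bicomp_Lpq _ _ SL) eqSS.
by case: ifP => _; rewrite ?mulr0.
Qed.

Lemma bicomp_x0 s q a : isX s -> bicomp 0 q (gL s * a) = 0.
Proof.
move=> sX; rewrite [a]eS_sum mulr_sumr linear_sum big1 // => S _.
rewrite -scalerAr linearZ /=; have := Lpq_gL s (eS_Lpq S); rewrite sX add1n add0n => sSL.
by rewrite (bicomp_Lpq _ _ sSL) /= scaler0.
Qed.

Lemma bicomp_oS s p q a : ~~ isX s -> bicomp p q.+1 (gL s * a) = gL s * bicomp p q a.
Proof.
move=> sX; apply: bicomp_mul_ext => S.
have SL := eS_Lpq S; have := Lpq_gL s SL; rewrite sX (negPf sX) add1n add0n => sSL.
rewrite (bicomp_Lpq _ _ sSL) (bicomp_Lpq _ _ SL) eqSS.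
by case: ifP => _; rewrite ?mulr0.
Qed.

Lemma bicomp_o0 s p a : ~~ isX s -> bicomp p 0 (gL s * a) = 0.
Proof.
move=> sX; rewrite [a]eS_sum mulr_sumr linear_sum big1 // => S _.
rewrite -scalerAr linearZ /=.
have := Lpq_gL s (eS_Lpq S); rewrite sX (negPf sX) add1n add0n => sSL.
by rewrite (bicomp_Lpq _ _ sSL) andbF scaler0.
Qed.

Lemma bicomp_dx i j p q a :
  bicomp p q (dx i j * a) = if p is p'.+1 then dx i j * bicomp p' q a else 0.
Proof.
have X k : isX (inl (k, true) : gen n) by [].
rewrite mulrBl linearB /=; case: p => [|p]; first by rewrite !bicomp_x0 ?subr0.
by rewrite !bicomp_xS // -mulrBl.
Qed.

Lemma bicomp_om i j p q a :
  bicomp p q (om i j * a) = if q is q'.+1 then om i j * bicomp p q' a else 0.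
Proof.
apply: (om_ind (P := fun i j u => bicomp p q (u * a) = if q is q'.+1 then u * bicomp p q' a else 0)).
- by move=> _; rewrite !mul0r linear0; case: (q) => // q'; rewrite mul0r.
- by [].
- by move=> s; case: (q) => [|q']; [rewrite bicomp_o0|rewrite bicomp_oS].
Qed.

End BidegreeComponents.

(** * Highest weight vectors as combinations of forests *)

Section HighestWeightNormalForm.
Variable N : nat.
Local Notation ext := (ext N.+1).
Local Notation Idl := (Ideal N.+1 : {vspace ext}).
Implicit Types (a u : ext) (z : nat -> rat).

Lemma dx_Dx (i j : 'I_N.+1) : dx i j = Dx N i j.
Proof. by rewrite /Dx /ix !inord_val. Qed.

Lemma om_Om (i j : 'I_N.+1) : om i j = Om N i j.
Proof. by rewrite /Om /ix !inord_val. Qed.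

Lemma normal1 m : (1 : ext) \in normal N m 0 0.
Proof.
elim: m => [|m]; last exact/subvP/normalS.
by apply: (subvP (addvSl _ _)); rewrite /=; exact: memv_line.
Qed.

Lemma Subalg_normal p q a : a \in Subalg N.+1 -> bicomp p q (act E11 1 a) \in normal N N p q.
Proof.
move: a p q; have H : forall a, a \in Subalg N.+1 ->
   forall p q, bicomp p q (act E11 1 a) \in normal N N p q; last by move=> a p q /H.
apply: Subalg_ind => [p q|k a b IHa IHb p q|p q|i j a IH p q|i j a IH p q|i j a IH p q].
- by rewrite !linear0 mem0v.
- by rewrite 2!linearP /=; apply: memvD (IHb p q); exact/memvZ/IHa.
- rewrite act1 (bicomp_Lpq _ _ (Lpq1 _)); case: ifP => [/andP[/eqP<- /eqP<-]|_].
    exact: normal1.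
  exact: mem0v.
- rewrite actM act_dx !mat2E scale0r addr0 scale1r bicomp_dx; case: p => [|p].
    exact: mem0v.
  rewrite dx_Dx Dx_sub mulrBl; apply: memvB; apply: normal_Dx => //; exact: leq_ord.
- by rewrite actM act_dy !mat2E !scale0r addr0 mul0r linear0 mem0v.
- rewrite actM act_om scale1r bicomp_om; case: q => [|q]; first exact: mem0v.
  case: (ltngtP i j) => [ij|ij|/val_inj->]; last by rewrite om_diag mul0r mem0v.
    by rewrite om_sym om_Om; apply: normal_Om => //; exact: leq_ord.
  by rewrite om_Om; apply: normal_Om => //; exact: leq_ord.
Qed.

Lemma wt_N z i j : wt z j i = - wt z i j.
Proof. by rewrite /wt -invrN opprB. Qed.

Lemma wt_Arnold z i j k : zinj N z -> (i <= N)%N -> (j <= N)%N -> (k <= N)%N ->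
  [&& i != j, j != k & k != i] ->
  wt z i j * wt z j k + wt z j k * wt z k i + wt z k i * wt z i j = 0.
Proof.
move=> zi iN jN kN /and3P[ij jk ki].
have ne (a b : nat) : (a <= N)%N -> (b <= N)%N -> a != b -> z a - z b != 0.
  by move=> aN bN; apply: contraNneq => /eqP; rewrite subr_eq0 => /eqP/zi ->.
have H1 := ne _ _ iN jN ij; have H2 := ne _ _ jN kN jk; have H3 := ne _ _ kN iN ki.
by rewrite /wt; field; rewrite H1 H2 H3.
Qed.

Lemma wt0_N z l i j : wt0 z l j i = - wt0 z l i j.
Proof. by rewrite /wt0 orbC; case: ifP => _; rewrite ?oppr0 // wt_N. Qed.

Lemma wt0_Arnold z l i j k : zinj N z -> (i <= N)%N -> (j <= N)%N -> (k <= N)%N ->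
  [&& i != j, j != k & k != i] ->
  wt0 z l i j * wt0 z l j k + wt0 z l j k * wt0 z l k i + wt0 z l k i * wt0 z l i j = 0.
Proof.
move=> zi iN jN kN ijk; rewrite /wt0.
have [_|il] := eqVneq i l; first by rewrite /= orbT !(mul0r, mulr0, addr0).
have [_|jl] := eqVneq j l; first by rewrite /= !(mul0r, mulr0, addr0).
have [_|kl] := eqVneq k l; first by rewrite /= !(mul0r, mulr0, addr0).
exact: wt_Arnold.
Qed.

Lemma cocycle_of_closed q (f : forest N q) : d (G N f) \in Idl -> cocycle f.
Proof.
move=> dI z i zi iN.
pose eta (k : nat) : rat := (k == i)%:R.
have ceta (a b : nat) : wt0 z i a b * eta a = 0.
  by rewrite /wt0 /eta; case: (a == i) => /=; rewrite ?mul0r ?mulr0.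
have := wmap_dG (eta := eta) (wt0_N z i) f (fun k => erefl) (leqnn N).
have cA (j k l : nat) := @wt0_Arnold z i j k l zi.
rewrite (wmap_Ideal (wt0_N z i) cA ceta dI) => /esym/eqP.
by rewrite scaler_eq0 oppr_eq0 (negPf (yg_vol_neq0 _ _)) orbF => /eqP.
Qed.

Lemma wmap_G_wt z q (f : forest N q) : 
  wmap (wt z) (fun=> 0) (G N f) = ev (wt z) f *: vol N N.
Proof. by apply: wmap_G => //; exact: wt_N. Qed.

Lemma wmap_wt_Ideal z a : zinj N z -> a \in Idl -> wmap (wt z) (fun=> 0) a = 0.
Proof.
move=> zi; apply: wmap_Ideal; [exact: wt_N|by move=> *; exact: wt_Arnold|].
by move=> *; rewrite mulr0.
Qed.

Lemma vol_neq0 : vol N N != 0.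
Proof. by apply: contraNneq (xg_vol_neq0 N) => ->; rewrite mulr0. Qed.

Lemma G_Ideal_eq0 q (f : forest N q) : G N f \in Idl -> f = 0.
Proof.
move=> fI; apply: ev_eq0 => z zi; have := wmap_wt_Ideal zi fI.
rewrite wmap_G_wt => /eqP; rewrite scaler_eq0 (negPf vol_neq0) orbF.
by move/eqP.
Qed.

(** [u] is fixed by [act E11 1], so modulo the ideal it equals the image of its [Subalg] part, in
    which no [y] is left and which straightens to forests. *)
Lemma Kx_normal p q u : (p + q = N)%N -> u \in Kx N.+1 p q ->
  exists2 f : forest N q, cocycle f & u - G N f \in Idl.
Proof.
move=> pqN; rewrite KxP ZpqP => /andP[/andP[/memv_addP[s + [r + uE]] dI] /eqP uf].
rewrite memv_cap => /andP[sS sL]; rewrite memv_cap => /andP[rI _].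
have := Subalg_normal p q sS; rewrite (bicomp_Lpq _ _ (act_Lpq _ _ sL)) !eqxx /=.
move=> /(normal_G pqN)[f fE].
have ufI : u - G N f \in Idl.
  rewrite -uf uE linearD /= addrAC; apply: memvD fE _; exact: act_Ideal.
exists f => //; apply: cocycle_of_closed.
have := memvB dI (d_Ideal ufI); rewrite linearB /= subKr; exact.
Qed.
End HighestWeightNormalForm.

(** * Closed elements from cyclic words *)

Section Expansions.
Variables (n : nat) (E : Type).
Local Notation ext := (ext n).
Implicit Types (u v th : E -> ext) (l : seq E) (a b : ext).

(* Coefficients of [t ^+ q] in the product of [u + t v] over [l], and in its
   contraction [contr] below, which is the alternating sum of the products over
   [l] with one factor omitted. *)
Fixpoint expand u v (q : nat) l : ext :=
  if l is e :: l' then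
    u e * expand u v q l' + (if q is q'.+1 then v e * expand u v q' l' else 0)
  else (q == 0%N)%:R.

Fixpoint contr th l : ext :=
  if l is e :: l' then \prod_(e <- l') th e - th e * contr th l' else 0.

Fixpoint contrq u v (q : nat) l : ext :=
  if l is e :: l' then
    expand u v q l' - (u e * contrq u v q l' + (if q is q'.+1 then v e * contrq u v q' l' else 0))
  else 0.

Lemma sum_shift u v (t : rat) M e (F : nat -> ext) :
  \sum_(q < M.+1) t ^+ q *: (u e * F q + (if q : nat is q'.+1 then v e * F q' else 0)) =
  u e * (\sum_(q < M.+1) t ^+ q *: F q) + t *: v e * (\sum_(q < M) t ^+ q *: F q).
Proof.
under eq_bigr do rewrite scalerDr; rewrite big_split /=; congr (_ + _).
  by rewrite mulr_sumr; apply: eq_bigr => q _; rewrite scalerAr.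
rewrite big_ord_recl /= scaler0 add0r mulr_sumr; apply: eq_bigr => q _.
by rewrite exprS -scalerAl -scalerAr scalerA.
Qed.

Lemma expand_sum u v (t : rat) M l : (size l < M)%N ->
  \prod_(e <- l) (u e + t *: v e) = \sum_(q < M) t ^+ q *: expand u v q l.
Proof.
elim: l M => [|e l IH] [|M] //= lM.
  rewrite big_nil big_ord_recl /= expr0 scale1r big1 ?addr0 // => q _.
  by rewrite scaler0.
rewrite big_cons sum_shift mulrDl; congr (_ * _ + _ * _); apply: IH => //.
exact: ltnW.
Qed.

Lemma contr_sum u v (t : rat) M l : (size l < M)%N ->
  contr (fun e => u e + t *: v e) l = \sum_(q < M) t ^+ q *: contrq u v q l.
Proof.
elim: l M => [|e l IH] [|M] //= lM; first by rewrite big1 // => q _; rewrite scaler0.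
rewrite (expand_sum u v t (ltnW lM)) mulrDl {1}(IH M.+1 (ltnW lM)) (IH M lM).
rewrite -(sum_shift u v t M e (fun q => contrq u v q l)) -sumrB.
by apply: eq_bigr => q _; symmetry; exact: scalerBr.
Qed.

Lemma expand0 u v l : expand u v 0 l = \prod_(e <- l) u e.
Proof. by elim: l => [|e l IH] /=; rewrite ?big_nil // big_cons IH addr0. Qed.

Lemma expand_gt u v q l : (size l < q)%N -> expand u v q l = 0.
Proof.
elim: l q => [|e l IH] [|q] //=; rewrite ltnS => lq.
by rewrite !IH ?mulr0 ?addr0 // ltnW.
Qed.

Lemma contrq_ge u v q l : (size l <= q)%N -> contrq u v q l = 0.
Proof.
elim: l q => [|e l IH] [|q] //=; rewrite ltnS => lq.
by rewrite !IH ?mulr0 ?addr0 ?subr0 ?expand_gt // ltnW.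
Qed.

Section TwoSided.
Variable J : {vspace ext}.
Hypotheses (JL : forall a b, b \in J -> a * b \in J) (JR : forall a b, b \in J -> b * a \in J).

Lemma mul_prod_mem u v l : (forall e, u e \in deg1 n) -> (forall e, v e \in deg1 n) ->
    (forall e, u e * v e \in J) ->
  (\sum_(e <- l) u e) * \prod_(e <- l) v e \in J.
Proof.
move=> u1 v1 uv; elim: l => [|e l IH]; first by rewrite !big_nil mul0r mem0v.
rewrite !big_cons mulrDl; apply: memvD; first by rewrite mulrA JR.
rewrite mulrA; have sl : \sum_(e <- l) u e \in deg1 n by apply: memv_suml.
by rewrite (deg1_anti sl (v1 e)) mulNr -mulrA memvN JL.
Qed.

Lemma prod_add_mod u v l : (forall e, u e \in deg1 n) -> (forall e, v e \in deg1 n) ->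
    (forall e, u e * v e \in J) ->
  exists a, \prod_(e <- l) (u e + v e) - \prod_(e <- l) v e - (\sum_(e <- l) u e) * a \in J.
Proof.
move=> u1 v1 uv; elim: l => [|e l [a IH]].
  by exists 0; rewrite !big_nil subrr mul0r subr0 mem0v.
rewrite !big_cons; set R := \prod_(e <- l) (u e + v e) in IH *.
set V := \prod_(e <- l) v e in IH *; set U := \sum_(e <- l) u e in IH *.
have Ud : U \in deg1 n by apply: memv_suml.
have UV : U * V \in J by exact: mul_prod_mem.
have UR : U * R \in J.
  rewrite -[R](subrK (V + U * a)) mulrDr opprD addrA; apply: memvD; first exact: JL.
  by rewrite mulrDr mulrA deg1_sq // mul0r addr0.
(* Modulo [J], [U] kills [R], so [u e * R] may be replaced by [(u e + U) * R]. Moreover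
   [v e * U * a] is [- U * v e * a], where [U] may be replaced by [u e + U] because [u e * v e] lies
   in [J]. *)
exists (R - v e * a).
have -> : (u e + v e) * R - v e * V - (u e + U) * (R - v e * a) =
    v e * (R - V - U * a) + u e * v e * a - U * R.
  rewrite !mulrBr !mulrDl !mulrA (deg1_anti (v1 e) Ud) mulNr opprK.
  rewrite opprB opprD !addrA.
  by rewrite [LHS](ACl (2*3*5*4*7*(1*6))%AC) /= subrr addr0.
apply: memvB; [apply: memvD|] => //; first exact: JL.
exact/JR.
Qed.
End TwoSided.
End Expansions.

Fixpoint omit (R : pzSemiRingType) (E : Type) (s : E -> R) (l : seq E) : R :=
  if l is e :: l' then \prod_(f <- l') s f + s e * omit s l' else 0.

Lemma horner_omit (E : Type) (P : E -> {poly rat}) t l :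
  omit (fun e => (P e).[t]) l = (omit P l).[t].
Proof.
elim: l => [|e l IH] /=; first by rewrite horner0.
by rewrite hornerD hornerM horner_prod IH.
Qed.

Lemma omit_sum (R : comNzRingType) (E : Type) (s : E -> R) l :
  omit s l = \sum_(i < size l) \prod_(e <- drop i.+1 l ++ take i l) s e.
Proof.
elim: l => [|e l IH] /=; first by rewrite big_ord0.
rewrite big_ord_recl /= drop0 cats0 IH mulr_sumr; congr (_ + _).
by apply: eq_bigr => i _; rewrite !big_cat big_cons /= mulrCA.
Qed.

Lemma coef_omit_cedges z w q :
  (omit (edgeP z) (cedges w))`_q = ((size w)%:R - q%:R) * (cycP z w)`_q.
Proof.
rewrite omit_sum size_cedges -coef_sum_pathP_rot coef_sum; apply: eq_bigr => i _.
by rewrite /pathP pedges_rot.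
Qed.

Section Contraction.
Variables (n : nat) (E : Type).
Local Notation ext := (ext n).
Implicit Types (u v th : E -> ext) (l : seq E) (a b : ext).

Lemma prod_scale u (s : E -> rat) l :
  \prod_(e <- l) (s e *: u e) = (\prod_(e <- l) s e) *: \prod_(e <- l) u e.
Proof.
elim: l => [|e l IH]; rewrite ?big_nil ?scale1r // !big_cons IH.
by rewrite -scalerAl -scalerAr scalerA.
Qed.

Lemma sum_deg1 u l : (forall e, u e \in deg1 n) -> \sum_(e <- l) u e \in deg1 n.
Proof. by move=> u1; apply: memv_suml. Qed.

Lemma sum_mul_prod u l : (forall e, u e \in deg1 n) ->
  (\sum_(e <- l) u e) * \prod_(e <- l) u e = 0.
Proof.
move=> u1; apply/eqP; rewrite -(memv0 (vT := ext)); apply: mul_prod_mem => //.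
- by move=> a b; rewrite memv0 => /eqP->; rewrite mulr0 mem0v.
- by move=> a b; rewrite memv0 => /eqP->; rewrite mul0r mem0v.
- by move=> e; rewrite deg1_sq // mem0v.
Qed.

(** Multiplied into a product with the factor at [e] omitted, the sum contributes only [u e], since
    the other terms give squares; moving [u e] into the gap cancels the sign in [contr]. *)
Lemma sum_mul_contr u (s : E -> rat) l : (forall e, u e \in deg1 n) ->
  (\sum_(e <- l) u e) * contr (fun e => s e *: u e) l = omit s l *: \prod_(e <- l) u e.
Proof.
move=> u1; elim: l => [|e l IH] /=; first by rewrite mulr0 scale0r.
rewrite !big_cons prod_scale; set U := \sum_(f <- l) u f in IH *.
have U1 : U \in deg1 n by exact: sum_deg1.
have UP : U * \prod_(f <- l) u f = 0 by exact: sum_mul_prod.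
move: (contr _ l) IH => c IH; rewrite mulrBr -scalerAr mulrDl UP addr0 -scalerAl -scalerAr.
rewrite mulrA [(u e + U) * u e]mulrDl deg1_sq // add0r (deg1_anti U1 (u1 e)) mulNr -mulrA IH.
by rewrite scalerN opprK -scalerAr scalerA -scalerDl.
Qed.

(** When the [u f] sum to 0, their products with one factor omitted agree up to the sign that
    [contr] carries, so the alternating sum becomes the unsigned [omit] of the scalars. *)
Lemma contr_closed u (s : E -> rat) e l : (forall e, u e \in deg1 n) ->
    \sum_(f <- e :: l) u f = 0 ->
  contr (fun e => s e *: u e) (e :: l) = omit s (e :: l) *: \prod_(f <- l) u f.
Proof.
rewrite big_cons => u1 /eqP; rewrite addr_eq0 => /eqP uE /=.
rewrite prod_scale uE scalerN mulNr opprK -scalerAl sum_mul_contr //.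
by rewrite scalerA -scalerDl.
Qed.
End Contraction.

Lemma sum_pairmap (V : zmodType) (g : nat -> V) x s :
  \sum_(e <- pairmap pair x s) (g e.1 - g e.2) = g x - g (last x s).
Proof.
elim: s x => [|y s IH] x /=; first by rewrite big_nil subrr.
by rewrite big_cons IH /= addrA subrK.
Qed.

Lemma sum_cedges (V : zmodType) (g : nat -> V) w :
  \sum_(e <- cedges w) (g e.1 - g e.2) = 0.
Proof.
case: w => [|x t]; first by rewrite big_nil.
by rewrite sum_pairmap last_rcons subrr.
Qed.

(** Bookkeeping for [d_prod_th]: [T] is [th e] with differential [D], [P] the remaining product with
    differential [dP], and [y], [Y] are the [y]-forms of [e] and of the remaining edges. *)
Lemma prod_step (R : algType rat) (t : rat) (D T y P dP Y : R) : Y * T = - (T * Y) ->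
  (D + t *: (y * T)) * P - T * (dP + t *: (Y * P)) = D * P - T * dP + t *: ((y + Y) * (T * P)).
Proof.
move=> YT; rewrite mulrDl mulrDr opprD addrACA; congr (_ + _).
by rewrite !mulrDl scalerDr !mulrA YT mulNr scalerN -scalerAl -scalerAr !mulrA.
Qed.

Lemma contr_step (R : algType rat) (t : rat) (D T y P dP Y c dc F : R) : Y * T = - (T * Y) ->
  dP + t *: (Y * P) - (D + t *: (y * T)) * c + T * (dc + t *: (Y * c) - t *: F) =
  dP - (D * c - T * dc) + t *: ((y + Y) * (P - T * c)) - t *: (T * F + y * P).
Proof.
move=> YT.
have -> : (y + Y) * (P - T * c) = y * P - y * T * c + (Y * P + T * Y * c).
  by rewrite mulrDl !mulrBr !mulrA YT mulNr opprK.
rewrite mulrDl mulrBr mulrDr -!scalerAr -scalerAl !scalerDr scalerN !mulrA.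
rewrite ?opprD ?opprB ?opprD !addrA.
by rewrite opprK [RHS](ACl (1*6*2*5*3*7*8*(4*9))%AC) /= subrr addr0.
Qed.

Section Cycles.
Variable N : nat.
Local Notation ext := (ext N.+1).
Local Notation Idl := (Ideal N.+1 : {vspace ext}).
Implicit Types (a u : ext) (z : nat -> rat) (l : seq (nat * nat)) (e : nat * nat).

Definition eX e : ext := Dx N e.1 e.2.
Definition eY e : ext := dy (ix N e.1) (ix N e.2).
Definition eO e : ext := Om N e.1 e.2.

Lemma eX1 e : eX e \in deg1 N.+1. Proof. exact: dx_deg1. Qed.
Lemma eY1 e : eY e \in deg1 N.+1. Proof. exact: dy_deg1. Qed.
Lemma eO1 e : eO e \in deg1 N.+1. Proof. exact: om_deg1. Qed.

Lemma sum_eX w : \sum_(e <- cedges w) eX e = 0.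
Proof. exact: (sum_cedges (fun k => xg (ix N k))). Qed.
Lemma sum_eY w : \sum_(e <- cedges w) eY e = 0.
Proof. exact: (sum_cedges (fun k => yg (ix N k))). Qed.

Variable t : rat.
Definition th e : ext := eX e + t *: eO e.

Lemma th1 e : th e \in deg1 N.+1.
Proof. by apply: memvD; [exact: eX1|apply: memvZ; exact: eO1]. Qed.

Lemma d_th e : d (th e) = t *: (eX e * eY e).
Proof. by rewrite linearD linearZ /= d_dx d_om add0r. Qed.

(** Since [y_e omega_e] is in the ideal, [t x_e y_e] is congruent to [- t y_e (x_e + t omega_e)]: on
    each factor, hence on products, [d] is multiplication by [- t y]. *)
Lemma d_th_Ideal e : d (th e) + t *: (eY e * th e) \in Idl.
Proof.
rewrite d_th -scalerDr (deg1_anti (eX1 e) (eY1 e)) /th (mulrDr (eY e) (eX e)) addKr -scalerAr.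
by do 2 apply: memvZ; exact: Ideal_y.
Qed.

Lemma d_prod_th l :
  d (\prod_(e <- l) th e) + t *: ((\sum_(e <- l) eY e) * \prod_(e <- l) th e) \in Idl.
Proof.
elim: l => [|e l IH]; first by rewrite !big_nil d1 mul0r scaler0 addr0 mem0v.
rewrite !big_cons; set P := \prod_(e <- l) th e in IH *; set Y := \sum_(e <- l) eY e in IH *.
rewrite (d_deg1M _ (th1 e)).
have Y1 : Y \in deg1 N.+1 by apply: sum_deg1; exact: eY1.
apply: memv_eq (memvB (Ideal_mulr P (d_th_Ideal e)) (Ideal_mull (th e) IH)) _.
exact/prod_step/(deg1_anti Y1 (th1 e)).
Qed.

(** On the contraction the same rule holds up to the terms in which one factor [th e] is replaced by
    [y_e], that is, [expand th eY 1 l]. Around a cycle the [y]-forms sum to 0 and [expand_th_Ideal]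
    disposes of this defect. *)
Lemma d_contr_th l :
  d (contr th l) + t *: ((\sum_(e <- l) eY e) * contr th l) - t *: expand th eY 1 l \in Idl.
Proof.
elim: l => [|e l IH]; first by rewrite linear0 mulr0 scaler0 addr0 subr0 mem0v.
rewrite big_cons /=; set P := \prod_(e <- l) th e; set Y := \sum_(e <- l) eY e in IH *.
rewrite expand0 -/P linearB /= (d_deg1M _ (th1 e)).
move: (contr th l) (expand th eY 1 l) IH => c F IH.
have Y1 : Y \in deg1 N.+1 by apply: sum_deg1; exact: eY1.
have PI : d P + t *: (Y * P) \in Idl by exact: d_prod_th.
apply: memv_eq (memvD (memvB PI (Ideal_mulr c (d_th_Ideal e))) (Ideal_mull (th e) IH)) _.
exact/contr_step/(deg1_anti Y1 (th1 e)).
Qed.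
End Cycles.

(** * Closed classes of cyclic words and their weight functions *)

Section CycleClasses.
Variable N : nat.
Local Notation ext := (ext N.+1).
Local Notation Idl := (Ideal N.+1 : {vspace ext}).
Local Notation eX := (@eX N).
Local Notation eY := (@eY N).
Local Notation eO := (@eO N).
Implicit Types (a u : ext) (z : nat -> rat) (w : seq nat) (l : seq (nat * nat)) (e : nat * nat).

(* The left-hand side is the derivative at [c = 0] of the product of
   [th e + c y_e] = [(x_e + c y_e) + t omega_e].  Since the forms
   [x_e + c y_e] sum to [0] around the cycle and kill [omega_e], this product is
   congruent to that of the [t omega_e], whatever [c]. *)
Lemma expand_th_Ideal t w : expand (th N t) eY 1 (cedges w) \in Idl.
Proof.
set l := cedges w; pose v k : ext := expand (th N t) eY k l - (k == 0%N)%:R * \prod_(e <- l) (t *: eO e).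
suff: v 1%N \in Idl by rewrite /v mul0r subr0.
apply: (@coef_memv _ _ (size l).+2) => // c _.
have -> : \sum_(k < (size l).+2) c ^+ k *: v k =
    \prod_(e <- l) (eX e + c *: eY e + t *: eO e) - \prod_(e <- l) (t *: eO e).
  pose B : ext := \prod_(e <- l) (t *: eO e).
  transitivity (\sum_(k < (size l).+2) c ^+ k *: expand (th N t) eY k l
    - \sum_(k < (size l).+2) c ^+ k *: ((k == 0%N :> nat)%:R * B)).
    by rewrite -sumrB; apply: eq_bigr => k _; exact: scalerBr.
  congr (_ - _).
    by rewrite -expand_sum //; apply: eq_bigr => e _; rewrite addrAC.
  by rewrite big_ord_recl big1 => [|i _]; rewrite ?mul0r ?scaler0 // scale1r mul1r addr0.
have [||e|e|e|a] := @prod_add_mod _ _ Idl _ _ (fun e => eX e + c *: eY e) (fun e => t *: eO e) l.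
- by move=> a b; exact: Ideal_mull.
- by move=> a b; exact: Ideal_mulr.
- by apply: memvD; [exact: eX1|apply: memvZ; exact: eY1].
- by apply: memvZ; exact: eO1.
- rewrite -scalerAr mulrDl -scalerAl; apply: memvZ.
  by apply: memvD; [exact: Ideal_x|apply: memvZ; exact: Ideal_y].
by rewrite big_split -scaler_sumr /= sum_eX sum_eY scaler0 addr0 mul0r subr0.
Qed.

Definition cycle_class q w : ext := contrq eX eO q (cedges w).

Lemma d_cycle_class q w : d (cycle_class q w) \in Idl.
Proof.
have [qw|qw] := ltnP q (size (cedges w)); last first.
  by rewrite /cycle_class contrq_ge // linear0 mem0v.
apply: (@coef_memv _ _ (size (cedges w)).+1 (fun q => d (cycle_class q w))) (ltnW qw) => t _.
have -> : \sum_(j < (size (cedges w)).+1) t ^+ j *: d (cycle_class j w) =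
    d (contr (th N t) (cedges w)).
  rewrite (contr_sum eX eO t (ltnSn _)) [RHS]linear_sum; apply: eq_bigr => j _.
  by rewrite [RHS]linearZ.
have := memvD (d_contr_th N t (cedges w)) (memvZ t (expand_th_Ideal t w)).
by rewrite subrK sum_eY mul0r scaler0 addr0.
Qed.

Lemma eX_act e : act E11 1 (eX e) = eX e.
Proof. by rewrite act_dx !mat2E scale1r scale0r addr0. Qed.
Lemma eO_act e : act E11 1 (eO e) = eO e.
Proof. by rewrite act_om scale1r. Qed.

Lemma expand_act q s : act E11 1 (expand eX eO q s) = expand eX eO q s.
Proof.
elim: s q => [|e s IH] q /=; first by case: q => [|q]; rewrite ?act1 ?linear0.
rewrite linearD /= actM eX_act IH; congr (_ + _).
by case: q => [|q]; rewrite ?linear0 // actM eO_act IH.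
Qed.

Lemma contrq_act q s : act E11 1 (contrq eX eO q s) = contrq eX eO q s.
Proof.
elim: s q => [|e s IH] q /=; first by rewrite linear0.
rewrite linearB linearD /= expand_act actM eX_act IH; congr (_ - (_ + _)).
by case: q => [|q]; rewrite ?linear0 // actM eO_act IH.
Qed.

Lemma expand_Subalg q s : expand eX eO q s \in Subalg N.+1.
Proof.
elim: s q => [|e s IH] q /=.
  by case: q => [|q]; [exact: Subalg1|exact: mem0v].
apply: memvD; first by apply: Subalg_dx.
by case: q => [|q]; [exact: mem0v|exact: Subalg_om].
Qed.

Lemma contrq_Subalg q s : contrq eX eO q s \in Subalg N.+1.
Proof.
elim: s q => [|e s IH] q /=; first exact: mem0v.
apply: memvB; first exact: expand_Subalg.
apply: memvD; first by apply: Subalg_dx.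
by case: q => [|q]; [exact: mem0v|exact: Subalg_om].
Qed.

Lemma expand_Lpq p q s : (p + q = size s)%N -> expand eX eO q s \in Lpq N.+1 p q.
Proof.
elim: s p q => [|e s IH] p q /= pq.
  by move/eqP: pq; rewrite addn_eq0 => /andP[/eqP-> /eqP->]; exact: Lpq1.
apply: memvD.
  case: p pq => [|p] pq; last by apply: Lpq_dx; apply: IH; case: pq.
  by rewrite expand_gt ?mulr0 ?mem0v // -[X in (_ < X)%N]add0n pq.
case: q pq => [|q] pq; first exact: mem0v.
by apply: Lpq_om; apply: IH; move: pq; rewrite addnS => -[].
Qed.

Lemma contrq_Lpq p q s : (p + q.+1 = size s)%N -> contrq eX eO q s \in Lpq N.+1 p q.
Proof.
elim: s p q => [|e s IH] p q /= pq; first exact: mem0v.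
have pq' : (p + q = size s)%N by move: pq; rewrite addnS => -[].
apply: memvB; first exact: expand_Lpq.
apply: memvD.
  case: p pq pq' => [|p] pq pq'; last by apply: Lpq_dx; apply: IH; rewrite addnS.
  by rewrite contrq_ge ?mulr0 ?mem0v // -pq'.
case: q pq' {pq} => [|q] pq; first exact: mem0v.
by apply: Lpq_om; exact: IH.
Qed.

Lemma cycle_class_Kx p q w : (p + q = N)%N -> word N w -> cycle_class q w \in Kx N.+1 p q.
Proof.
move=> pq wN; have wL : cycle_class q w \in Lpq N.+1 p q.
  by apply: contrq_Lpq; rewrite size_cedges (size_word wN) addnS pq.
rewrite KxP ZpqP d_cycle_class andbT; apply/andP; split; last by rewrite [act _ _ _]contrq_act.
rewrite -[X in X \in _]addr0; apply: memv_add (mem0v _).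
by rewrite memv_cap; apply/andP; split; [exact: contrq_Subalg|].
Qed.

Section WeightMap.
Variable z : nat -> rat.
Local Notation wm := (wmap (N := N) (wt z) (fun=> 0)).

Lemma wm_eX e : wm (eX e) = eX e.
Proof. by apply: wmap_Dx; exact: wt_N. Qed.
Lemma wm_eO e : (e.1 <= N)%N && (e.2 <= N)%N -> wm (eO e) = wt z e.1 e.2 *: eX e.
Proof. by move=> /andP[e1 e2]; apply: wmap_Om => //; exact: wt_N. Qed.
Lemma wmM a b : wm (a * b) = wm a * wm b.
Proof. by apply: wmapM; exact: wt_N. Qed.

Let s t e : rat := (edgeP z e).[t].

Lemma wm_th t e : (e.1 <= N)%N && (e.2 <= N)%N -> wm (th N t e) = s t e *: eX e.
Proof.
move=> eN; rewrite linearD linearZ /= wm_eX wm_eO // /s /edgeP hornerD hornerZ hornerX hornerC.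
by rewrite scalerDl scale1r scalerA mulrC.
Qed.

Lemma wm_contr t l : all (fun e => (e.1 <= N)%N && (e.2 <= N)%N) l ->
  wm (contr (th N t) l) = contr (fun e => s t e *: eX e) l.
Proof.
elim: l => [|e l IH] /=; first by rewrite linear0.
move=> /andP[eN lN]; rewrite linearB /= wmM wm_th // (IH lN); congr (_ - _).
elim: l lN {IH} => [|f l IH] /=; first by move=> _; rewrite !big_nil; exact: wmap1.
by move=> /andP[fN lN]; rewrite !big_cons wmM wm_th // IH.
Qed.

(** [th e] maps to [(edgeP z e).[t] *: eX e] and the [eX e] sum to 0 around the cycle, so
    [contr_closed] evaluates the contraction for every t; the factor [size w - q] counts omitted
    edges as in [sum_omit]. *)
Lemma wm_cycle_class q w : all [pred k | (k <= N)%N] w ->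
  wm (cycle_class q w) =
  (((size w)%:R - q%:R) * (cycP z w)`_q) *: \prod_(e <- behead (cedges w)) eX e.
Proof.
move=> wN; rewrite -coef_omit_cedges; set P := omit _ _.
case: w @P wN => [|x w] P wN; first by rewrite [cycle_class _ _]/= linear0 /P /= coef0 scale0r.
set l := cedges (x :: w); set R := \prod_(e <- behead l) eX e.
pose v j : ext := wm (cycle_class j (x :: w)) - P`_j *: R.
suff /eqP : v q = 0 by rewrite subr_eq0 => /eqP.
apply/eqP; rewrite -(memv0 (vT := ext)).
apply: (@coef_memv _ _ (size l + size P + q).+1) => [t _|]; last by rewrite ltnS leq_addl.
set M := (_ + _).+1.
have lM : (size l < M)%N by rewrite ltnS -addnA leq_addr.
have PM : (size P <= M)%N by rewrite /M; lia.
suff -> : \sum_(j < M) t ^+ j *: v j = 0 by exact: mem0v.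
have -> : \sum_(j < M) t ^+ j *: v j = wm (contr (th N t) l) - P.[t] *: R.
  rewrite (contr_sum eX eO t lM) (horner_coef_wide t PM) [wm _]linear_sum scaler_suml -sumrB.
  by apply: eq_bigr => j _; rewrite linearZ /= [P`_j * _]mulrC -scalerA; exact: scalerBr.
rewrite (wm_contr _ (all_cedges wN)) /l.
have := sum_eX N (x :: w); rewrite /R /l.
case lE: (cedges (x :: w)) => [|e l'] sX; first by rewrite -[P]/(omit _ _) lE /= horner0 scale0r subr0.
rewrite (contr_closed _ _ sX) => [|f]; last exact: eX1.
by rewrite horner_omit -[P]/(omit _ _) lE subrr.
Qed.
End WeightMap.

Lemma path_prod (a b : nat) (t : seq nat) : b \in a :: t -> Dx N b a * \prod_(e <- pedges (a :: t)) eX e = 0.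
Proof.
elim: t a => [|c t IH] a; first by rewrite inE => /eqP->; rewrite /Dx dx_diag mul0r.
rewrite inE => /orP[/eqP->|/IH bt]; first by rewrite /Dx dx_diag mul0r.
rewrite /= big_cons; set P := \prod_(e <- _) _ in bt *.
have -> : Dx N b a = Dx N b c - eX (a, c) by rewrite /eX /Dx /= -dxN dxD.
rewrite mulrBl mulrA (deg1_anti (Dx_deg1 N b c) (eX1 N (a, c))) mulNr -mulrA bt mulr0 oppr0 sub0r.
by rewrite mulrA deg1_sq ?eX1 // mul0r oppr0.
Qed.

Lemma xg_path_prod (a : nat) (t : seq nat) : xg (ix N a) * \prod_(e <- pedges (a :: t)) eX e =
  (-1) ^+ size t *: \prod_(s <- map (xgen N) (a :: t)) gL s.
Proof.
elim: t a => [|c t IH] a; first by rewrite /= big_nil big_seq1 mulr1 scale1r.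
rewrite [size _]/= exprS -scalerA map_cons big_cons -[gL _]/(xg (ix N a)).
rewrite [X in _ *: X]scalerAr -IH scaleN1r [pedges _]/= big_cons !mulrA -mulNr; congr (_ * _).
by rewrite /eX mulrBr [xg _ * xg (ix N a)]deg1_sq ?xg_deg1 // sub0r.
Qed.

(** Dropping one cyclic edge leaves a path through all points. Multiplied by the variable of any
    letter, its edge product becomes a monomial in all the [x_k] up to sign, as does the volume
    form. *)
Lemma cycle_vol w : word N w -> exists2 k : rat, k != 0 &
  xg (ix N 0) * \prod_(e <- behead (cedges w)) eX e = k *: (xg (ix N 0) * vol N N).
Proof.
move=> wN; have -> : behead (cedges w) = pedges (rot 1 w).
  by rewrite pedges_rot ?(size_word wN) // take0 cats0 drop1.
have := word_rot 1 wN; case: (rot 1 w) => [/size_word //|a t] aN.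
have a0 : 0 \in a :: t by rewrite (perm_mem aN) mem_iota.
have := path_prod a0; rewrite mulrBl => /eqP; rewrite subr_eq0 => /eqP ->.
have [||e e0 E] := @prod_gL_perm N.+1 (map (xgen N) (a :: t)) (map (xgen N) (rev (iota 0 N.+1))).
- apply: uniq_xgen; first exact: word_all aN.
  by rewrite (perm_uniq aN) iota_uniq.
- by apply: perm_map; rewrite perm_sym perm_rev perm_sym.
exists ((-1) ^+ size t * e * (-1) ^+ N); first by rewrite !mulf_neq0 ?signr_eq0.
rewrite xg_path_prod E xg_vol // !scalerA -!mulrA -expr2 sqrr_sign mulr1.
by [].
Qed.
End CycleClasses.

(** The straightened cycle class has the desired weight function up to the factor [r], which is
    nonzero because a cycle on [N.+1] points has more than [q] edges. *)
Lemma word_lift N p q w : (p + q = N)%N -> word N w ->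
  exists f : forest N q, [/\ cocycle f, represents f w &
    exists2 u, u \in Kx N.+1 p q & u - G N f \in Ideal N.+1].
Proof.
move=> pq wN; have uK := cycle_class_Kx pq wN; set u := cycle_class N q w in uK.
have [f cf uf] := Kx_normal pq uK.
have [k k0 kE] := cycle_vol wN.
pose r : rat := (N.+1%:R - q%:R) * k.
have r0 : r != 0.
  by rewrite mulf_neq0 // subr_eq0 eqr_nat -pq; apply/eqP; lia.
have evf z : zinj N z -> ev (wt z) f = r * (cycP z w)`_q.
  move=> zi; have := wmap_wt_Ideal zi uf.
  rewrite linearB /= wmap_G_wt (wm_cycle_class _ _ (word_all wN)) (size_word wN).
  move/(congr1 (fun a => xg (ix N 0) * a)); rewrite mulr0 mulrBr -!scalerAr kE scalerA -scalerBl.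
  move/eqP; rewrite scaler_eq0 (negPf (xg_vol_neq0 N)) orbF subr_eq0 => /eqP <-.
  by rewrite /r; ring.
exists (r^-1 *: f); split.
- by apply/cocyclesP/memvZ/cocyclesP.
- by move=> z zi; rewrite linearZ /= evf // mulKf.
exists (r^-1 *: u); first exact: memvZ.
by rewrite linearZ /= -scalerBr; exact: memvZ.
Qed.

Lemma word_cocycle m q w : (q <= m)%N -> word m w ->
  exists2 f : forest m q, cocycle f & represents f w.
Proof.
by move=> qm wm; have [f [cf fw _]] := word_lift (subnK qm) wm; exists f.
Qed.

(** * The dimension count *)

Lemma forest_gt m q (f : forest m q) : (m < q)%N -> f = 0.
Proof.
elim: m q f => [|m IH] q f mq; first by case: q f mq => // q f _; apply/rowP => -[].
rewrite -[f]mkF_eta (IH _ (detF f)) 1?ltnW // (_ : attF f = 0) //.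
apply/ffunP => j; rewrite ffunE; apply: IH.
by case: q mq {f j}.
Qed.

(** Quantifying over all subspaces that contain the word forests, rather than naming their span,
    lets the induction apply the hypothesis to preimages of such a subspace. *)
Definition spanned m := forall q (U : {vspace forest m q}),
  (forall w f, word m w -> represents f w -> f \in U) -> (cocycles m q <= U)%VS.

Lemma mkF_linear m q : linear (fun f : forest m q => mkF f 0).
Proof. by move=> k f g; rewrite /mkF -[0 in LHS](addr0 0) -{1}(scaler0 _ k). Qed.
Definition mkFl m q : {linear forest m q -> forest m.+1 q} :=
  HB.pack (fun f : forest m q => mkF f 0) (GRing.isLinear.Build _ _ _ _ _ (@mkF_linear m q)).

Lemma spanned_det m q (U : {vspace forest m.+1 q}) : spanned m ->
    (forall w f, word m.+1 w -> represents f w -> f \in U) ->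
  forall f : forest m q, cocycle f -> mkF f 0 \in U.
Proof.
move=> spm HU f /cocyclesP cf.
have [mq|qm] := ltnP m q; first by rewrite (forest_gt f mq) mem0v.
suff /subvP/(_ f cf) : (cocycles m q <= linfun (@mkFl m q) @^-1: U)%VS.
  by rewrite -memv_preim lfunE.
apply: spm => w {cf}f ww fw; rewrite -memv_preim lfunE /=.
have Hw i : exists f : forest m.+1 q, represents f (m.+1 :: rot i.+1 w).
  have := word_cons (word_rot i.+1 ww).
  by move=> /(word_cocycle (leqW qm))[g _ gr]; exists g.
pose g i := projT1 (cid (Hw i)); have gr i : represents (g i) _ := projT2 (cid (Hw i)).
have gU i : g i \in U by apply: HU (gr i); exact/word_cons/word_rot.
(* Over all gaps of [w], every letter is first once and last once, so the attached parts cancel; the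
   detached parts are the openings of [w] and add up to [m.+1 - q] times the cycle. *)
suff E : \sum_(i < size w) g i = (m.+1%:R - q%:R) *: mkF f 0.
  have ne : (m.+1%:R - q%:R : rat) != 0.
    by rewrite subr_eq0 eqr_nat gtn_eqF // ltnS.
  rewrite -[mkF f 0](scalerK ne) -E; apply: memvZ; apply: memv_suml => i _; exact: gU.
have HG i z : zinj m z -> ev (wt z) (detF (g i)) = (pathP z (rot i.+1 w))`_q /\
    forall j, ev (wt z) (attF (g i) j) =
      (((j : nat) == head 0 (rot i.+1 w))%:R - ((j : nat) == last 0 (rot i.+1 w))%:R)
        * (cycP z w)`_q.-1.
  move=> zi; have wi := word_rot i.+1 ww; have := gr i.
  rewrite -(cycP_rot z i.+1 w); case: (rot i.+1 w) wi => [/(@size_word m)//|x t] wi gi.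
  exact: (represents_cons wi (leqW qm) gi zi).
have mkFZ k : k *: mkF f 0 = mkF (k *: f) 0 by exact: esym (linearZ_LR (mkFl m q) k f).
rewrite mkFZ -[LHS]mkF_eta; congr (mkF _ _).
  apply/eqP; rewrite -subr_eq0; apply/eqP/ev_eq0 => z zi.
  rewrite linearB linearZ /= !linear_sum /=.
  rewrite (eq_bigr (fun i : 'I__ => (pathP z (rot i.+1 w))`_q)) => [|i _]; last by case: (HG i z zi).
  by rewrite coef_sum_pathP_rot fw // (size_word ww) subrr.
apply/ffunP => j; rewrite ffunE; apply: ev_eq0 => z zi.
rewrite linear_sum sum_ffunE linear_sum /=.
rewrite (eq_bigr (fun i : 'I__ => (((j : nat) == head 0 (rot i.+1 w))%:R
   - ((j : nat) == last 0 (rot i.+1 w))%:R) * (cycP z w)`_q.-1)) => [|i _].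
  by rewrite -mulr_suml (sum_head_last _ (fun x => ((j : nat) == x)%:R)) mul0r.
by case: (HG i z zi).
Qed.

Definition dlt m q (b : nat) (g : forest m q.-1) : {ffun 'I_(npar m q) -> forest m q.-1} :=
  [ffun j : 'I_(npar m q) => ((j : nat) == b)%:R *: g].
Arguments dlt {m} q b g.

Lemma dlt_is_linear m q b : linear (@dlt m q b).
Proof.
by move=> k f g; apply/ffunP => j; rewrite !ffunE scalerDr !scalerA [k * _]mulrC.
Qed.
HB.instance Definition _ m q b := GRing.isLinear.Build rat (forest m q.-1)
  {ffun 'I_(npar m q) -> forest m q.-1} *:%R (@dlt m q b) (@dlt_is_linear m q b).

(** If a word represents [g], inserting [m.+1] between two consecutive letters gives an attached
    part equal to [g] at the second letter minus [g] at the first. Adding these along the word,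
    rotated to start at 0, reaches every [b]. *)
Lemma spanned_dlt m q (U : {vspace forest m.+1 q}) : spanned m -> (0 < q <= m.+1)%N ->
    (forall w f, word m.+1 w -> represents f w -> f \in U) ->
  forall (g : forest m q.-1) b, cocycle g -> (b <= m)%N ->
  exists2 f, f \in U & attF f = dlt q b g - dlt q 0 g.
Proof.
move=> spm /andP[q0 qm] HU g b /cocyclesP cg bm.
have qm1 : (q.-1 <= m)%N by rewrite -ltnS prednK.
pose h : {linear forest m.+1 q -> {ffun 'I_(npar m q) -> forest m q.-1}} := @attF m q.
pose h' := linfun (@dlt m q b) - linfun (@dlt m q 0).
suff /subvP/(_ g cg) : (cocycles m q.-1 <= h' @^-1: (linfun h @: U))%VS.
  rewrite -memv_preim => /memv_imgP[f fU]; rewrite add_lfunE opp_lfunE !lfunE => E.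
  by exists f.
apply: spm => w0 {cg}g w0w gw0; rewrite -memv_preim.
have [w [ww gw w00]] : exists w, [/\ word m w, represents g w & head 1 w = 0]%N.
  exists (rot (index 0%N w0) w0); split; [exact: word_rot|exact: represents_rot|].
  by rewrite rot_index // (perm_mem w0w) mem_iota.
suff H i : (i < size w)%N -> exists2 f, f \in U & attF f = dlt q (nth 0%N w i) g - dlt q 0 g.
  have bw : b \in w by rewrite (perm_mem ww) mem_iota.
  have [|f fU fE] := H (index b w); first by rewrite index_mem.
  apply/memv_imgP; exists f => //.
  by rewrite add_lfunE opp_lfunE !lfunE /= fE nth_index.
elim: i => [|i IH] iw.
  exists 0; first exact: mem0v.
  by rewrite (_ : nth 0%N w 0 = 0%N) ?subrr //; case: (w) w00.
have [f fU fE] := IH (ltnW iw).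
have wi := word_rot i.+1 ww; have gwi := represents_rot i.+1 gw.
have [f' _ fr] := word_cocycle qm (word_cons wi).
exists (f + f'); first by rewrite memvD // (HU _ _ (word_cons wi) fr).
have -> : attF (f + f') = attF f + attF f' by [].
rewrite fE; suff -> : attF f' = dlt q (nth 0%N w i.+1) g - dlt q (nth 0%N w i) g.
  by rewrite addrC addrA subrK.
apply/ffunP => j; apply/eqP; rewrite -subr_eq0; apply/eqP/ev_eq0 => z zi.
have := gwi z zi; rewrite -(head_rot iw) -(last_rot (ltnW iw)).
case: (rot i.+1 w) wi fr => [/(@size_word m)//|x t] wi fr gE.
have [_ /(_ j) E] := represents_cons wi qm fr zi.
by rewrite !ffunE linearB /= E linearB !linearZ /= gE -mulrBl subrr.
Qed.

(** A family of sum 0 is the sum over [b] of [g b] placed at [b] minus [g b] placed at 0, since the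
    contributions at 0 add up to nothing. *)
Lemma spanned_attF m q (U : {vspace forest m.+1 q}) : spanned m -> (0 < q <= m.+1)%N ->
    (forall w f, word m.+1 w -> represents f w -> f \in U) ->
  forall g : {ffun 'I_(npar m q) -> forest m q.-1},
    (forall j, cocycle (g j)) -> \sum_j g j = 0 ->
  exists2 f, f \in U & attF f = g.
Proof.
move=> spm q0m HU g cg g0.
have H (b : 'I_(npar m q)) : exists v, v \in U /\ attF v = dlt q b (g b) - dlt q 0 (g b).
  have bm : (b <= m)%N by rewrite -ltnS lt_npar.
  by have [v] := spanned_dlt spm q0m HU (cg b) bm; exists v.
pose v b := projT1 (cid (H b)).
have vP b : v b \in U /\ attF (v b) = _ := projT2 (cid (H b)).
exists (\sum_b v b); first by apply: memv_suml => b _; case: (vP b).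
rewrite linear_sum /= (eq_bigr _ (fun b _ => (vP b).2)) sumrB -linear_sum.
rewrite g0 linear0 subr0; apply/ffunP => j; rewrite sum_ffunE (bigD1 j) //=.
rewrite ffunE eqxx scale1r big1 ?addr0 // => b bj.
by rewrite ffunE eq_sym (negPf (bj : (b : nat) != j)) scale0r.
Qed.

Lemma spanned0 : spanned 0.
Proof.
move=> q U HU; apply/subvP => f _; case: q U HU f => [|q] U HU f; last first.
  by rewrite (forest_gt f) ?mem0v.
pose e : forest 0 0 := const_mx 1 : 'rV_1.
have eU : e \in U.
  apply: (HU [:: 0%N]) => // z _; rewrite /= big_ord_recl big_ord0 addr0 mxE.
  by rewrite /cycP /= big_seq1 /edgeP /wt subrr invr0 scale0r addr0 coef1.
suff -> : f = (f : 'rV_1) 0 0 *: e by rewrite memvZ.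
by apply/rowP => j; rewrite !mxE mulr1 ord1.
Qed.

Lemma spannedS m : spanned m -> spanned m.+1.
Proof.
(* Inside the cocycles the correction [v] below is itself a cocycle, hence so is [f - v], to which
   [spanned_det] applies. *)
move=> spm q U0 HU0; pose U := (U0 :&: cocycles m.+1 q)%VS.
suff: (cocycles m.+1 q <= U)%VS by move/subv_trans; apply; exact: capvSl.
have HU w f : word m.+1 w -> represents f w -> f \in U.
  move=> ww fr; rewrite memv_cap (HU0 w) //=.
  have [qm|mq] := leqP q m.+1; last by rewrite (forest_gt f mq) mem0v.
  by have [g cg gr] := word_cocycle qm ww; rewrite (represents_inj fr gr); exact: (cocyclesP g).2 cg.
have UK : (U <= cocycles m.+1 q)%VS by exact: capvSr.
move: U HU UK => U HU UK {U0 HU0}.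
apply/subvP => f fK; have cf := (cocyclesP f).1 fK.
have [qm|mq] := leqP q m.+1; last by rewrite (forest_gt f mq) mem0v.
have [v vU vE] : exists2 v, v \in U & attF v = attF f.
  case: (posnP q) => [q0|q0].
    exists 0; first exact: mem0v.
    by apply/ffunP => j; exfalso; have := npar_gt0 j; rewrite q0.
  apply: spanned_attF => //; first by rewrite q0.
    by move=> b; exact: cocycle_attF_cocycle.
  exact: cocycle_attF.
rewrite -[f](subrK v) memvD // -[f - v]mkF_eta.
have a0 : attF (f - v) = 0 by rewrite linearB /= vE subrr.
rewrite a0; apply: spanned_det => //; apply/cocycle_mkF0; rewrite -a0 mkF_eta.
by apply/cocyclesP; rewrite memvB // (subvP UK).
Qed.

Lemma spanned_all m : spanned m.
Proof. by elim: m => [|m]; [exact: spanned0|exact: spannedS]. Qed.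

Lemma represents_cocycle m q w (f : forest m q) :
  word m w -> represents f w -> f \in cocycles m q.
Proof.
move=> ww fr; have [qm|mq] := leqP q m; last by rewrite (forest_gt f mq) mem0v.
have [g cg gr] := word_cocycle qm ww; rewrite (represents_inj fr gr).
exact: (cocyclesP g).2 cg.
Qed.

Lemma dim_cocycles_gt m q : (m < q)%N -> \dim (cocycles m q) = 0%N.
Proof.
move=> mq; apply/eqP; rewrite dimv_eq0 -subv0; apply/subvP => f _.
by rewrite (forest_gt f mq) mem0v.
Qed.

Lemma dim_cocycles_ker m q :
  \dim (cocycles m.+1 q :&: lker (linfun (@attF m q))) = \dim (cocycles m q).
Proof.
have -> : (cocycles m.+1 q :&: lker (linfun (@attF m q)) = linfun (@mkFl m q) @: cocycles m q)%VS.
  apply/vspaceP => f; rewrite memv_cap memv_ker lfunE; apply/andP/memv_imgP => [[fK /eqP f0]|].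
    exists (detF f); last by rewrite lfunE /= -f0 mkF_eta.
    by apply/cocyclesP/cocycle_mkF0; rewrite -f0 mkF_eta; exact: (cocyclesP f).1.
  move=> [g /cocyclesP cg ->]; rewrite lfunE; split; last exact: eqxx.
  exact/cocyclesP/cocycle_mkF0.
rewrite limg_dim_eq //; apply/eqP; rewrite -subv0; apply/subvP => f.
rewrite memv_cap memv_ker lfunE /= => /andP[_ /eqP/(congr1 (@detF m q)) f0].
by rewrite memv0; apply/eqP.
Qed.

(** The image of [attF] is the space of families of [m.+1] cocycles with sum 0, which gives [m]
    copies; surjectivity onto it is [spanned_attF] with [U] the space of all cocycles. *)
Lemma dim_cocyclesS m q : (0 < q <= m.+1)%N ->
  \dim (cocycles m.+1 q) = (\dim (cocycles m q) + m * \dim (cocycles m q.-1))%N.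
Proof.
move=> q0m; rewrite -(limg_ker_dim (linfun (@attF m q))) dim_cocycles_ker; congr (_ + _)%N.
have [W [WP dimW]] := @ffun_vspace 'I_(npar m q) _ (cocycles m q.-1).
pose S (g : {ffun 'I_(npar m q) -> forest m q.-1}) := \sum_j g j.
have S_lin : linear S.
  move=> k f g; rewrite /S scaler_sumr -big_split; apply: eq_bigr => j _ /=.
  by rewrite !ffunE.
pose Sl : {linear _ -> _} := HB.pack S (GRing.isLinear.Build _ _ _ _ S S_lin).
have -> : (linfun (@attF m q) @: cocycles m.+1 q = W :&: lker (linfun Sl))%VS.
  apply/vspaceP => g; rewrite memv_cap memv_ker [linfun Sl g]lfunE /=.
  apply/memv_imgP/andP => [[f fK ->]|[/WP gW /eqP gS]].
    have cf : @cocycle m.+1 q f := (@cocyclesP m.+1 q f).1 fK.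
    rewrite lfunE; split; last exact/eqP/cocycle_attF.
    by apply/WP => j; apply: (cocyclesP _).2; exact: cocycle_attF_cocycle.
  have cg j : cocycle (g j) := (cocyclesP _).1 (gW j).
  have [f fK fE] := spanned_attF (@spanned_all m) q0m (@represents_cocycle m.+1 q) cg gS.
  by exists f; rewrite ?lfunE.
have imS : (linfun Sl @: W = cocycles m q.-1)%VS.
  apply/vspaceP => g; apply/memv_imgP/idP => [[h /WP hW ->]|gK].
    by rewrite lfunE; apply: memv_suml => j _.
  exists (dlt q 0 g).
    by apply/WP => j; rewrite ffunE memvZ.
  rewrite lfunE /= /S; case: q q0m {W WP dimW S S_lin Sl} g gK => [//|q] _ g _.
  rewrite (bigD1 ord0) //= ffunE eqxx scale1r big1 ?addr0 // => j.
  by rewrite ffunE -val_eqE /= => /negPf->; rewrite scale0r.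
have nE : npar m q = m.+1 by case: (q) q0m.
rewrite card_ord [X in (X * _)%N]nE mulSn in dimW.
by have := limg_ker_dim (linfun Sl) W; rewrite imS dimW addnC => /addnI.
Qed.

Lemma stirling1_gt m k : (m < k)%N -> stirling1 m k = 0%N.
Proof.
elim: m k => [|m IH] [|k] //=; rewrite ltnS => mk.
by rewrite !IH ?muln0 // ltnW.
Qed.

Lemma dim_cocycles m q : (q <= m)%N -> \dim (cocycles m q) = stirling1 m (m - q).
Proof.
elim: m q => [|m IH] q.
  rewrite leqn0 => /eqP->; have -> : cocycles 0 0 = fullv.
    by apply/vspaceP => f; rewrite memvf; apply/cocyclesP.
  by rewrite dimvf.
case: q => [_|q qm].
  rewrite -(limg_ker_dim (linfun (@attF m 0))) dim_cocycles_ker IH // !subn0 /=.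
  rewrite (@stirling1_gt m m.+1) // muln0 add0n; apply/eqP; rewrite -[X in _ == X]addn0 eqn_add2l.
  rewrite dimv_eq0 -subv0; apply/subvP => g _; rewrite memv0; apply/eqP/ffunP => j.
  by case: j.
rewrite dim_cocyclesS // subSS /= (IH q) // [LHS]addnC; congr (_ + _)%N.
have [qm'|mq] := ltnP q m.
  by rewrite IH // -(subnSK qm').
(* Here [q = m]: no forest on the points 0, ..., m has [m.+1] edges, which matches the zero branch
   of [stirling1]. *)
have -> : (m - q = 0)%N by apply/eqP.
by rewrite dim_cocycles_gt.
Qed.

(** * The multiplicity as the dimension of the cocycles *)

Section HighestWeightDimension.
Variables (N p q : nat).
Hypothesis pqN : (p + q = N)%N.
Local Notation ext := (ext N.+1).
Local Notation Idl := (Ideal N.+1 : {vspace ext}).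
Local Notation K := (Kx N.+1 p q : {vspace ext}).
Local Notation Gl := (linfun (@G N N q)).

(** One inclusion straightens the elements of [Kx]; for the other it suffices, by [spanned_all], to
    lift the forests of cyclic words. Only here does it emerge that the cocycle conditions are
    sufficient for closedness. *)
Lemma Kx_cocycles : (K + Idl = Gl @: cocycles N q + Idl)%VS.
Proof.
apply/eqP; rewrite eqEsubv !subv_add !addvSr !andbT; apply/andP; split.
  apply/subvP => u /(Kx_normal pqN)[f cf uf]; rewrite -[u](subrK (G N f)) addrC.
  by apply: memv_add => //; rewrite -[G N f]lfunE memv_img //; exact/cocyclesP.
suff /subvP sK : (cocycles N q <= Gl @^-1: (K + Idl))%VS.
  by apply/subvP => _ /memv_imgP[f /sK + ->]; rewrite memv_preim.
apply: spanned_all => w f wN fw; rewrite -memv_preim lfunE /=.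
have [g [_ gw [u uK ug]]] := word_lift pqN wN; rewrite (represents_inj fw gw).
by rewrite -(subKr u (G N g)); apply: memv_add uK _; rewrite memvN.
Qed.

Lemma cocycles_Ideal : (Gl @: cocycles N q :&: Idl = 0)%VS.
Proof.
apply/eqP; rewrite -subv0; apply/subvP => _ /memv_capP[/memv_imgP[f _ ->]].
by rewrite lfunE => /G_Ideal_eq0->; rewrite linear0 mem0v.
Qed.

Lemma dim_Gl : \dim (Gl @: cocycles N q) = \dim (cocycles N q).
Proof.
apply: limg_dim_eq; apply/eqP; rewrite -subv0; apply/subvP => f /memv_capP[_].
rewrite memv_ker lfunE => /eqP Gf; rewrite memv0; apply/eqP/G_Ideal_eq0.
by rewrite [G N f]Gf mem0v.
Qed.

Lemma e3_cocycles : e3 N.+1 p q p = \dim (cocycles N q).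
Proof.
have E : (\dim (K + Idl) + \dim (K :&: Idl) = \dim K + \dim Idl)%N by exact: dimv_sum_cap.
have E' : (\dim (K + Idl) = \dim (cocycles N q) + \dim Idl)%N.
  by rewrite Kx_cocycles -dim_Gl -dimv_sum_cap cocycles_Ideal dimv0 addn0.
have aux (a b c e f : nat) : (a + b = c + e -> a = f + e -> c - b = f)%N by lia.
by rewrite e3_Kx; exact: aux E E'.
Qed.
End HighestWeightDimension.

Theorem theorem3p11 (p q : nat) :
  e3 (p + q + 1) p q p = stirling1 (p + q) p.
Proof.
rewrite addn1 (e3_cocycles erefl) dim_cocycles ?leq_addl //.
by rewrite addnK.
Qed.
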